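(* Fix $\tau\in\mathbb R$ and $0<\varphi<\pi$. The operator $$\mathcal L f(s)=i(1/2-is)f(s+i)+2(s-\tau)\cos\varphi\,f(s)-i(1/2+is-2i\tau)f(s-i)$$ in $L^2(\mathbb R,ds)$, defined on the subspace $\mathcal V$, is not self-adjoint. Its defect indices are $(1,1)$.
   Context: $\mathcal V$ is the space of functions $f$ holomorphic in the closed strip $|\operatorname{Im}s|\le1$ (i.e. holomorphic in $|\operatorname{Im}s|<1+\delta$ for some $\delta>0$) such that, for some $\varepsilon>0$, $|f(s)|=O(|\operatorname{Re}s|^{-3/2-\varepsilon})$ as $|\operatorname{Re}s|\to\infty$ in this strip. The operator $\mathcal L$ is symmetric on $\mathcal V$; its defect indices are $(\dim\ker(\mathcal L^*-i),\dim\ker(\mathcal L^*+i))$. *)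

(* Defs.v *)
From HB Require Import structures.
From mathcomp Require Import all_boot all_order all_algebra complex.
From mathcomp Require Import all_classical all_reals all_analysis.

Set Implicit Arguments.
Unset Strict Implicit.
Unset Printing Implicit Defensive.
Import Order.TTheory GRing.Theory Num.Theory.
Import numFieldNormedType.Exports.
Local Open Scope classical_set_scope.
Local Open Scope ring_scope.
Local Open Scope complex_scope.

(* Elements of the complex Hilbert space L^2(R, ds) are represented by functions
   R -> R[i], equality in L^2 being equality almost everywhere. *)
Section L2.
Context {R : realType}.
Implicit Types (u v w g h : R -> R[i]).

Definition ae_equal u v : Prop :=
  {ae (@lebesgue_measure R), forall x, u x = v x}.

Definition L2 : set (R -> R[i]) :=
  [set u | ((fun x => complex.Re (u x)) \in Lfun (@lebesgue_measure R) 2%:E) /\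
           ((fun x => complex.Im (u x)) \in Lfun (@lebesgue_measure R) 2%:E)].

Definition cintegral (u : R -> R[i]) : R[i] :=
  (\int[@lebesgue_measure R]_x complex.Re (u x))%R
  +i* (\int[@lebesgue_measure R]_x complex.Im (u x))%R.

Definition L2_dot u v : R[i] := cintegral (fun x => u x * (v x)^*).

(* An unbounded operator is represented by its graph, saturated for equality
   almost everywhere. *)
Definition op_graph : Type := set ((R -> R[i]) * (R -> R[i])).

Definition adjoint (A : op_graph) : op_graph :=
  [set gh | [/\ L2 gh.1, L2 gh.2 &
    forall u w, A (u, w) -> L2_dot w gh.1 = L2_dot u gh.2]].

Definition self_adjoint (A : op_graph) : Prop :=
  A = adjoint A.

(* The kernel of A - lambda: pairs (g, lambda g) in the graph. *)
Definition ker_sub (A : op_graph) (lambda : R[i]) : set (R -> R[i]) :=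
  [set g | A (g, fun x => lambda * g x)].

(* Complex dimension in L^2, i.e. modulo equality almost everywhere. *)
Definition has_dim (S : set (R -> R[i])) (n : nat) : Prop :=
  exists e : 'I_n -> R -> R[i],
    [/\ forall k, S (e k),
        forall c : 'I_n -> R[i],
          ae_equal (fun x => \sum_k c k * e k x) (fun=> 0) -> forall k, c k = 0
      & forall g, S g -> exists c : 'I_n -> R[i],
          ae_equal g (fun x => \sum_k c k * e k x)].

Definition has_defect_indices (A : op_graph) (n m : nat) : Prop :=
  has_dim (ker_sub (adjoint A) 'i) n /\
  has_dim (ker_sub (adjoint A) (- 'i)) m.

End L2.

Section Operator.
Context {R : realType}.

(* Functions on the strip are total functions on R[i] with arbitrary values
   outside it; derivability over the field R[i] is complex differentiability. *)
Definition holomorphic_on (D : set R[i]) (f : R[i] -> R[i]) : Prop :=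
  forall s, D s -> derivable (f : R[i]^o -> R[i]^o) s 1.

Definition spaceV : set (R[i] -> R[i]) :=
  [set f | (exists2 delta : R, 0 < delta &
              holomorphic_on [set s | `|complex.Im s| < 1 + delta] f) /\
           (exists2 eps : R, 0 < eps &
              exists C M : R, forall s : R[i],
                `|complex.Im s| <= 1 -> M <= `|complex.Re s| ->
                `|f s| <= (C * `|complex.Re s| `^ (- (3 / 2) - eps))%:C)].

Definition difference_op (tau phi : R) (f : R[i] -> R[i]) (s : R[i]) : R[i] :=
  'i * (1 / 2 - 'i * s) * f (s + 'i)
  + 2 * (s - tau%:C) * (cos phi)%:C * f s
  - 'i * (1 / 2 + 'i * s - 2 * 'i * tau%:C) * f (s - 'i).

(* The operator difference_op with domain the restrictions to R of spaceV. *)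
Definition opL (tau phi : R) : @op_graph R :=
  [set uw | [/\ L2 uw.1, L2 uw.2 &
    exists2 f, spaceV f &
      ae_equal uw.1 (fun x => f x%:C) /\
      ae_equal uw.2 (fun x => difference_op tau phi f x%:C)]].

End Operator.

(* Main.v *)
(** With [f = ft F], that is [f s = \int F t * e^(i s t) dt], the shifts of [s] by [i] and [-i] become
multiplication by [e^-t] and [e^t], and the difference operator becomes a first-order differential
operator. Correspondingly, for [kappa = 1] and [kappa = -1] the equation [L^* g = i kappa g] is solved
by the function [g] whose conjugate is [\int EE t * e^(- i s t) dt], where [EE] is an explicit integrable
solution of a first-order linear equation; that [g] is in the kernel follows by moving the line of
integration of functions in [spaceV].

Conversely, if [H] is C^1 with compact support and [\int H * EE = 0], then the first-order equation has a
compactly supported C^2 solution [F]; its transform [f] lies in [spaceV] and [(L + i kappa) f = i ft H].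
Hence every [g] in the kernel annihilates the [ft H] for all [H] in a hyperplane. Rescaled and
translated transforms of a bump are an approximate identity, so the [ft H] are total in L^2, and [g] is
determined up to a scalar. If [L] were self-adjoint, the nonzero solution for [kappa = 1] would be an
eigenvector of a symmetric operator for the eigenvalue [i]. *)
Require Import Defs.
From mathcomp Require Import all_boot all_order all_algebra complex.
From mathcomp Require Import all_classical all_reals all_analysis.
From mathcomp Require Import measurable_realfun ring lra.

Set Implicit Arguments.
Unset Strict Implicit.
Unset Printing Implicit Defensive.
Import Order.TTheory GRing.Theory Num.Theory.
Import numFieldNormedType.Exports.
Import ComplexField.Normc.
Local Open Scope classical_set_scope.
Local Open Scope ring_scope.
Local Open Scope complex_scope.
Local Notation Re := complex.Re.
Local Notation Im := complex.Im.

(** * Integration and differentiation of complex-valued functions *)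

Section ComplexBasics.
Context {R : realType}.
Implicit Types (z w : R[i]) (a b x y : R).

(** The coefficients of the operator have degree one in [s], which is why the transformed equation
    has order one. Its leading coefficient [e^t + e^-t + 2 cos phi] never vanishes because 0 < phi <
    pi, and [kappa] enters the modulus of the solution only through a bounded arctangent factor. So
    for either sign of [kappa] the solution decays like e^(-|t|/2) at both ends: this is the source
    of the symmetry of the two indices. The same decay is the obstacle that shapes the existence
    proof. The integral defining the transform of [EE] converges absolutely only for |Im s| < 1/2,
    too narrow a strip for shifts by i and -i. The shifts are therefore carried out on the function
    in [spaceV], holomorphic on the closed strip, after Fubini has moved the transform onto it.
    Totality rests on a single kernel, the transform of a bump. Its integral has to be nonzero; the
    exact value given by Fourier inversion is replaced by a lower bound obtained from Abel damping.
    Membership in L^2 is likewise read off from pointwise decay, one derivative at a time, instead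
    of from Plancherel. *)

Lemma complexP z w : Re z = Re w -> Im z = Im w -> z = w.
Proof. by case: z w => [a b] [c d] /= -> ->. Qed.

Lemma cReD z w : Re (z + w) = Re z + Re w. Proof. by case: z w => [a b] [c d]. Qed.
Lemma cImD z w : Im (z + w) = Im z + Im w. Proof. by case: z w => [a b] [c d]. Qed.
Lemma cReN z : Re (- z) = - Re z. Proof. by case: z. Qed.
Lemma cImN z : Im (- z) = - Im z. Proof. by case: z. Qed.
Lemma cReM z w : Re (z * w) = Re z * Re w - Im z * Im w.
Proof. by case: z w => [a b] [c d]. Qed.
Lemma cImM z w : Im (z * w) = Re z * Im w + Im z * Re w.
Proof. by case: z w => [a b] [c d]. Qed.
Lemma cReC z : Re z^* = Re z. Proof. by case: z. Qed.
Lemma cImC z : Im z^* = - Im z. Proof. by case: z. Qed.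
Lemma cRe0 : Re (0 : R[i]) = 0. Proof. by []. Qed.
Lemma cIm0 : Im (0 : R[i]) = 0. Proof. by []. Qed.
Lemma cRe1 : Re (1 : R[i]) = 1. Proof. by []. Qed.
Lemma cIm1 : Im (1 : R[i]) = 0. Proof. by []. Qed.
Lemma cReMn z n : Re (z *+ n) = Re z *+ n.
Proof. by elim: n => [|n ih]; rewrite ?mulr0n// !mulrS cReD ih. Qed.
Lemma cImMn z n : Im (z *+ n) = Im z *+ n.
Proof. by elim: n => [|n ih]; rewrite ?mulr0n// !mulrS cImD ih. Qed.

Definition ReImE := (cReD, cImD, cReN, cImN, cReM, cImM, cReC, cImC, cReMn, cImMn, cRe0, cIm0, cRe1, cIm1).

(** The norm of [R[i]] takes values in [R[i]]; estimates are made with the real number [normc z],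
    and this equation is the bridge. *)
Lemma normcE z : `|z| = (normc z)%:C. Proof. by []. Qed.

Lemma normc_ge0 z : 0 <= normc z.
Proof. by case: z => a b; exact: sqrtr_ge0. Qed.

Lemma normc_sqr z : normc z ^+ 2 = Re z ^+ 2 + Im z ^+ 2.
Proof. by case: z => a b /=; rewrite sqr_sqrtr// addr_ge0 ?sqr_ge0. Qed.

Lemma normcD z w : normc (z + w) <= normc z + normc w.
Proof. by have := ler_normD z w; rewrite !normcE -rmorphD/= lecR. Qed.

Lemma normcN z : normc (- z) = normc z.
Proof. by case: z => a b /=; rewrite !sqrrN. Qed.

Lemma normcB z w : normc (z - w) <= normc z + normc w.
Proof. by rewrite -(normcN w) normcD. Qed.

Lemma normc_real a : normc a%:C = `|a|.
Proof. by rewrite /= expr0n/= addr0 sqrtr_sqr. Qed.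

Lemma le_Re_normc z : `|Re z| <= normc z.
Proof. by rewrite -(ler_pXn2r (_ : 0 < 2)%N)// ?nnegrE ?normc_ge0//
  normc_sqr real_normK ?num_real// lerDl sqr_ge0. Qed.

Lemma le_Im_normc z : `|Im z| <= normc z.
Proof. by rewrite -(ler_pXn2r (_ : 0 < 2)%N)// ?nnegrE ?normc_ge0//
  normc_sqr real_normK ?num_real// lerDr sqr_ge0. Qed.

Lemma normc_le_ReIm z : normc z <= `|Re z| + `|Im z|.
Proof.
have -> : z = (Re z)%:C + 'i * (Im z)%:C by case: z => a b; apply: complexP; rewrite !ReImE/=; ring.
apply: le_trans (normcD _ _) _; rewrite normcM !normc_real !ReImE /=.
rewrite expr0n/= expr1n add0r sqrtr1 !(mul0r, mul1r, mulr0, mulr1, addr0, add0r, subr0, sub0r, oppr0).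
by [].
Qed.

Lemma normcX z n : normc (z ^+ n) = normc z ^+ n.
Proof. by elim: n => [|n ih]; rewrite ?expr0 ?normc1// !exprS normcM ih. Qed.

Lemma conjcM z w : conjc (z * w) = conjc z * conjc w.
Proof. by apply: complexP; rewrite !ReImE; ring. Qed.

Lemma conjc_inj z w : z^* = w^* -> z = w.
Proof. by move=> /(congr1 conjc); rewrite !conjcK. Qed.

End ComplexBasics.

Section ComplexIntegral.
Context {R : realType}.
Local Notation mu := (@lebesgue_measure R).
Implicit Types (f g : R -> R[i]) (D : set R).

Definition cintegrable D f :=
  mu.-integrable D (EFin \o (fun x => Re (f x))) /\
  mu.-integrable D (EFin \o (fun x => Im (f x))).

Definition cint D f : R[i] :=
  (\int[mu]_(x in D) Re (f x)) +i* (\int[mu]_(x in D) Im (f x)).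

Definition cmeasurable D f :=
  measurable_fun D (fun x => Re (f x)) /\ measurable_fun D (fun x => Im (f x)).

Lemma cintegralE f : cintegral f = cint setT f. Proof. by []. Qed.

Lemma integrable_real_dom D (f g : R -> R) : measurable D ->
  measurable_fun D f -> mu.-integrable D (EFin \o g) ->
  (forall x, D x -> `|f x| <= g x) -> mu.-integrable D (EFin \o f).
Proof.
move=> mD mf ig fg; apply: le_integrable ig => //.
  exact/measurable_EFinP.
move=> x Dx; rewrite /= lee_fin; apply: (le_trans (fg x Dx)).
exact: ler_norm.
Qed.

Lemma integrable_realD D (f g : R -> R) : measurable D ->
  mu.-integrable D (EFin \o f) -> mu.-integrable D (EFin \o g) ->
  mu.-integrable D (EFin \o (fun x => f x + g x)).
Proof.
by move=> mD f1 g1; apply: eq_integrable (integrableD _ f1 g1).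
Qed.

Lemma integrable_realZ D (k : R) (f : R -> R) : measurable D ->
  mu.-integrable D (EFin \o f) -> mu.-integrable D (EFin \o (fun x => k * f x)).
Proof.
by move=> mD f1; apply: eq_integrable (integrableZl _ k f1).
Qed.

Lemma cintegrable_dom D f (g : R -> R) : measurable D ->
  cmeasurable D f -> mu.-integrable D (EFin \o g) ->
  (forall x, D x -> normc (f x) <= g x) -> cintegrable D f.
Proof.
move=> mD [m1 m2] ig fg; split; apply: integrable_real_dom ig _ => // x Dx;
  apply: le_trans (fg x Dx); [exact: le_Re_normc|exact: le_Im_normc].
Qed.

Lemma cintegrable_measurable D f : cintegrable D f -> cmeasurable D f.
Proof.
by move=> [/integrableP[+ _] /integrableP[+ _]] => /measurable_EFinP ? /measurable_EFinP ?.
Qed.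

Lemma cintegrable_ext D f g : measurable D -> (forall x, D x -> f x = g x) ->
  cintegrable D f -> cintegrable D g.
Proof.
move=> mD fg [h1 h2]; split; [apply: eq_integrable h1|apply: eq_integrable h2] => // x /set_mem Dx /=;
  by rewrite fg.
Qed.

Lemma cint_ext D f g : (forall x, D x -> f x = g x) -> cint D f = cint D g.
Proof.
by move=> fg; congr (_ +i* _); apply: eq_Rintegral => x /set_mem Dx; rewrite fg.
Qed.

Lemma cintegrableD D f g : measurable D -> cintegrable D f -> cintegrable D g ->
  cintegrable D (fun x => f x + g x).
Proof.
move=> mD [f1 f2] [g1 g2]; split; under eq_fun do rewrite ReImE; exact: integrable_realD.
Qed.

Lemma cintegrableZ D (c : R[i]) f : measurable D -> cintegrable D f ->
  cintegrable D (fun x => c * f x).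
Proof.
move=> mD [f1 f2]; split.
  have -> : (fun x => Re (c * f x)) = (fun x => Re c * Re (f x) + (- Im c) * Im (f x)).
    by apply/funext => x; rewrite !ReImE; ring.
  by apply: integrable_realD => //; exact: integrable_realZ.
have -> : (fun x => Im (c * f x)) = (fun x => Re c * Im (f x) + Im c * Re (f x)).
  by apply/funext => x; rewrite !ReImE; ring.
by apply: integrable_realD => //; exact: integrable_realZ.
Qed.

Lemma cintegrableB D f g : measurable D -> cintegrable D f -> cintegrable D g ->
  cintegrable D (fun x => f x - g x).
Proof.
move=> mD hf hg; have := cintegrableD mD hf (cintegrableZ (-1) mD hg).
by apply: cintegrable_ext => // x _; rewrite mulN1r.
Qed.

Lemma cintD D f g : measurable D -> cintegrable D f -> cintegrable D g ->
  cint D (fun x => f x + g x) = cint D f + cint D g.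
Proof.
move=> mD [f1 f2] [g1 g2]; apply: complexP; rewrite !ReImE /=.
  by under eq_Rintegral do rewrite !ReImE; rewrite RintegralD.
by under eq_Rintegral do rewrite !ReImE; rewrite RintegralD.
Qed.

Lemma cintZ D c f : measurable D -> cintegrable D f ->
  cint D (fun x => c * f x) = c * cint D f.
Proof.
move=> mD [f1 f2]; apply: complexP; rewrite !ReImE /=.
  under eq_Rintegral do rewrite !ReImE.
  by rewrite RintegralB//; rewrite ?RintegralZl//; exact: integrable_realZ.
under eq_Rintegral do rewrite !ReImE.
by rewrite RintegralD//; rewrite ?RintegralZl//; exact: integrable_realZ.
Qed.

Lemma cintZr D c f : measurable D -> cintegrable D f ->
  cint D (fun x => f x * c) = cint D f * c.
Proof.
by move=> mD hf; rewrite mulrC -cintZ//; apply: cint_ext => x _; rewrite mulrC.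
Qed.

Lemma cintB D f g : measurable D -> cintegrable D f -> cintegrable D g ->
  cint D (fun x => f x - g x) = cint D f - cint D g.
Proof.
move=> mD hf hg; rewrite -[X in _ = _ + X]mulN1r -cintZ// -cintD//.
  by apply: cint_ext => x _; rewrite mulN1r.
exact: cintegrableZ.
Qed.

Lemma cint_real D (f : R -> R) : cint D (fun x => (f x)%:C) = (\int[mu]_(x in D) f x)%:C.
Proof. by apply: complexP => //=; rewrite /Rintegral integral0. Qed.

Lemma cint0 D : cint D (fun=> 0) = 0.
Proof.
by apply: complexP => /=; rewrite (_ : (fun=> _) = cst 0)// /Rintegral integral0.
Qed.

(** The factor 2 comes from bounding the real and the imaginary part separately, each by the
    integral of [b]. *)
Lemma le_normc_cint D f (b : R -> R) : measurable D -> cintegrable D f ->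
  mu.-integrable D (EFin \o b) -> (forall x, D x -> normc (f x) <= b x) ->
  normc (cint D f) <= 2 * \int[mu]_(x in D) b x.
Proof.
move=> mD [f1 f2] ib fb; apply: (le_trans (normc_le_ReIm _)) => /=.
rewrite mulr_natl mulr2n; apply: lerD.
  apply: le_trans (le_normr_Rintegral _ _) _ => //; apply: le_Rintegral => //.
    exact: integrable_norm.
  by move=> x Dx; apply: le_trans (fb x Dx); exact: le_Re_normc.
apply: le_trans (le_normr_Rintegral _ _) _ => //; apply: le_Rintegral => //.
  exact: integrable_norm.
by move=> x Dx; apply: le_trans (fb x Dx); exact: le_Im_normc.
Qed.

Lemma Rintegral_dominated_cvg D (f_ : nat -> R -> R) (f g : R -> R) : measurable D ->
  (forall n, measurable_fun D (f_ n)) -> measurable_fun D f ->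
  (forall x, D x -> f_ n x @[n --> \oo] --> f x) ->
  mu.-integrable D (EFin \o g) -> (forall n x, D x -> `|f_ n x| <= g x) ->
  (\int[mu]_(x in D) f_ n x)%R @[n --> \oo] --> (\int[mu]_(x in D) f x)%R.
Proof.
move=> mD mf_ mf ff ig fg.
have [] := @dominated_convergence _ _ R mu D mD (fun n => EFin \o f_ n) (EFin \o f) (EFin \o g).
- by move=> n; exact/(measurable_EFinP D (f_ n)).
- exact/(measurable_EFinP D f).
- by apply: aeW => x Dx; apply: cvg_EFin; [exact: nearW|exact: ff].
- exact: ig.
- by apply: aeW => x n Dx; rewrite lee_fin fg.
move=> i1 _ cv; apply: fine_cvg; rewrite fineK; first exact: cv.
exact: integrable_fin_num.
Qed.

(** Dominated convergence for truncations. This is the passage from compact intervals, where the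
    fundamental theorem and Cauchy's theorem live, to the whole line. *)
Lemma Rintegral_sym_cvg (f : R -> R) : mu.-integrable setT (EFin \o f) ->
  (\int[mu]_(x in `[- n%:R, n%:R]) f x)%R @[n --> \oo] --> (\int[mu]_x f x)%R.
Proof.
move=> fi; have mf : measurable_fun setT f by move/integrableP: fi => [/measurable_EFinP].
have -> : (fun n : nat => \int[mu]_(x in `[- n%:R, n%:R]) f x) =
    (fun n : nat => \int[mu]_x (f \_ `[- n%:R, n%:R]) x).
  by apply/funext => n; rewrite Rintegral_mkcond.
apply: (@Rintegral_dominated_cvg _ _ _ (fun x => `|f x|)) => //.
- by move=> n; apply/(measurable_restrictT _ _).1 => //; exact: measurable_funTS.
- move=> x _; apply: cvg_near_cst.
  exists (Num.truncn `|x|).+1 => // n /= xn.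
  rewrite patchE ifT// inE/= in_itv/= -ler_norml.
  apply: ltW; apply: (lt_le_trans (truncnS_gt _)).
  by rewrite ler_nat.
- exact: integrable_norm.
- by move=> n x _; rewrite patchE /=; case: ifP => // _; rewrite normr0.
Qed.
End ComplexIntegral.

(** * Calculus on the real line and three integrable weights *)

Section RealCalculus.
Context {R : realType}.
Local Notation mu := (@lebesgue_measure R).
Implicit Types (f g : R -> R) (x a b : R).

Lemma is_deriv_cst (a x : R) : is_derive x (1 : R) (fun=> a) 0.
Proof. exact: is_derive_cst. Qed.

Lemma is_deriv_id x : is_derive x (1 : R) (fun t => t) 1.
Proof. exact: is_derive_id. Qed.

Lemma is_deriv_add f g x a b : is_derive x (1 : R) f a -> is_derive x (1 : R) g b ->
  is_derive x (1 : R) (fun t => f t + g t) (a + b).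
Proof. by move=> h1 h2; exact: is_deriveD. Qed.

Lemma is_deriv_sub f g x a b : is_derive x (1 : R) f a -> is_derive x (1 : R) g b ->
  is_derive x (1 : R) (fun t => f t - g t) (a - b).
Proof. by move=> h1 h2; exact: is_deriveB. Qed.

Lemma is_deriv_opp f x a : is_derive x (1 : R) f a ->
  is_derive x (1 : R) (fun t => - f t) (- a).
Proof. by move=> h1; exact: is_deriveN. Qed.

Lemma is_deriv_mul f g x a b : is_derive x (1 : R) f a -> is_derive x (1 : R) g b ->
  is_derive x (1 : R) (fun t => f t * g t) (a * g x + f x * b).
Proof.
move=> h1 h2; apply: (is_derive_eq (is_deriveM h1 h2)).
by rewrite /GRing.scale /= addrC mulrC.
Qed.

Lemma is_deriv_comp f g x a b : is_derive (g x) (1 : R) f a -> is_derive x (1 : R) g b ->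
  is_derive x (1 : R) (fun t => f (g t)) (a * b).
Proof. by move=> h1 h2; exact: is_derive1_comp. Qed.

Lemma is_deriv_expR f x a : is_derive x (1 : R) f a ->
  is_derive x (1 : R) (fun t => expR (f t)) (a * expR (f x)).
Proof.
move=> h; have := is_deriv_comp (is_derive_expR (f x)) h; by rewrite mulrC.
Qed.

Lemma is_deriv_ln f x a : 0 < f x -> is_derive x (1 : R) f a ->
  is_derive x (1 : R) (fun t => ln (f t)) (a / f x).
Proof.
by move=> fx h; have := is_deriv_comp (is_derive1_ln fx) h; rewrite mulrC.
Qed.

Lemma is_deriv_atan f x a : is_derive x (1 : R) f a ->
  is_derive x (1 : R) (fun t => atan (f t)) (a / (1 + f x ^+ 2)).
Proof.
by move=> h; have := is_deriv_comp (is_derive1_atan (f x)) h; rewrite mulrC.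
Qed.

Lemma is_deriv_cos f x a : is_derive x (1 : R) f a ->
  is_derive x (1 : R) (fun t => cos (f t)) (- (a * sin (f x))).
Proof.
by move=> h; have := is_deriv_comp (is_derive_cos (f x)) h; rewrite mulNr mulrC.
Qed.

Lemma is_deriv_sin f x a : is_derive x (1 : R) f a ->
  is_derive x (1 : R) (fun t => sin (f t)) (a * cos (f x)).
Proof.
by move=> h; have := is_deriv_comp (is_derive_sin (f x)) h; rewrite mulrC.
Qed.

Lemma is_deriv_eq f x a b : is_derive x (1 : R) f a -> a = b -> is_derive x (1 : R) f b.
Proof. by move=> h <-. Qed.

Lemma is_deriv_scale c x : is_derive x (1 : R) (fun t => c * t) c.
Proof. by apply: is_deriv_eq (is_deriv_mul (is_deriv_cst c x) (is_deriv_id x)) _; ring. Qed.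

Lemma is_deriv_continuous f (f' : R -> R) :
  (forall x, is_derive x (1 : R) f (f' x)) -> continuous f.
Proof.
move=> h x; apply: differentiable_continuous; apply/derivable1_diffP.
by have [] := h x.
Qed.

(** A second-order remainder on |h| <= 1 forces the difference quotient to converge. This serves the
    powers of the positive part, whose derivative at 0 does not follow from the rules of
    calculus. *)
Lemma is_deriv_quadratic f x a (C : R) :
  (forall h, `|h| <= 1 -> `|f (x + h) - f x - a * h| <= C * h ^+ 2) ->
  is_derive x (1 : R) f a.
Proof.
move=> H.
have C0 : 0 <= C.
  have := H 1; rewrite normr1 lexx expr1n !mulr1 => /(_ isT) hC; exact: le_trans (normr_ge0 _) hC.
suff cv : (fun h : R => h^-1 *: ((f \o shift x) (h *: (1 : R)) - f x)) @ 0^' --> a.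
  split; first by apply/cvg_ex; exists a.
  exact/cvg_lim.
apply/cvgrPdist_le => /= e e0; near=> h.
have h0 : h != 0 by near: h; exact: nbhs_dnbhs_neq.
have h1 : `|h| <= 1.
  near: h; apply: dnbhs0_le; exact: ltr01.
have h2 : `|h| <= e / (C + 1).
  by near: h; apply: dnbhs0_le; rewrite divr_gt0// ltr_wpDl.
rewrite /= [h *: 1]mulr1 /GRing.scale /= (addrC h x).
have -> : a - h^-1 * (f (x + h) - f x) = - (h^-1 * (f (x + h) - f x - a * h)).
  by field.
rewrite normrN normrM normfV ler_pdivrMl ?normr_gt0//.
apply: le_trans (H h h1) _.
rewrite -(real_normK (num_real h)) expr2 mulrCA ler_wpM2l//.
have : C * `|h| <= (C + 1) * `|h| by rewrite ler_wpM2r// lerDl.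
move/le_trans; apply; rewrite mulrC -ler_pdivlMr//; by rewrite ltr_wpDl.
Unshelve. all: end_near. Qed.

Lemma continuous_within (f : R -> R) (A : set R) : continuous f -> {within A, continuous f}.
Proof. exact: continuous_subspaceT. Qed.

Lemma continuous_integrable_itv f a b : continuous f ->
  mu.-integrable `[a, b] (EFin \o f).
Proof.
move=> cf; apply: continuous_compact_integrable; first exact: segment_compact.
exact: continuous_within.
Qed.

Lemma Rintegral_deriv f (f' : R -> R) a b : a <= b ->
  (forall x, is_derive x (1 : R) f (f' x)) -> continuous f' ->
  \int[mu]_(x in `[a, b]) f' x = f b - f a.
Proof.
rewrite le_eqVlt => /predU1P[<- _ _|ab df cf'].
  by rewrite set_itv1 Rintegral_set1 subrr.
have cf := is_deriv_continuous df.
rewrite /Rintegral (@continuous_FTC2 _ f' f)//; first exact: continuous_within.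
- split; [by move=> x _; have [] := df x|exact: cvg_at_right_filter (cf a)|exact: cvg_at_left_filter (cf b)].
- by move=> x _; rewrite derive1E; have [] := df x.
Qed.

Lemma Rintegral_deriv0 f (f' : R -> R) :
  (forall x, is_derive x (1 : R) f (f' x)) -> continuous f' ->
  mu.-integrable setT (EFin \o f') ->
  (f n%:R @[n --> \oo] --> 0) -> (f (- n%:R) @[n --> \oo] --> 0) ->
  \int[mu]_x f' x = 0.
Proof.
move=> df cf' i1 h1 h2.
have := Rintegral_sym_cvg i1.
have -> : (fun n : nat => \int[mu]_(x in `[- n%:R, n%:R]) f' x) =
    (fun n : nat => f n%:R - f (- n%:R)).
  by apply/funext => n; rewrite (Rintegral_deriv _ df)// ge0_cp.
have h : (fun n : nat => f n%:R - f (- n%:R)) @ \oo --> (0 : R).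
  by rewrite -(subr0 (0 : R)); exact: cvgB.
by move=> h3; apply: cvg_unique h3 h.
Qed.

(** Over [[- n, n]] the integral is [f n - f (- n)], at most [2 * B]; monotone convergence passes to
    the line. The three weights below are compared with derivatives of bounded arctangents in order
    to use it. *)
Lemma integrable_bounded_primitive f (f' : R -> R) (B : R) :
  (forall x, is_derive x (1 : R) f (f' x)) -> continuous f' ->
  (forall x, 0 <= f' x) -> (forall x, `|f x| <= B) ->
  mu.-integrable setT (EFin \o f').
Proof.
move=> df cf' f0 fB.
have mf : measurable_fun setT f' by exact: continuous_measurable_fun.
apply/integrableP; split; first exact/measurable_EFinP.
under eq_integral do rewrite /= ger0_norm//.
have cv : (\int[mu]_(x in `[(- n%:R)%R, n%:R]) (f' x)%:E)%E @[n --> \oo] -->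
   (\int[mu]_(x in \bigcup_n `[(- n%:R)%R, n%:R]%classic) (f' x)%:E)%E.
  apply: ge0_nondecreasing_set_cvg_integral => //.
  - move=> m n mn; apply/subsetPset => x /=; rewrite !in_itv/= => /andP[h1 h2].
    have : m%:R <= n%:R :> R by rewrite ler_nat.
    by move=> h; apply/andP; split; lra.
  - by move=> n; apply: measurable_funTS; exact/measurable_EFinP.
  - by move=> n x _; rewrite lee_fin.
have UT : \bigcup_n `[(- n%:R)%R, n%:R]%classic = [set: R].
  apply/seteqP; split => // x _; exists (Num.truncn `|x|).+1 => //=.
  by rewrite in_itv/= -ler_norml ltW// truncnS_gt.
rewrite UT in cv.
apply: (@le_lt_trans _ _ (2 * B)%:E); last exact: ltry.
apply: (cvge_le _ cv); apply: nearW => n.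
have <- : (fine (\int[mu]_(x in `[(- n%:R)%R, n%:R]) (f' x)%:E))%:E =
   (\int[mu]_(x in `[(- n%:R)%R, n%:R]) (f' x)%:E)%E.
  rewrite fineK//; apply: integrable_fin_num => //; exact: continuous_integrable_itv.
rewrite lee_fin -/(Rintegral _ _ _) (Rintegral_deriv _ df)//; last by rewrite ge0_cp.
by have := fB n%:R; have := fB (- n%:R); rewrite !ler_norml => /andP[? ?] /andP[? ?]; lra.
Qed.

Lemma expRNabs_le x : 1 <= (expR x + expR (- x)) * expR (- `|x|).
Proof.
have [x0|x0] := leP 0 x.
  by rewrite ger0_norm// mulrDl -expRD addrN expR0 lerDl mulr_ge0 ?expR_ge0.
by rewrite ltr0_norm// opprK mulrDl -!expRD addNr expR0 lerDr expR_ge0.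
Qed.

Lemma continuous_expR_comp f : continuous f -> continuous (fun x => expR (f x)).
Proof. by move=> cf x; apply: continuous_comp; [exact: cf|exact: continuous_expR]. Qed.

Lemma continuous_norm_id : continuous (fun x : R => `|x|).
Proof. by move=> x; exact: norm_continuous. Qed.

(** The exponential is at most [g = 1 / cosh (c x)], which is smooth at 0 and has the bounded
    primitive [2 / c * atan (expR (c * x))]. *)
Lemma integrable_expRNabs (c : R) : 0 < c ->
  mu.-integrable setT (EFin \o (fun x => expR (- (c * `|x|)))).
Proof.
move=> c0.
pose G x := 2 / c * atan (expR (c * x)).
pose g x := 2 / (expR (c * x) + expR (- (c * x))).
have p0 x : 0 < expR (c * x) + expR (- (c * x)) by rewrite addr_gt0 ?expR_gt0.
have dG x : is_derive x (1 : R) G (g x).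
  have d1 := is_deriv_scale c x.
  apply: is_deriv_eq (is_deriv_mul (is_deriv_cst (2 / c) x) (is_deriv_atan (is_deriv_expR d1))) _.
  have := p0 x; rewrite /g expRN; have := expR_gt0 (c * x).
  set e := expR (c * x) => e0 h; field.
  by rewrite !gt_eqF// ltr_wpDl// mulr_ge0 ?ltW.
have cg : continuous g.
  have d x : is_derive x (1 : R) (fun x => expR (c * x) + expR (- (c * x)))
      (c * expR (c * x) + (- c) * expR (- (c * x))).
    have d1 := is_deriv_scale c x.
    by apply: is_deriv_add; apply: is_deriv_expR => //; exact: is_deriv_opp.
  move=> x; apply: cvgM; first exact: cvg_cst.
  by apply: cvgV; [rewrite gt_eqF|exact: (is_deriv_continuous d)].
have g0 x : 0 <= g x by rewrite divr_ge0// ltW.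
have GB x : `|G x| <= 2 / c * pi.
  have c1 : 0 <= 2 / c by rewrite divr_ge0 ?ltW.
  rewrite /G normrM (ger0_norm c1) ler_wpM2l//.
  have := atan_gtNpi2 (expR (c * x)); have := atan_ltpi2 (expR (c * x)).
  have := pi_gt0 R; rewrite ler_norml => h1 h2 h3; apply/andP; split; lra.
apply: integrable_real_dom (integrable_bounded_primitive dG cg g0 GB) _ => //.
  apply: continuous_measurable_fun; apply: continuous_expR_comp => x.
  by apply: cvgN; apply: cvgM; [exact: cvg_cst|exact: continuous_norm_id].
move=> x _; rewrite ger0_norm ?expR_ge0// ler_pdivlMr// mulrC.
have := expRNabs_le (c * x); rewrite normrM (gtr0_norm c0) => h1.
have [x0|x0] := leP 0 x.
  rewrite ger0_norm// mulrDl -!expRD addrN expR0 -opprD.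
  suff : expR (- (c * x + c * x)) <= 1 by lra.
  by rewrite expR_le1 oppr_le0 addr_ge0// mulr_ge0// ltW.
rewrite ltr0_norm// mulrN opprK mulrDl -!expRD addNr expR0.
suff : expR (c * x + c * x) <= 1 by lra.
by rewrite expR_le1; have := pmulr_rlt0 x c0; rewrite x0; lra.
Qed.

Lemma continuous_sqrD1 : continuous (fun x : R => 1 + x ^+ 2).
Proof. exact: continuous_oneDsqr. Qed.

Lemma sqrD1_gt0 x : 0 < 1 + x ^+ 2. Proof. by rewrite ltr_wpDr ?sqr_ge0. Qed.

Lemma continuous_sqrD1V : continuous (fun x : R => (1 + x ^+ 2)^-1).
Proof. exact: continuous_oneDsqrV. Qed.

Lemma integrable_sqrD1V : mu.-integrable setT (EFin \o (fun x : R => (1 + x ^+ 2)^-1)).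
Proof.
apply: (@integrable_bounded_primitive atan _ pi).
- exact: continuous_sqrD1V.
- by move=> x; rewrite invr_ge0 ltW ?sqrD1_gt0.
- move=> x; have := atan_gtNpi2 x; have := atan_ltpi2 x.
  by have := pi_gt0 R; rewrite ler_norml => h1 h2 h3; apply/andP; split; lra.
Qed.

(* [(1 + x^2)^(-3/4)] *)
Definition w34 x : R := expR (- (3 / 4) * ln (1 + x ^+ 2)).

Lemma is_deriv_ln_sqrD1 (k x : R) :
  is_derive x (1 : R) (fun t => k * ln (1 + t ^+ 2)) (k * (2 * x / (1 + x ^+ 2))).
Proof.
have d : is_derive x (1 : R) (fun t : R => 1 + t ^+ 2) (2 * x).
  apply: is_deriv_eq (is_deriv_add (is_deriv_cst 1 x) (is_deriv_mul (is_deriv_id x) (is_deriv_id x))) _.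
  ring.
apply: is_deriv_eq (is_deriv_mul (is_deriv_cst k x) (@is_deriv_ln (fun t : R => 1 + t ^+ 2) x _ (sqrD1_gt0 x) d)) _.
by rewrite mul0r add0r.
Qed.

Lemma continuous_ln_sqrD1 k : continuous (fun x => k * ln (1 + x ^+ 2)).
Proof. exact: is_deriv_continuous (is_deriv_ln_sqrD1 k). Qed.

Lemma continuous_w34 : continuous w34.
Proof. exact: (@continuous_expR_comp (fun x => - (3 / 4) * ln (1 + x ^+ 2)) (@continuous_ln_sqrD1 _)). Qed.

(** With [q = (1 + x^2)^(-1/4)] the weight is [q^3]. It is at most 4 times the derivative of
    [atan (x q)], because [(x q)' >= q / 2] and [1 + (x q)^2 <= 2 / q^2]. *)
Lemma integrable_w34 : mu.-integrable setT (EFin \o w34).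
Proof.
pose q x : R := expR (- (1 / 4) * ln (1 + x ^+ 2)).
pose h x := x * q x.
pose h' x := q x * (1 - x ^+ 2 / (2 * (1 + x ^+ 2))).
have dh x : is_derive x (1 : R) h (h' x).
  apply: is_deriv_eq (is_deriv_mul (is_deriv_id x) (is_deriv_expR (is_deriv_ln_sqrD1 (- (1/4)) x))) _.
  rewrite /h' -/(q x); have := sqrD1_gt0 x => p; field.
  by rewrite ?gt_eqF.
have q0 x : 0 < q x by exact: expR_gt0.
have q4 x : q x ^+ 4 * (1 + x ^+ 2) = 1.
  rewrite -[in X in _ * X](lnK (sqrD1_gt0 x)) /q -expRM_natl -expRD.
  by rewrite (_ : 4%:R * _ + _ = 0) ?expR0//; set l := ln _; field.
have w3 x : w34 x = q x ^+ 3.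
  rewrite /q -expRM_natl /w34; congr expR; set l := ln _; by field.
have cq : continuous q.
  exact: (@continuous_expR_comp (fun x => - (1 / 4) * ln (1 + x ^+ 2)) (@continuous_ln_sqrD1 _)).
have ch : continuous h by exact: is_deriv_continuous dh.
pose g x := h' x / (1 + h x ^+ 2).
have ch' : continuous h'.
  move=> x; apply: cvgM; first exact: cq.
  apply: cvgB; first exact: cvg_cst.
  apply: cvgM; first exact: exprn_continuous.
  apply: cvgV; first by rewrite gt_eqF// mulr_gt0// sqrD1_gt0.
  by apply: cvgM; [exact: cvg_cst|exact: continuous_sqrD1].
have cg : continuous g.
  move=> x; apply: cvgM; first exact: ch'.
  apply: (@continuous_comp _ _ _ h (fun y : R => (1 + y ^+ 2)^-1)); first exact: ch.
  exact: continuous_sqrD1V.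
have h'q x : q x / 2 <= h' x.
  rewrite /h' ler_wpM2l//; first exact: ltW.
  have := sqrD1_gt0 x => p.
  suff : x ^+ 2 / (2 * (1 + x ^+ 2)) <= 1 / 2 by lra.
  rewrite ler_pdivrMr ?mulr_gt0//; have := sqr_ge0 x; lra.
have g0 x : 0 <= g x.
  by rewrite divr_ge0 ?(ltW (sqrD1_gt0 _))//; apply: le_trans (h'q x); rewrite divr_ge0 ?ltW.
have GB x : `|atan (h x)| <= pi.
  have := atan_gtNpi2 (h x); have := atan_ltpi2 (h x).
  by have := pi_gt0 R; rewrite ler_norml => h1 h2 h3; apply/andP; split; lra.
have dG x : is_derive x (1 : R) (fun x => atan (h x)) (g x) by exact: is_deriv_atan.
have i1 := integrable_realZ 4 measurableT (integrable_bounded_primitive dG cg g0 GB).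
apply: integrable_real_dom i1 _ => //.
  by apply: continuous_measurable_fun; exact: continuous_w34.
move=> x _; rewrite w3 ger0_norm; last by rewrite exprn_ge0// ltW.
have hh : h x ^+ 2 <= q x ^- 2.
  have q20 : 0 < q x ^+ 2 by rewrite exprn_gt0.
  rewrite -[leRHS]mul1r ler_pdivlMr// /h exprMn -mulrA -expr2 -exprM.
  have := q4 x; have : 0 <= q x ^+ 4 by rewrite exprn_ge0 ?ltW.
  rewrite mulrDr mulr1 (mulrC (x ^+ 2)); lra.
have q1 : q x <= 1.
  rewrite /q expR_le1 mulNr oppr_le0 mulr_ge0// ln_ge0// lerDl; exact: sqr_ge0.
have hq : 1 + h x ^+ 2 <= 2 * q x ^- 2.
  suff : 1 <= q x ^- 2 by lra.
  by rewrite invf_ge1 ?exprn_gt0// exprn_ile1// ltW.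
rewrite /g mulrA ler_pdivlMr ?sqrD1_gt0//.
apply: (@le_trans _ _ (2 * q x)).
  apply: le_trans (ler_wpM2l _ hq) _; first by rewrite exprn_ge0 ?ltW.
  have := q0 x; set e := q x => e0.
  rewrite le_eqVlt; apply/orP; left; apply/eqP; field; by rewrite gt_eqF.
have := h'q x; lra.
Qed.

End RealCalculus.

(** * Complex-valued functions of a real variable, and the exponential *)

Section ComplexCalculus.
Context {R : realType}.
Local Notation mu := (@lebesgue_measure R).
Implicit Types (f g : R -> R[i]) (x a b : R) (z w : R[i]).

Definition is_cderiv f (f' : R -> R[i]) := forall x,
  is_derive x (1 : R) (fun t => Re (f t)) (Re (f' x)) /\
  is_derive x (1 : R) (fun t => Im (f t)) (Im (f' x)).

Definition ccontinuous f :=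
  continuous (fun t => Re (f t)) /\ continuous (fun t => Im (f t)).

Lemma is_cderiv_ext f f' g g' : f =1 g -> f' =1 g' -> is_cderiv f f' -> is_cderiv g g'.
Proof. by move=> /funext <- /funext <-. Qed.

Lemma is_cderiv_eq f f' g' : is_cderiv f f' -> f' =1 g' -> is_cderiv f g'.
Proof. by move=> h /funext <-. Qed.

Lemma is_cderiv_continuous f f' : is_cderiv f f' -> ccontinuous f.
Proof.
by move=> h; split;
  [apply: (@is_deriv_continuous _ _ (fun x => Re (f' x)))|apply: (@is_deriv_continuous _ _ (fun x => Im (f' x)))] => x; have [] := h x.
Qed.

Lemma is_cderiv_cst z : is_cderiv (fun=> z) (fun=> 0).
Proof. by move=> x; split; exact: is_deriv_cst. Qed.

Lemma is_cderiv_real (f f' : R -> R) : (forall x, is_derive x (1 : R) f (f' x)) ->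
  is_cderiv (fun t => (f t)%:C) (fun t => (f' t)%:C).
Proof. by move=> h x; split => //=; exact: is_deriv_cst. Qed.

Lemma is_cderiv_id : is_cderiv (fun t => t%:C) (fun=> 1).
Proof. by apply: (@is_cderiv_real (fun t => t) (fun=> 1)) => x; exact: is_deriv_id. Qed.

Lemma is_cderivD f f' g g' : is_cderiv f f' -> is_cderiv g g' ->
  is_cderiv (fun t => f t + g t) (fun t => f' t + g' t).
Proof.
move=> hf hg x; have [f1 f2] := hf x; have [g1 g2] := hg x; rewrite !ReImE; split;
  under eq_fun do rewrite ReImE; exact: is_deriv_add.
Qed.

Lemma is_cderivM f f' g g' : is_cderiv f f' -> is_cderiv g g' ->
  is_cderiv (fun t => f t * g t) (fun t => f' t * g t + f t * g' t).
Proof.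
move=> hf hg x; have [f1 f2] := hf x; have [g1 g2] := hg x; rewrite !ReImE; split;
  under eq_fun do rewrite ReImE.
  apply: is_deriv_eq (is_deriv_sub (is_deriv_mul f1 g1) (is_deriv_mul f2 g2)) _; ring.
apply: is_deriv_eq (is_deriv_add (is_deriv_mul f1 g2) (is_deriv_mul f2 g1)) _; ring.
Qed.

Lemma is_cderivZ z f f' : is_cderiv f f' -> is_cderiv (fun t => z * f t) (fun t => z * f' t).
Proof.
move=> hf; apply: is_cderiv_eq (is_cderivM (is_cderiv_cst z) hf) _ => x.
by rewrite mul0r add0r.
Qed.

Lemma ccontinuous_ext f g : f =1 g -> ccontinuous f -> ccontinuous g.
Proof. by move=> /funext <-. Qed.

Lemma ccontinuous_cst z : ccontinuous (fun=> z).
Proof. by split => x; exact: cvg_cst. Qed.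

Lemma ccontinuous_real (f : R -> R) : continuous f -> ccontinuous (fun t => (f t)%:C).
Proof. by move=> h; split => //= x; exact: cvg_cst. Qed.

Lemma ccontinuous_id : ccontinuous (fun t => t%:C).
Proof. by apply: (@ccontinuous_real (fun t => t)) => x; exact: cvg_id. Qed.

Lemma ccontinuousD f g : ccontinuous f -> ccontinuous g -> ccontinuous (fun t => f t + g t).
Proof.
move=> [f1 f2] [g1 g2]; split; under eq_fun do rewrite ReImE; move=> x;
  apply: cvgD; [exact: f1|exact: g1|exact: f2|exact: g2].
Qed.

Lemma ccontinuousM f g : ccontinuous f -> ccontinuous g -> ccontinuous (fun t => f t * g t).
Proof.
move=> [f1 f2] [g1 g2]; split; under eq_fun do rewrite ReImE; move=> x.
  by apply: cvgB; apply: cvgM; [exact: f1|exact: g1|exact: f2|exact: g2].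
by apply: cvgD; apply: cvgM; [exact: f1|exact: g2|exact: f2|exact: g1].
Qed.

Lemma ccontinuousZ z f : ccontinuous f -> ccontinuous (fun t => z * f t).
Proof. by move=> h; apply: ccontinuousM h; exact: ccontinuous_cst. Qed.

Lemma ccontinuousB f g : ccontinuous f -> ccontinuous g -> ccontinuous (fun t => f t - g t).
Proof.
move=> hf hg; apply: ccontinuous_ext (ccontinuousD hf (ccontinuousZ (-1) hg)) => x.
by rewrite mulN1r.
Qed.

Lemma ccontinuous_measurable D f : ccontinuous f -> cmeasurable D f.
Proof.
by move=> [f1 f2]; split; apply: measurable_funTS; exact: continuous_measurable_fun.
Qed.

Lemma ccontinuous_normc f : ccontinuous f -> continuous (fun t => normc (f t)).
Proof.
move=> [f1 f2].
have -> : (fun t => normc (f t)) = (fun t => Num.sqrt (Re (f t) ^+ 2 + Im (f t) ^+ 2)).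
  by apply/funext => t; rewrite -normc_sqr sqrtr_sqr ger0_norm// normc_ge0.
move=> x; apply: (@continuous_comp _ _ _ (fun t => Re (f t) ^+ 2 + Im (f t) ^+ 2) Num.sqrt).
  by apply: cvgD; apply: cvgM; [exact: f1|exact: f1|exact: f2|exact: f2].
exact: sqrt_continuous.
Qed.

Lemma ccontinuous_integrable_itv f a b : ccontinuous f -> cintegrable `[a, b] f.
Proof. by move=> [f1 f2]; split; exact: continuous_integrable_itv. Qed.

Lemma cmeasurableM D f g : cmeasurable D f -> cmeasurable D g ->
  cmeasurable D (fun t => f t * g t).
Proof.
move=> [f1 f2] [g1 g2]; split; under eq_fun do rewrite ReImE.
  by apply: measurable_funB; exact: measurable_funM.
by apply: measurable_funD; exact: measurable_funM.
Qed.

Lemma cmeasurable_conj D f : cmeasurable D f -> cmeasurable D (fun t => (f t)^*).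
Proof.
move=> [f1 f2]; split; under eq_fun do rewrite ReImE; first by [].
exact: measurableT_comp.
Qed.

Lemma cmeasurable_normc D f : cmeasurable D f -> measurable_fun D (fun t => normc (f t)).
Proof.
move=> [f1 f2].
have -> : (fun t => normc (f t)) = (fun t => Num.sqrt (Re (f t) ^+ 2 + Im (f t) ^+ 2)).
  by apply/funext => t; rewrite -normc_sqr sqrtr_sqr ger0_norm// normc_ge0.
apply: measurableT_comp; first by apply: continuous_measurable_fun; exact: sqrt_continuous.
by apply: measurable_funD; exact: measurable_funX.
Qed.

Lemma cintegrable_normc D f : measurable D -> cintegrable D f ->
  mu.-integrable D (EFin \o (fun t => normc (f t))).
Proof.
move=> mD [f1 f2].
have i1 := integrable_realD mD (integrable_norm f1) (integrable_norm f2).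
apply: integrable_real_dom i1 _ => //.
  by apply: cmeasurable_normc; exact: cintegrable_measurable.
by move=> x _; rewrite ger0_norm ?normc_ge0//; exact: normc_le_ReIm.
Qed.

Lemma cint_deriv0 f f' : is_cderiv f f' -> ccontinuous f' -> cintegrable setT f' ->
  (normc (f n%:R) @[n --> \oo] --> (0 : R)) ->
  (normc (f (- n%:R)) @[n --> \oo] --> (0 : R)) ->
  cint setT f' = 0.
Proof.
move=> df [c1 c2] [i1 i2] h1 h2.
have sq (P : R[i] -> R) (u : nat -> R) : (forall z, `|P z| <= normc z) ->
    normc (f (u n)) @[n --> \oo] --> (0 : R) -> P (f (u n)) @[n --> \oo] --> (0 : R).
  move=> Pz cu; apply/norm_cvg0P.
  apply: (squeeze_cvgr _ (cvg_cst 0) cu); apply: nearW => n.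
  by rewrite normr_ge0 Pz.
apply: complexP; rewrite ReImE /=.
  apply: (@Rintegral_deriv0 _ (fun t => Re (f t))) => //.
  - by move=> x; have [] := df x.
  - by apply: (sq _ (fun n => n%:R)) => // z; exact: le_Re_normc.
  - by apply: (sq _ (fun n => - n%:R)) => // z; exact: le_Re_normc.
apply: (@Rintegral_deriv0 _ (fun t => Im (f t))) => //.
- by move=> x; have [] := df x.
- by apply: (sq _ (fun n => n%:R)) => // z; exact: le_Im_normc.
- by apply: (sq _ (fun n => - n%:R)) => // z; exact: le_Im_normc.
Qed.

Lemma cint_deriv f f' a b : a <= b -> is_cderiv f f' -> ccontinuous f' ->
  cint `[a, b] f' = f b - f a.
Proof.
move=> ab df [c1 c2]; apply: complexP; rewrite !ReImE /=.
  apply: (@Rintegral_deriv _ (fun t => Re (f t))) => //.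
  by move=> x; have [] := df x.
apply: (@Rintegral_deriv _ (fun t => Im (f t))) => //.
by move=> x; have [] := df x.
Qed.

Fact cexp_key : unit. Proof. exact: tt. Qed.

(** Sealed so that simplification keeps it opaque; computations go through [Re_cexp], [Im_cexp] and
    [cexpD]. *)
Definition cexp : R[i] -> R[i] := locked_with cexp_key
  (fun z => (expR (Re z))%:C * (cos (Im z) +i* sin (Im z))).

Lemma Re_cexp z : Re (cexp z) = expR (Re z) * cos (Im z).
Proof. by rewrite /cexp unlock cReM /= mul0r subr0. Qed.

Lemma Im_cexp z : Im (cexp z) = expR (Re z) * sin (Im z).
Proof. by rewrite /cexp unlock cImM /= mul0r addr0. Qed.

Lemma cexpD z w : cexp (z + w) = cexp z * cexp w.
Proof.
by apply: complexP; rewrite !ReImE !(Re_cexp, Im_cexp) ?ReImE ?cosD ?sinD expRD; ring.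
Qed.

Lemma cexp0 : cexp 0 = 1.
Proof. by apply: complexP; rewrite ?(Re_cexp, Im_cexp)/= expR0 ?cos0 ?sin0 ?mulr1 ?mulr0. Qed.

Lemma normc_cexp z : normc (cexp z) = expR (Re z).
Proof.
rewrite /cexp unlock normcM normc_real ger0_norm ?expR_ge0//.
by rewrite /normc cos2Dsin2 sqrtr1 mulr1.
Qed.

Lemma cexp_neq0 z : cexp z != 0.
Proof.
apply/eqP => h; have := normc_cexp z; rewrite h normc0 => /eqP.
by rewrite lt_eqF ?expR_gt0.
Qed.

Lemma cexpN z : cexp (- z) = (cexp z)^-1.
Proof.
apply: (mulfI (cexp_neq0 z)); rewrite -cexpD subrr cexp0 mulfV//; exact: cexp_neq0.
Qed.

Lemma is_cderiv_cexp f f' : is_cderiv f f' ->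
  is_cderiv (fun t => cexp (f t)) (fun t => f' t * cexp (f t)).
Proof.
move=> hf x; have [f1 f2] := hf x; rewrite !ReImE !(Re_cexp, Im_cexp); split.
  under eq_fun do rewrite Re_cexp.
  apply: is_deriv_eq (is_deriv_mul (is_deriv_expR f1) (is_deriv_cos f2)) _; ring.
under eq_fun do rewrite Im_cexp.
apply: is_deriv_eq (is_deriv_mul (is_deriv_expR f1) (is_deriv_sin f2)) _; ring.
Qed.

Lemma ccontinuous_cexp f : ccontinuous f -> ccontinuous (fun t => cexp (f t)).
Proof.
move=> [f1 f2]; split; under eq_fun do rewrite ?Re_cexp ?Im_cexp; move=> x; apply: cvgM.
- by apply: continuous_comp; [exact: f1|exact: continuous_expR].
- by apply: continuous_comp; [exact: f2|exact: continuous_cos].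
- by apply: continuous_comp; [exact: f1|exact: continuous_expR].
- by apply: continuous_comp; [exact: f2|exact: continuous_sin].
Qed.

Lemma is_cderiv_cexpZ z : is_cderiv (fun t => cexp (z * t%:C)) (fun t => z * cexp (z * t%:C)).
Proof.
apply: is_cderiv_eq (is_cderiv_cexp (is_cderivZ z is_cderiv_id)) _ => x.
by rewrite mulr1.
Qed.

Lemma ccontinuous_cexpZ z : ccontinuous (fun t => cexp (z * t%:C)).
Proof. exact: is_cderiv_continuous (is_cderiv_cexpZ z). Qed.

End ComplexCalculus.

(** * The second-order remainder of the exponential *)

Section CexpEstimates.
Context {R : realType}.
Implicit Types (x a b r K : R) (z w s h : R[i]).

Lemma deriv_bound_sub0 (f f' : R -> R) (r K x : R) :
  (forall y, is_derive y (1 : R) f (f' y)) -> continuous f' ->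
  (forall y, `|y| <= r -> `|f' y| <= K) -> `|x| <= r -> `|f x - f 0| <= K * `|x|.
Proof.
move=> df cf' fK xr.
have cf := is_deriv_continuous df.
have dd (a b : R) : a <= b -> `|a| <= r -> `|b| <= r -> `|f b - f a| <= K * (b - a).
  move=> ab ar br.
  have [c cab ->] : exists2 c, c \in `[a, b] & f b - f a = f' c * (b - a).
    apply: (@MVT_segment _ f f') => //.
    exact: continuous_within.
  rewrite normrM (ger0_norm (_ : 0 <= b - a)) ?subr_ge0// ler_wpM2r ?subr_ge0//.
  apply: fK; move: cab; rewrite in_itv/= => /andP[ac cb].
  by move: ar br; rewrite !ler_norml => /andP[? ?] /andP[? ?]; apply/andP; split; lra.
have r0 : 0 <= r by exact: le_trans (normr_ge0 _) xr.
have [x0|x0] := leP 0 x.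
  by rewrite (ger0_norm x0) -[X in K * X]subr0; apply: dd => //; rewrite normr0.
rewrite (ltr0_norm x0) distrC -[X in K * X]sub0r; apply: dd => //; rewrite ?normr0//.
exact: ltW.
Qed.

(** Convexity gives the lower bound 0. The upper one follows from [expR (- x) >= 1 - x]: the
    remainder is at most [x^2 / (1 - x)]. *)
Lemma expR_sub1D_le x : `|x| <= 1 / 2 -> `|expR x - 1 - x| <= 2 * x ^+ 2.
Proof.
rewrite ler_norml => /andP[x1 x2].
have h1 := expR_ge1Dx x; have h2 := expR_ge1Dx (- x).
have h3 := expRxMexpNx_1 x.
rewrite ger0_norm; last by lra.
have e0 := expR_gt0 x; set e := expR x in h1 h3 e0 *; set e' := expR (- x) in h2 h3.
nra.
Qed.

(** Start of a bootstrap through [deriv_bound_sub0]: a bound on the derivative gains one order on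
    the function, here for [cos x - 1], then for [sin x - x], then again for [cos x - 1]. *)
Lemma cos_sub1_le x : `|x| <= 1 -> `|cos x - 1| <= `|x|.
Proof.
move=> x1; rewrite -cos0 -[leRHS]mul1r; apply: (@deriv_bound_sub0 cos (fun y => - sin y) 1) => //.
- by move=> y; apply: cvgN; exact: continuous_sin.
- by move=> y _; rewrite normrN sin_max.
Qed.

Lemma sin_sub_le x : `|x| <= 1 -> `|sin x - x| <= x ^+ 2.
Proof.
move=> x1; rewrite -(real_normK (num_real x)) expr2.
have := @deriv_bound_sub0 (fun y => sin y - y) (fun y => cos y - 1) `|x| `|x| x.
rewrite sin0 !subr0; apply => //.
- by move=> y; apply: cvgB; [exact: continuous_cos|exact: cvg_cst].
- by move=> y yx; exact: le_trans (cos_sub1_le (le_trans yx x1)) yx.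
Qed.

Lemma cos_sub1_sqr_le x : `|x| <= 1 -> `|cos x - 1| <= 2 * x ^+ 2.
Proof.
move=> x1; rewrite -(real_normK (num_real x)) expr2 mulrA -{1}cos0.
apply: (@deriv_bound_sub0 cos (fun y => - sin y) `|x|) => //.
- by move=> y; apply: cvgN; exact: continuous_sin.
- move=> y yx; rewrite normrN.
  have y1 : `|y| <= 1 by exact: le_trans x1.
  have h := sin_sub_le y1; rewrite -(subrK y (sin y)).
  apply: le_trans (ler_normD _ _) _.
  have : y ^+ 2 <= `|y| by rewrite -(real_normK (num_real y)) expr2 ler_piMr.
  lra.
Qed.

Lemma cexp_sub1D_le z : normc z <= 1 / 2 -> normc (cexp z - 1 - z) <= 8 * normc z ^+ 2.
Proof.
move=> z1; set a := Re z; set b := Im z.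
have a1 : `|a| <= 1 / 2 by exact: le_trans (le_Re_normc z) z1.
have b1 : `|b| <= 1 / 2 by exact: le_trans (le_Im_normc z) z1.
have b2 : `|b| <= 1 by lra.
have hE := expR_sub1D_le a1; have hC := cos_sub1_sqr_le b2; have hS := sin_sub_le b2.
apply: (le_trans (normc_le_ReIm _)).
rewrite !(cReD, cReN, cRe1, cImD, cImN, cIm1, Re_cexp, Im_cexp) -/a -/b normc_sqr -/a -/b oppr0 addr0.
set e := expR a in hE *.
(* Apart from the cross term [a * b], every summand contains a real second-order remainder. The five
   bounds add up to [5 a^2 + 7 b^2], whence the constant 8. *)
have -> : e * cos b - 1 - a = (e - 1 - a) * cos b + (1 + a) * (cos b - 1) by ring.
have -> : e * sin b - b = e * (sin b - b) + b * (e - 1 - a) + a * b by ring.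
have cb : `|cos b| <= 1 by exact: cos_max.
have e2 : `|e| <= 2.
  have -> : e = (e - 1 - a) + (1 + a) by ring.
  apply: le_trans (ler_normD _ _) _; apply: (@le_trans _ _ (2 * a ^+ 2 + (1 + `|a|))).
    by apply: lerD => //; apply: le_trans (ler_normD _ _) _; rewrite normr1.
  by rewrite -(real_normK (num_real a)); have := normr_ge0 a; nra.
have t1 : `|(e - 1 - a) * cos b| <= 2 * a ^+ 2.
  by rewrite normrM -[leRHS]mulr1; apply: ler_pM.
have t2 : `|(1 + a) * (cos b - 1)| <= 2 * (2 * b ^+ 2).
  rewrite normrM; apply: ler_pM => //; apply: le_trans (ler_normD _ _) _; rewrite normr1; lra.
have t3 : `|e * (sin b - b)| <= 2 * b ^+ 2 by rewrite normrM; apply: ler_pM.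
have t4 : `|b * (e - 1 - a)| <= 1 * (2 * a ^+ 2) by rewrite normrM; apply: ler_pM.
have t5 : `|a * b| <= a ^+ 2 + b ^+ 2.
  rewrite normrM -(real_normK (num_real a)) -(real_normK (num_real b)).
  have := normr_ge0 a; have := normr_ge0 b; set u := `|a|; set v := `|b|; nra.
have n1 := ler_normD ((e - 1 - a) * cos b) ((1 + a) * (cos b - 1)).
have n2 := ler_normD (e * (sin b - b) + b * (e - 1 - a)) (a * b).
have n3 := ler_normD (e * (sin b - b)) (b * (e - 1 - a)).
have := sqr_ge0 a; have := sqr_ge0 b; lra.
Qed.

End CexpEstimates.

(** * Complex differentiability *)

Section ComplexDerivative.
Context {R : realType}.
Implicit Types (x a b r K : R) (z w s h d : R[i]) (f g : R[i] -> R[i]).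

(** The epsilon-delta form with real radii, [h = 0] included; the next lemmas show it equivalent to
    [derivable] over the field [R[i]]. Goursat's argument consumes this inequality directly. *)
Definition cderivable f s := exists d, forall e : R, 0 < e ->
  exists2 r : R, 0 < r & forall h, normc h < r ->
    normc (f (s + h) - f s - d * h) <= e * normc h.

Lemma gt0_real_complex (e : R[i]) : 0 < e -> exists2 r : R, 0 < r & e = r%:C.
Proof.
case: e => a b; rewrite ltcE /= => /andP[/eqP-> a0]; by exists a.
Qed.

Lemma derivable_cderivable f s : derivable (f : R[i]^o -> R[i]^o) s 1 -> cderivable f s.
Proof.
move=> /cvg_ex[d /cvgrPdist_le H]; exists d => e e0.
have e0' : 0 < e%:C by rewrite ltcR.
have := H _ e0'; rewrite /= near_withinE /= => -[r /= r0 Hr].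
have [r' r'0 rE] := gt0_real_complex r0; exists r' => // h hr.
have [->|hn0] := eqVneq h 0.
  by rewrite addr0 subrr mulr0 subr0 normc0 mulr0.
have := Hr h; rewrite /ball_/= sub0r normrN normcE rE ltcR => /(_ hr hn0).
rewrite normcE lecR [h *: 1]mulr1 /GRing.scale /= (addrC h s) => le1.
have -> : f (s + h) - f s - d * h = - (h * (d - h^-1 * (f (s + h) - f s))).
  rewrite mulrBr mulrA mulfV// mul1r; ring.
rewrite normcN normcM mulrC ler_wpM2r//; exact: normc_ge0.
Qed.

Lemma cderivable_derivable f s : cderivable f s -> derivable (f : R[i]^o -> R[i]^o) s 1.
Proof.
move=> [d H]; apply/cvg_ex; exists d; apply/cvgrPdist_le => /= e e0.
have [e' e'0 eE] := gt0_real_complex e0; have [r r0 Hr] := H _ e'0.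
rewrite near_withinE /=; exists r%:C; first by rewrite /= ltcR.
move=> h /=; rewrite sub0r normrN normcE ltcR => hr hn0.
rewrite eE normcE lecR [h *: 1]mulr1 /GRing.scale /= (addrC h s).
have -> : d - h^-1 * (f (s + h) - f s) = - (h^-1 * (f (s + h) - f s - d * h)).
  by rewrite (mulrBr h^-1 (f (s + h) - f s)) opprB (mulrC d h) mulKf.
rewrite normcN normcM normcV mulrC ler_pdivrMr; first exact: Hr.
by rewrite lt_def normc_ge0 andbT; apply/eqP => /eq0_normc/eqP; rewrite (negbTE hn0).
Qed.

Lemma cderivableM f g s : cderivable f s -> cderivable g s -> cderivable (fun z => f z * g z) s.
Proof.
move=> /cderivable_derivable hf /cderivable_derivable hg.
apply: derivable_cderivable; exact: (@derivableM R[i] R[i]^o f g s 1 hf hg).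
Qed.

Lemma cderivable_cexpZ c s : cderivable (fun z => cexp (c * z)) s.
Proof.
exists (c * cexp (c * s)) => e e0.
set K := normc (cexp (c * s)); set C := normc c.
have K0 : 0 <= K by exact: normc_ge0.
have C0 : 0 <= C by exact: normc_ge0.
pose D := 8 * K * C ^+ 2 + 2 * C + 1.
have D0 : 0 < D by rewrite /D; nra.
pose m := Num.min e 1.
have m0 : 0 < m by rewrite /m lt_min e0 ltr01.
exists (m / D); first by rewrite divr_gt0.
move=> h; rewrite ltr_pdivlMr// => hr.
have h0 := normc_ge0 h.
have me : m <= e by rewrite /m ge_min lexx.
have m1 : m <= 1 by rewrite /m ge_min lexx orbT.
have CH : 0 <= C * normc h by rewrite mulr_ge0.
have KCH : 0 <= K * C ^+ 2 * normc h by rewrite !mulr_ge0.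
have h1 : normc (c * h) <= 1 / 2.
  rewrite normcM -/C; move: hr; rewrite /D; lra.
have := cexp_sub1D_le h1; rewrite normcM -/C => le1.
have -> : cexp (c * (s + h)) - cexp (c * s) - c * cexp (c * s) * h =
    cexp (c * s) * (cexp (c * h) - 1 - c * h).
  rewrite mulrDr cexpD; ring.
rewrite normcM -/K; apply: le_trans (ler_wpM2l K0 le1) _.
rewrite exprMn (_ : K * _ = (8 * K * C ^+ 2 * normc h) * normc h); last by ring.
apply: ler_wpM2r => //; apply: le_trans me; move: hr; rewrite /D; lra.
Qed.

Lemma cderivable_continuous f s (e : R) : cderivable f s -> 0 < e ->
  exists2 r : R, 0 < r & forall h, normc h < r -> normc (f (s + h) - f s) <= e.
Proof.
move=> [d H] e0; have [r r0 Hr] := H 1 ltr01.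
pose D := 1 + normc d; have D0 : 0 < D by rewrite ltr_wpDr// normc_ge0.
exists (Num.min r (e / D)); first by rewrite lt_min r0 divr_gt0.
move=> h; rewrite lt_min => /andP[hr]; rewrite ltr_pdivlMr// => he.
have -> : f (s + h) - f s = (f (s + h) - f s - d * h) + d * h by ring.
apply: le_trans (normcD _ _) _; rewrite normcM.
have := Hr h hr; move: he; rewrite /D; have := normc_ge0 h; nra.
Qed.

Lemma cderivable_continuous_path f (p : R -> R[i]) (t : R) : cderivable f (p t) ->
  (forall u, normc (p u - p t) <= `|u - t|) ->
  {for t, continuous (fun u => Re (f (p u)))} /\ {for t, continuous (fun u => Im (f (p u)))}.
Proof.
move=> df pL.
have key (P : R[i] -> R) : (forall z, `|P z| <= normc z) -> (forall z w, P (z - w) = P z - P w) ->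
    {for t, continuous (fun u => P (f (p u)))}.
  move=> Pz PB; apply/cvgrPdist_le => e e0.
  have [r r0 Hr] := cderivable_continuous df e0.
  near=> u; rewrite distrC -PB; apply: le_trans (Pz _) _.
  rewrite -[p u](subrK (p t)) (addrC _ (p t)); apply: Hr.
  apply: le_lt_trans (pL u) _; rewrite distrC.
  by near: u; apply: cvgr_dist_lt => //; exact: cvg_id.
split; apply: key.
- exact: le_Re_normc.
- by move=> z w; rewrite cReD cReN.
- exact: le_Im_normc.
- by move=> z w; rewrite cImD cImN.
Unshelve. all: end_near. Qed.

End ComplexDerivative.

(** * Cauchy's theorem on rectangles and in the strip *)

Section Goursat.
Context {R : realType}.
Local Notation mu := (@lebesgue_measure R).
Implicit Types (a b c d x y : R) (z w s h : R[i]) (f g : R[i] -> R[i]).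

Definition hint f y a b := cint `[a, b] (fun x => f (x +i* y)).
Definition vint f x c d := cint `[c, d] (fun y => f (x +i* y)).
(** The contour integral along the boundary, counterclockwise; the factor ['i] on the vertical sides
    is that of dz. *)
Definition rectint f a b c d :=
  hint f c a b - hint f d a b + 'i * vint f b c d - 'i * vint f a c d.

Lemma Rintegral_itv_cat (f : R -> R) a m b : a <= m -> m <= b ->
  mu.-integrable `[a, b] (EFin \o f) ->
  \int[mu]_(x in `[a, b]) f x = \int[mu]_(x in `[a, m]) f x + \int[mu]_(x in `[m, b]) f x.
Proof.
move=> am mb fi.
have := @Rintegral_itvB _ f (BLeft a) (BRight b) m fi.
rewrite !bnd_simp => /(_ am mb) h; apply/eqP; rewrite addrC -subr_eq; apply/eqP.
rewrite h Rintegral_itv_obnd_cbnd//.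
apply: integrableS fi => //; apply: subset_itvr => /=.
by rewrite bnd_simp.
Qed.

Lemma cint_itv_cat (f : R -> R[i]) a m b : a <= m -> m <= b -> cintegrable `[a, b] f ->
  cint `[a, b] f = cint `[a, m] f + cint `[m, b] f.
Proof.
move=> am mb [f1 f2]; apply: complexP; rewrite ?cReD ?cImD; exact: Rintegral_itv_cat.
Qed.

Lemma nested_intervals (u v : nat -> R) :
  (forall n, u n <= u n.+1) -> (forall n, v n.+1 <= v n) -> (forall n, u n <= v n) ->
  exists l, forall n, u n <= l <= v n.
Proof.
move=> uS vS uv.
have um n m : (n <= m)%N -> u n <= u m.
  by move=> /subnK <-; elim: (m - n)%N => // k ih; rewrite addSn; exact: le_trans ih (uS _).
have vm n m : (n <= m)%N -> v m <= v n.
  by move=> /subnK <-; elim: (m - n)%N => // k ih; rewrite addSn; exact: le_trans (vS _) ih.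
have uvnm n m : u n <= v m.
  apply: le_trans (um _ (maxn n m) (leq_maxl _ _)) _.
  exact: le_trans (uv _) (vm _ _ (leq_maxr n m)).
have ubn n : ubound (range u) (v n) by move=> _ [m _ <-].
exists (sup (range u)) => n; apply/andP; split.
  by apply: ub_le_sup; [exists (v 0%N)|exists n].
by apply: ge_sup; [exists (u 0%N); exists 0%N|].
Qed.

(** Only the corner [(a, c)] is chosen at each stage, the sides being prescribed as [W / 2 ^ n] and
    [H / 2 ^ n]. Dependent choice is obtained from a choice function on pairs of a stage and a
    corner. *)
Lemma bisection (P : nat -> R -> R -> Prop) (W H a0 c0 : R) : 0 <= W -> 0 <= H ->
  P 0%N a0 c0 ->
  (forall n a c, P n a c -> exists a' c', [/\ P n.+1 a' c',
     a <= a' /\ a' + W / 2 ^+ n.+1 <= a + W / 2 ^+ n &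
     c <= c' /\ c' + H / 2 ^+ n.+1 <= c + H / 2 ^+ n]) ->
  exists x y, forall n, exists a c,
    [/\ P n a c, a <= x <= a + W / 2 ^+ n & c <= y <= c + H / 2 ^+ n].
Proof.
move=> W0 H0 P0 step.
have /choice[F FP] : forall t : nat * (R * R), exists q : R * R,
    P t.1 t.2.1 t.2.2 -> [/\ P t.1.+1 q.1 q.2,
     t.2.1 <= q.1 /\ q.1 + W / 2 ^+ t.1.+1 <= t.2.1 + W / 2 ^+ t.1 &
     t.2.2 <= q.2 /\ q.2 + H / 2 ^+ t.1.+1 <= t.2.2 + H / 2 ^+ t.1].
  move=> [n [a c]] /=; have [h|h] := pselect (P n a c).
    by have [a' [c' h']] := step n a c h; exists (a', c').
  (* Arbitrary default: the implication is vacuous when [P n a c] fails. *)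
  by exists (a, c).
pose S := fix S n := if n is m.+1 then F (m, S m) else (a0, c0).
have PS n : P n (S n).1 (S n).2.
  by elim: n => // n ih; have [] := FP (n, S n) ih.
have [x hx] : exists l, forall n, (S n).1 <= l <= (S n).1 + W / 2 ^+ n.
  apply: (@nested_intervals (fun n => (S n).1)) => n.
  - by have [_ []] := FP (n, S n) (PS n).
  - by have [_ []] := FP (n, S n) (PS n).
  - by rewrite lerDl divr_ge0// exprn_ge0.
have [y hy] : exists l, forall n, (S n).2 <= l <= (S n).2 + H / 2 ^+ n.
  apply: (@nested_intervals (fun n => (S n).2)) => n.
  - by have [_ _ []] := FP (n, S n) (PS n).
  - by have [_ _ []] := FP (n, S n) (PS n).
  - by rewrite lerDl divr_ge0// exprn_ge0.
by exists x, y => n; exists (S n).1, (S n).2; split.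
Qed.

Definition rect_cderivable f a b c d :=
  forall x y, a <= x <= b -> c <= y <= d -> cderivable f (x +i* y).

Lemma hint_integrable f y a b : (forall x, a <= x <= b -> cderivable f (x +i* y)) ->
  cintegrable `[a, b] (fun x => f (x +i* y)).
Proof.
move=> df.
have cc t : t \in `[a, b] -> {for t, continuous (fun u => Re (f (u +i* y)))} /\
      {for t, continuous (fun u => Im (f (u +i* y)))}.
  rewrite in_itv/= => tab; apply: (@cderivable_continuous_path _ f (fun u => u +i* y)); first exact: df.
  move=> u; have -> : u +i* y - t +i* y = (u - t)%:C by apply: complexP; rewrite !ReImE /= ?subrr.
  by rewrite normc_real.
split; apply: continuous_compact_integrable; try exact: segment_compact;
  apply: continuous_in_subspaceT => t /set_mem tab; have [] := cc t tab; done.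
Qed.

Lemma vint_integrable f x c d : (forall y, c <= y <= d -> cderivable f (x +i* y)) ->
  cintegrable `[c, d] (fun y => f (x +i* y)).
Proof.
move=> df.
have cc t : t \in `[c, d] -> {for t, continuous (fun u => Re (f (x +i* u)))} /\
      {for t, continuous (fun u => Im (f (x +i* u)))}.
  rewrite in_itv/= => tab; apply: (@cderivable_continuous_path _ f (fun u => x +i* u)); first exact: df.
  move=> u; have -> : x +i* u - x +i* t = 'i * (u - t)%:C.
    by apply: complexP; rewrite !ReImE /=; ring.
  by rewrite normcM normc_real /= expr0n/= expr1n add0r sqrtr1 mul1r.
split; apply: continuous_compact_integrable; try exact: segment_compact;
  apply: continuous_in_subspaceT => t /set_mem tab; have [] := cc t tab; done.
Qed.

Lemma rectint_splitx f a m b c d : a <= m -> m <= b -> c <= d ->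
  rect_cderivable f a b c d ->
  rectint f a b c d = rectint f a m c d + rectint f m b c d.
Proof.
move=> am mb cd df; rewrite /rectint /hint.
rewrite (cint_itv_cat am mb (@hint_integrable f c a b _)); last by move=> x h; apply: df => //; rewrite lexx.
rewrite (cint_itv_cat am mb (@hint_integrable f d a b _)); last by move=> x h; apply: df => //; rewrite cd lexx.
ring.
Qed.

Lemma rectint_splity f a b c m d : c <= m -> m <= d -> a <= b ->
  rect_cderivable f a b c d ->
  rectint f a b c d = rectint f a b c m + rectint f a b m d.
Proof.
move=> cm md ab df; rewrite /rectint /vint.
rewrite (cint_itv_cat cm md (@vint_integrable f a c d _)); last by move=> x h; apply: df => //; rewrite lexx.
rewrite (cint_itv_cat cm md (@vint_integrable f b c d _)); last by move=> x h; apply: df => //; rewrite ab lexx.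
ring.
Qed.

(** An affine function has the primitive [A z + B z^2 / 2], so the four sides telescope around the
    closed contour. *)
Lemma rectint_affine (A B : R[i]) a b c d : a <= b -> c <= d ->
  rectint (fun z => A + B * z) a b c d = 0.
Proof.
move=> ab cd; pose G z := A * z + 2^-1 * B * (z * z).
have hG y : hint (fun z => A + B * z) y a b = G (b +i* y) - G (a +i* y).
  apply: (@cint_deriv _ (fun x => G (x +i* y))) => //.
    have dx : is_cderiv (fun x => x +i* y) (fun=> 1).
      apply: is_cderiv_ext (is_cderivD is_cderiv_id (is_cderiv_cst ('i * y%:C))) => x.
        by apply: complexP; rewrite !ReImE /=; ring.
      by rewrite addr0.
    apply: is_cderiv_eq (is_cderivD (is_cderivZ A dx) (is_cderivZ (2^-1 * B) (is_cderivM dx dx))) _ => x.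
    by rewrite mul1r !mulr1; field.
  apply: ccontinuousD; first exact: ccontinuous_cst.
  apply: ccontinuousZ; apply: ccontinuous_ext (ccontinuousD ccontinuous_id (ccontinuous_cst ('i * y%:C))) => x.
  by apply: complexP; rewrite !ReImE /=; ring.
have vc x : ccontinuous (fun y => A + B * (x +i* y)).
  apply: ccontinuousD; first exact: ccontinuous_cst.
  apply: ccontinuousZ; apply: ccontinuous_ext (ccontinuousD (ccontinuous_cst x%:C) (ccontinuousZ 'i ccontinuous_id)) => y.
  by apply: complexP; rewrite !ReImE /=; ring.
have vG x : 'i * vint (fun z => A + B * z) x c d = G (x +i* d) - G (x +i* c).
  rewrite /vint -cintZ//; last exact: ccontinuous_integrable_itv.
  apply: (@cint_deriv _ (fun y => G (x +i* y))) => //.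
    have dx : is_cderiv (fun y => x +i* y) (fun=> 'i).
      apply: is_cderiv_ext (is_cderivD (is_cderiv_cst x%:C) (is_cderivZ 'i is_cderiv_id)) => y.
        by apply: complexP; rewrite !ReImE /=; ring.
      by rewrite add0r mulr1.
    apply: is_cderiv_eq (is_cderivD (is_cderivZ A dx) (is_cderivZ (2^-1 * B) (is_cderivM dx dx))) _ => y.
    have key (ii z : R[i]) : A * ii + 2^-1 * B * (ii * z + z * ii) = ii * (A + B * z) by field.
    exact: key.
  exact: ccontinuousZ.
rewrite /rectint !hG !vG; ring.
Qed.

Lemma normc_i : normc ('i : R[i]) = 1.
Proof. by rewrite /= expr0n/= expr1n add0r sqrtr1. Qed.

Lemma Rintegral_cst_itv (k a b : R) : a <= b -> \int[mu]_(x in `[a, b]) k = k * (b - a).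
Proof.
move=> ab; rewrite Rintegral_cst//= lebesgue_measure_itv/= lte_fin.
case: ifP => [_|]; first by rewrite -EFinD.
by rewrite lt_neqAle ab andbT => /negbFE/eqP->; rewrite subrr.
Qed.

Lemma normc_cint_itv_le (f : R -> R[i]) (K a b : R) : a <= b -> cintegrable `[a, b] f ->
  (forall x, a <= x <= b -> normc (f x) <= K) -> normc (cint `[a, b] f) <= 2 * K * (b - a).
Proof.
move=> ab fi fK; rewrite -mulrA -(Rintegral_cst_itv K ab); apply: le_normc_cint => //.
apply: continuous_integrable_itv => x; exact: cvg_cst.
Qed.

Lemma rectint_bound f (K a b c d : R) : a <= b -> c <= d ->
  (forall y, c <= y <= d -> cintegrable `[a, b] (fun x => f (x +i* y))) ->
  (forall x, a <= x <= b -> cintegrable `[c, d] (fun y => f (x +i* y))) ->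
  (forall x y, a <= x <= b -> c <= y <= d -> normc (f (x +i* y)) <= K) ->
  normc (rectint f a b c d) <= 4 * K * ((b - a) + (d - c)).
Proof.
move=> ab cd hi vi fK.
have cc : c <= c <= d by rewrite lexx. have dd : c <= d <= d by rewrite lexx cd.
have aa : a <= a <= b by rewrite lexx. have bb : a <= b <= b by rewrite lexx ab.
have h1 : normc (hint f c a b) <= 2 * K * (b - a).
  by apply: normc_cint_itv_le => //; [exact: hi|move=> x xab; exact: fK].
have h2 : normc (hint f d a b) <= 2 * K * (b - a).
  by apply: normc_cint_itv_le => //; [exact: hi|move=> x xab; exact: fK].
have v1 : normc (vint f a c d) <= 2 * K * (d - c).
  by apply: normc_cint_itv_le => //; [exact: vi|move=> x xab; exact: fK].
have v2 : normc (vint f b c d) <= 2 * K * (d - c).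
  by apply: normc_cint_itv_le => //; [exact: vi|move=> x xab; exact: fK].
rewrite /rectint; apply: le_trans (normcB _ _) _.
apply: le_trans (lerD (normcD _ _) (lexx _)) _.
apply: le_trans (lerD (lerD (normcB _ _) (lexx _)) (lexx _)) _.
by rewrite !(normcM 'i) normc_i !mul1r; lra.
Qed.

Lemma rectint_sub f g a b c d : a <= b -> c <= d ->
  (forall y, c <= y <= d -> cintegrable `[a, b] (fun x => f (x +i* y))) ->
  (forall x, a <= x <= b -> cintegrable `[c, d] (fun y => f (x +i* y))) ->
  (forall y, c <= y <= d -> cintegrable `[a, b] (fun x => g (x +i* y))) ->
  (forall x, a <= x <= b -> cintegrable `[c, d] (fun y => g (x +i* y))) ->
  rectint (fun z => f z - g z) a b c d = rectint f a b c d - rectint g a b c d.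
Proof.
move=> ab cd fh fv gh gv.
have cc : c <= c <= d by rewrite lexx. have dd : c <= d <= d by rewrite lexx cd.
have aa : a <= a <= b by rewrite lexx. have bb : a <= b <= b by rewrite lexx ab.
rewrite /rectint /hint /vint !cintB//; try (by apply: fh); try (by apply: fv); try (by apply: gh); try (by apply: gv).
ring.
Qed.

Lemma rect_cderivableS f a b c d a' b' c' d' : a <= a' -> b' <= b -> c <= c' -> d' <= d ->
  rect_cderivable f a b c d -> rect_cderivable f a' b' c' d'.
Proof.
move=> h1 h2 h3 h4 df x y /andP[x1 x2] /andP[y1 y2]; apply: df; apply/andP; split.
- exact: le_trans x1.
- exact: le_trans h2.
- exact: le_trans y1.
- exact: le_trans h4.
Qed.

Lemma lt_quarters_absurd (e r1 r2 r3 r4 : R) : e <= (r1 + r2) + (r3 + r4) ->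
  4 * r1 < e -> 4 * r2 < e -> 4 * r3 < e -> 4 * r4 < e -> False.
Proof. lra. Qed.

(** If all four quarters had modulus below a quarter of the total, they could not add up to the
    whole. The quarters share the sides [w] and [v], so a corner determines the one selected, as
    [bisection] expects. *)
Lemma quadrisect f a c (w v : R) : 0 <= w -> 0 <= v ->
  rect_cderivable f a (a + w + w) c (c + v + v) ->
  exists x y, [/\ a <= x <= a + w, c <= y <= c + v &
    normc (rectint f a (a + w + w) c (c + v + v)) <= 4 * normc (rectint f x (x + w) y (y + v))].
Proof.
move=> w0 v0 df; set E := rectint f a _ c _.
have s1 : E = rectint f a (a + w) c (c + v + v) + rectint f (a + w) (a + w + w) c (c + v + v).
  by apply: rectint_splitx => //; rewrite ?lerDl// -addrA lerDl addr_ge0.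
have s2 : rectint f a (a + w) c (c + v + v) =
    rectint f a (a + w) c (c + v) + rectint f a (a + w) (c + v) (c + v + v).
  apply: rectint_splity; rewrite ?lerDl//; apply: rect_cderivableS df => //; by rewrite lerDl.
have s3 : rectint f (a + w) (a + w + w) c (c + v + v) =
    rectint f (a + w) (a + w + w) c (c + v) + rectint f (a + w) (a + w + w) (c + v) (c + v + v).
  apply: rectint_splity; rewrite ?lerDl//; apply: rect_cderivableS df => //; by rewrite lerDl.
have n4 : normc E <= (normc (rectint f a (a + w) c (c + v)) +
      normc (rectint f a (a + w) (c + v) (c + v + v))) +
      (normc (rectint f (a + w) (a + w + w) c (c + v)) +
       normc (rectint f (a + w) (a + w + w) (c + v) (c + v + v))).
  rewrite s1 s2 s3; apply: le_trans (normcD _ _) _; apply: lerD; exact: normcD.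
have [h|h1] := leP (normc E) (4 * normc (rectint f a (a + w) c (c + v))).
  by exists a, c; rewrite !lexx !lerDl w0 v0.
have [h|h2] := leP (normc E) (4 * normc (rectint f a (a + w) (c + v) (c + v + v))).
  by exists a, (c + v); rewrite !lexx !lerDl w0 v0.
have [h|h3] := leP (normc E) (4 * normc (rectint f (a + w) (a + w + w) c (c + v))).
  by exists (a + w), c; rewrite !lexx !lerDl w0 v0.
have [h|h4] := leP (normc E) (4 * normc (rectint f (a + w) (a + w + w) (c + v) (c + v + v))).
  by exists (a + w), (c + v); rewrite !lexx !lerDl w0 v0.
by case: (lt_quarters_absurd n4 h1 h2 h3 h4).
Qed.

(** Quartering keeps at least the fraction [4^-n] of the integral in a rectangle with sides [w],
    [v]. Near the limit point [f] is affine up to [e * normc h], so that rectangle contributes at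
    most [4 e (w + v)^2], and [4^n (w + v)^2 = (W + H)^2]. No continuity of the derivative
    enters. *)
Lemma goursat f a b c d : a <= b -> c <= d -> rect_cderivable f a b c d ->
  rectint f a b c d = 0.
Proof.
move=> ab cd df; set W := b - a; set H := d - c.
have W0 : 0 <= W by rewrite subr_ge0.
have H0 : 0 <= H by rewrite subr_ge0.
pose E n x y := rectint f x (x + W / 2 ^+ n) y (y + H / 2 ^+ n).
pose P n x y := [/\ a <= x /\ x + W / 2 ^+ n <= b, c <= y /\ y + H / 2 ^+ n <= d &
   normc (rectint f a b c d) <= 4 ^+ n * normc (E n x y)].
have P0 : P 0%N a c.
  rewrite /P /E !expr0 !divr1 mul1r /W /H !subrKC; split => //.
have step n x y : P n x y -> exists x' y', [/\ P n.+1 x' y',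
     x <= x' /\ x' + W / 2 ^+ n.+1 <= x + W / 2 ^+ n &
     y <= y' /\ y' + H / 2 ^+ n.+1 <= y + H / 2 ^+ n].
  move=> [[ax xb] [cy yd] hE].
  set w := W / 2 ^+ n.+1; set v := H / 2 ^+ n.+1.
  have wE : W / 2 ^+ n = w + w by rewrite /w exprS invfM mulrCA; field; rewrite expf_neq0.
  have vE : H / 2 ^+ n = v + v by rewrite /v exprS invfM mulrCA; field; rewrite expf_neq0.
  have w0 : 0 <= w by rewrite divr_ge0// exprn_ge0.
  have v0 : 0 <= v by rewrite divr_ge0// exprn_ge0.
  rewrite wE in xb; rewrite vE in yd.
  have [x' [y' [/andP[h1 h2] /andP[h3 h4] h5]]] : exists x' y', [/\ x <= x' <= x + w, y <= y' <= y + v &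
      normc (rectint f x (x + w + w) y (y + v + v)) <= 4 * normc (rectint f x' (x' + w) y' (y' + v))].
    by apply: quadrisect => //; apply: rect_cderivableS df; rewrite -?addrA.
  rewrite !addrA in xb yd.
  move: hE; rewrite /E wE vE [x + (w + w)]addrA [y + (v + v)]addrA => hE.
  exists x', y'; rewrite /P /E -/w -/v; split.
  - split; last first.
      by apply: le_trans hE _; rewrite exprSr -mulrA ler_wpM2l// exprn_ge0.
    - by clear - cy h3 h4 yd; split; lra.
    - by clear - ax h1 h2 xb; split; lra.
  - by clear - h1 h2; split; lra.
  - by clear - h3 h4; split; lra.
have [x0 [y0 hxy]] := bisection W0 H0 P0 step.
have z0 : cderivable f (x0 +i* y0).
  have [x [y [[[? ?] [? ?] _]]]] := hxy 0%N; rewrite !expr0 !divr1 => /andP[? ?] /andP[? ?].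
  by apply: df; rewrite /W /H in hxy *; apply/andP; split; lra.
have [D HD] := z0.
suff small e : 0 < e -> normc (rectint f a b c d) <= e * (4 * (W + H) ^+ 2).
  apply: eq0_normc; apply/eqP; rewrite eq_le normc_ge0 andbT; apply/ler_addgt0Pl => e e0.
  (* The summand 1 keeps the denominator positive for a rectangle reduced to a point. *)
  rewrite addr0; apply: le_trans (small (e / (4 * (W + H) ^+ 2 + 1)) _) _.
    by rewrite divr_gt0// ltr_wpDl// mulr_ge0// sqr_ge0.
  rewrite -mulrA ler_piMr//; first exact: ltW.
  rewrite mulrC ler_pdivrMr ?mul1r ?lerDl//.
  by rewrite ltr_wpDl// mulr_ge0// sqr_ge0.
move=> e0; have [r r0 Hr] := HD e e0.
have [n nr] : exists n : nat, (W + H) / 2 ^+ n < r.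
  exists (Num.truncn ((W + H) / r)).+1; rewrite ltr_pdivrMr ?exprn_gt0// mulrC -ltr_pdivrMr//.
  apply: (lt_le_trans (truncnS_gt _)); rewrite -natrX ler_nat ltnW// ltn_expl//.
have [x [y [[[ax xb] [cy yd] hE] /andP[x1 x2] /andP[y1 y2]]]] := hxy n.
apply: (le_trans hE).
set w := W / 2 ^+ n in xb x2 *; set v := H / 2 ^+ n in yd y2 *.
have w0 : 0 <= w by rewrite divr_ge0// exprn_ge0.
have v0 : 0 <= v by rewrite divr_ge0// exprn_ge0.
have xw : x <= x + w by rewrite lerDl.
have yv : y <= y + v by rewrite lerDl.
pose z0' := x0 +i* y0.
(* The first-order Taylor polynomial at the limit point: its boundary integral is 0, so only the
   remainder of [f] counts. *)
pose g z := (f z0' - D * z0') + D * z.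
have dfxy : rect_cderivable f x (x + w) y (y + v) by apply: rect_cderivableS df.
have fh y' : y <= y' <= y + v -> cintegrable `[x, x + w] (fun x => f (x +i* y')).
  by move=> hy; apply: hint_integrable => x' hx; exact: dfxy.
have fv x' : x <= x' <= x + w -> cintegrable `[y, y + v] (fun y => f (x' +i* y)).
  by move=> hx; apply: vint_integrable => y' hy; exact: dfxy.
have dg z : cderivable g z.
  exists D => e1 e10; exists 1 => // h _.
  have -> : g (z + h) - g z - D * h = 0 by rewrite /g; ring.
  by rewrite normc0 mulr_ge0 ?normc_ge0// ltW.
have gh y' : y <= y' <= y + v -> cintegrable `[x, x + w] (fun x => g (x +i* y')).
  by move=> hy; apply: hint_integrable => x' hx; exact: dg.
have gv x' : x <= x' <= x + w -> cintegrable `[y, y + v] (fun y => g (x' +i* y)).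
  by move=> hx; apply: vint_integrable => y' hy; exact: dg.
have EE : E n x y = rectint (fun z => f z - g z) x (x + w) y (y + v).
  by rewrite rectint_sub// rectint_affine// subr0.
have bound x' y' : x <= x' <= x + w -> y <= y' <= y + v ->
    normc (f (x' +i* y') - g (x' +i* y')) <= e * (w + v).
  move=> /andP[hx1 hx2] /andP[hy1 hy2].
  pose h := (x' +i* y') - z0'.
  have hwv : normc h <= w + v.
    apply: le_trans (normc_le_ReIm _) _; rewrite /h !ReImE /=.
    by apply: lerD; rewrite ler_norml; apply/andP; clear - x1 x2 y1 y2 hx1 hx2 hy1 hy2; split; lra.
  have -> : f (x' +i* y') - g (x' +i* y') = f (z0' + h) - f z0' - D * h.
    by rewrite /h /g subrKC; ring.
  apply: le_trans (Hr h _) _; last by rewrite ler_wpM2l// ltW.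
  by apply: le_lt_trans hwv _; rewrite /w /v -mulrDl.
rewrite EE; apply: le_trans (ler_wpM2l _ (rectint_bound xw yv _ _ bound)) _.
- by rewrite exprn_ge0.
- by move=> y' hy; apply: cintegrableB => //; [exact: fh|exact: gh].
- by move=> x' hx; apply: cintegrableB => //; [exact: fv|exact: gv].
rewrite [x + w]addrC addrK [y + v]addrC addrK.
have wv : w + v = (W + H) / 2 ^+ n by rewrite mulrDl.
rewrite wv (_ : 4 ^+ n = 2 ^+ n * 2 ^+ n); last by rewrite -exprMn; congr (_ ^+ _); rewrite -natrM.
set p := 2 ^+ n; have p0 : p != 0 by rewrite expf_neq0.
rewrite le_eqVlt; apply/orP; left; apply/eqP; field.
by [].
Qed.

End Goursat.

(** * Moving the line of integration inside the strip *)

Section ContourShift.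
Context {R : realType}.
Local Notation mu := (@lebesgue_measure R).
Implicit Types (a b c d x y : R) (z w s h : R[i]) (f g : R[i] -> R[i]).

Lemma w34_gt0 x : 0 < w34 x. Proof. exact: expR_gt0. Qed.

Lemma w34_sqr_le x : w34 x ^+ 2 * (1 + x ^+ 2) <= 1.
Proof.
rewrite -[in X in _ * X](lnK (sqrD1_gt0 x)) -expRM_natl -expRD expR_le1.
have : 0 <= ln (1 + x ^+ 2) by rewrite ln_ge0// lerDl sqr_ge0.
set l := ln _; lra.
Qed.

Lemma w34_cvg0 (x : nat -> R) : (forall n, `|x n| = n%:R) -> w34 (x n) @[n --> \oo] --> (0 : R).
Proof.
move=> xn; apply: (@squeeze_cvgr _ _ _ _ (fun=> 0) (fun n => n.+1%:R^-1 * 2)).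
- exists 1%N => // n /= n1; rewrite (ltW (w34_gt0 _)) /= mulrC ler_pdivlMr//.
  have h := w34_sqr_le (x n); rewrite -(real_normK (num_real (x n))) xn in h.
  rewrite -(ler_pXn2r (_ : 0 < 2)%N)// ?nnegrE ?mulr_ge0 ?(ltW (w34_gt0 _))//.
  have h2 : (1 : R) <= n%:R by rewrite ler1n.
  rewrite exprMn -natr1; apply: (@le_trans _ _ (w34 (x n) ^+ 2 * (4 * (1 + n%:R ^+ 2)))).
    by rewrite ler_wpM2l ?sqr_ge0//; nra.
  by clear - h; lra.
- exact: cvg_cst.
- rewrite -(mul0r 2); apply: cvgM; [exact: cvg_harmonic|exact: cvg_cst].
Qed.

(** Cauchy's theorem on [[- n, n]] times [[c, d]]: the two horizontal integrals differ by the
    vertical sides, each at most [2 C (d - c) w34 n], which tends to 0. *)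
Lemma contour_shift f (C M c d : R) : c <= d -> 0 <= C ->
  (forall z, c <= Im z <= d -> cderivable f z) ->
  (forall z, c <= Im z <= d -> M <= `|Re z| -> normc (f z) <= C * w34 (Re z)) ->
  cintegrable setT (fun x => f (x +i* c)) -> cintegrable setT (fun x => f (x +i* d)) ->
  cint setT (fun x => f (x +i* c)) = cint setT (fun x => f (x +i* d)).
Proof.
move=> cd C0 df fC ic id.
pose D n := hint f c (- n%:R) n%:R - hint f d (- n%:R) n%:R.
have Dn : \forall n \near \oo, normc (D n) <= 4 * C * (d - c) * (w34 n%:R).
  exists (Num.truncn `|M|).+1 => // n Mn.
  have nM : M <= n%:R.
    apply: le_trans (ler_norm _) _; apply: ltW; apply: (lt_le_trans (truncnS_gt _)).
    by rewrite ler_nat; exact: Mn.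
  have g0 : rectint f (- n%:R) n%:R c d = 0.
    by apply: goursat; rewrite ?ge0_cp// => x y _ yy; exact: df.
  have -> : D n = 'i * vint f (- n%:R) c d - 'i * vint f n%:R c d.
    move: g0; rewrite /rectint -/(D n) => /eqP; rewrite -addrA addr_eq0 => /eqP ->; ring.
  have v1 x : `|x| = n%:R -> normc (vint f x c d) <= 2 * (C * w34 n%:R) * (d - c).
    move=> xn; apply: normc_cint_itv_le => //.
      by apply: vint_integrable => y yy; exact: df.
    move=> y yy; have -> : w34 n%:R = w34 x by rewrite /w34 -[in RHS](real_normK (num_real x)) xn.
    by apply: (fC (x +i* y)) => //=; rewrite xn.
  apply: le_trans (normcB _ _) _; rewrite !normcM normc_i !mul1r.
  have h1 := v1 (- n%:R); have h2 := v1 n%:R.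
  rewrite normrN (ger0_norm (ler0n _ _)) in h1 h2.
  have := lerD (h1 erefl) (h2 erefl); move/le_trans; apply.
  by rewrite le_eqVlt; apply/orP; left; apply/eqP; ring.
have B0 : (fun n : nat => 4 * C * (d - c) * (w34 n%:R)) @ \oo --> (0 : R).
  rewrite -(mulr0 (4 * C * (d - c))); apply: cvgM; first exact: cvg_cst.
  by apply: w34_cvg0 => n; rewrite ger0_norm.
have key (P : R[i] -> R) (l : R) : (forall z, `|P z| <= normc z) -> P (D n) @[n --> \oo] --> l -> l = 0.
  move=> Pz cl; have c0 : P (D n) @[n --> \oo] --> (0 : R).
    apply/norm_cvg0P; apply: (squeeze_cvgr _ (cvg_cst 0) B0).
    by near=> n; rewrite normr_ge0 /=; apply: le_trans (Pz _) _; near: n.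
  by apply: cvg_unique cl c0.
case: ic id => [c1 c2] [d1 d2]; apply: complexP => /=; apply/eqP; rewrite -subr_eq0; apply/eqP.
  refine (key (@Re R) _ (@le_Re_normc R) _).
  under eq_fun do rewrite cReD cReN; apply: cvgB; exact: Rintegral_sym_cvg.
refine (key (@Im R) _ (@le_Im_normc R) _).
under eq_fun do rewrite cImD cImN; apply: cvgB; exact: Rintegral_sym_cvg.
Unshelve. all: end_near. Qed.

(** For |Re s| = u >= 1 one has [1 + u^2 <= 2 u^2], so [u^(-3/2)] is at most [2^(3/4) w34 u]; this
    explains the factor 2 and the cutoff [Num.max M 1]. The surplus [eps] only improves the bound,
    and the absolute value of [C] guards against a negative constant. *)
Lemma spaceV_bounds f : spaceV f ->
  (forall s, `|Im s| <= 1 -> cderivable f s) /\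
  exists C M : R, [/\ 0 <= C, 0 <= M & forall s, `|Im s| <= 1 -> M <= `|Re s| ->
    normc (f s) <= C * w34 (Re s)].
Proof.
move=> [[dl dl0 hol] [ep ep0 [C [M bd]]]]; split.
  move=> s s1; apply: derivable_cderivable; apply: hol => /=.
  by apply: le_lt_trans s1 _; rewrite ltrDl.
exists (2 * `|C|), (Num.max M 1); split.
- by rewrite mulr_ge0.
- by rewrite le_max ler01 orbT.
move=> s s1; rewrite ge_max => /andP[Ms s2].
have := bd s s1 Ms; rewrite normcE lecR => le1; apply: (le_trans le1).
set x := Re s in Ms s2 *; set u := `|x| in Ms s2 *.
have u0 : 0 < u by exact: lt_le_trans s2.
have l0 : 0 <= ln u by rewrite ln_ge0.
rewrite -mulrA; apply: (@le_trans _ _ (`|C| * u `^ (- (3 / 2) - ep))).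
  by rewrite ler_wpM2r ?powR_ge0// ler_norm.
rewrite mulrCA ler_wpM2l// /powR gt_eqF// /w34.
rewrite -(real_normK (num_real x)) -/u.
have h1 : ln (1 + u ^+ 2) <= ln 2 + 2 * ln u.
  have -> : 2 * ln u = ln (u ^+ 2) by rewrite lnXn// mulr_natl.
  rewrite -lnM ?posrE ?exprn_gt0// ler_ln ?posrE ?mulr_gt0 ?exprn_gt0 ?sqrD1_gt0//.
  have : 1 <= u ^+ 2 by rewrite exprn_ege1.
  lra.
rewrite -[X in _ <= X * _](@lnK _ 2) ?posrE// -expRD ler_expR.
have l2 : 0 <= ln 2 :> R by rewrite ln_ge0// ler1n.
have h2 : 0 <= ep * ln u by rewrite mulr_ge0// ltW.
rewrite mulrBl; move: h1 h2 l0 l2; set a := ln u; set b := ln (1 + _); set e := ep * _; set g := ln 2.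
clear; lra.
Qed.

Lemma cderivable_hline f c : (forall x, cderivable f (x +i* c)) ->
  ccontinuous (fun x => f (x +i* c)).
Proof.
move=> df; have h t : _ := @cderivable_continuous_path _ f (fun u => u +i* c) t (df t).
have n (u t : R) : normc (u +i* c - t +i* c) <= `|u - t|.
  have -> : u +i* c - t +i* c = (u - t)%:C by apply: complexP; rewrite !ReImE /= ?subrr.
  by rewrite normc_real.
by split => t; have [] := h t (fun u => n u t).
Qed.

Lemma spaceV_cintegrable f c : spaceV f -> `|c| <= 1 -> cintegrable setT (fun x => f (x +i* c)).
Proof.
move=> /spaceV_bounds[df [C [M [C0 M0 bd]]]] c1.
have cf : ccontinuous (fun x => f (x +i* c)) by apply: cderivable_hline => x; exact: df.
have [K K0 HK] : exists2 K, 0 <= K & forall x, `|x| <= M -> normc (f (x +i* c)) <= K.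
  have cM : compact (`[- M, M] : set R) by exact: segment_compact.
  have [||m mM Hm] := @EVT_max _ (fun x => normc (f (x +i* c))) (- M) M.
  - by rewrite ge0_cp.
  - by apply: continuous_within; exact: ccontinuous_normc.
  exists (normc (f (m +i* c))); first exact: normc_ge0.
  by move=> x xM; apply: Hm; rewrite in_itv/= -ler_norml.
have wM x : `|x| <= M -> w34 M <= w34 x.
  move=> xM; rewrite /w34 ler_expR !mulNr lerN2 ler_wpM2l// ler_ln ?posrE ?sqrD1_gt0//.
  by rewrite lerD2l -(real_normK (num_real x)) ler_pXn2r ?nnegrE.
(* The decay says nothing on |x| <= M; there the compactness bound [K] is absorbed by [K / w34 M],
   since [w34 x >= w34 M]. *)
have iw := integrable_realZ (C + K / w34 M) measurableT (@integrable_w34 R).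
apply: cintegrable_dom iw _ => //; first exact: ccontinuous_measurable.
move=> x _; rewrite mulrDl.
have KM : 0 <= K / w34 M by rewrite divr_ge0// ltW// w34_gt0.
have [xM|Mx] := leP `|x| M.
  apply: le_trans (HK x xM) _; rewrite -[leLHS]add0r; apply: lerD.
    by rewrite mulr_ge0// ltW// w34_gt0.
  rewrite mulrAC ler_pdivlMr ?w34_gt0// ler_wpM2l//; exact: wM.
rewrite -[leLHS]addr0; apply: lerD; first by apply: (bd (x +i* c)) => //=; exact: ltW.
by rewrite mulr_ge0// ltW// w34_gt0.
Qed.

End ContourShift.

(** * The Fourier transform *)

Section Fubini.
Context {R : realType}.
Local Notation mu := (@lebesgue_measure R).
Local Notation TR := (measurableTypeR R).

(** Domination by a product of integrable functions makes the kernel integrable on the plane, by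
    Tonelli. [real_Fubini] applies this a second time with the variables exchanged to get
    integrability of the other marginal. *)
Lemma real_Fubini_half (k : R -> R -> R) (a b : R -> R) :
  measurable_fun setT (fun z : TR * TR => k z.1 z.2) ->
  mu.-integrable setT (EFin \o a) -> mu.-integrable setT (EFin \o b) ->
  (forall s t, `|k s t| <= a s * b t) ->
  mu.-integrable setT (EFin \o (fun s => \int[mu]_t k s t)) /\
  \int[mu]_s (\int[mu]_t k s t) = \int[mu]_t (\int[mu]_s k s t).
Proof.
move=> mk ia ib kab.
pose f (z : TR * TR) : \bar R := (k z.1 z.2)%:E.
have mf : measurable_fun setT f by apply/measurable_EFinP.
have mks s : measurable_fun setT (k s) by exact: (measurableT_comp mk (pair1_measurable s)).
have mkt t : measurable_fun setT (k ^~ t) by exact: (measurableT_comp mk (pair2_measurable t)).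
have iks s : mu.-integrable setT (EFin \o (k s)).
  by apply: (integrable_real_dom _ (mks s) (integrable_realZ (a s) measurableT ib)).
have ikt t : mu.-integrable setT (EFin \o (k ^~ t)).
  apply: (integrable_real_dom _ (mkt t) (integrable_realZ (b t) measurableT ia)) => //.
  by move=> s _; rewrite mulrC.
have [/measurable_EFinP ma fa] := integrableP _ _ _ ia.
have [/measurable_EFinP mb fb] := integrableP _ _ _ ib.
pose g (z : TR * TR) : \bar R := (a z.1 * b z.2)%:E.
have mg : measurable_fun setT g.
  apply/measurable_EFinP; apply: measurable_funM.
    by apply: (measurableT_comp ma); exact: measurable_fst.
  by apply: (measurableT_comp mb); exact: measurable_snd.
have intg : (mu \x mu)%E.-integrable setT g.
  apply/integrable12ltyP => //=.
  have fbf : (\int[mu]_t `|(b t)%:E|)%E \is a fin_num.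
    by rewrite ge0_fin_numE//; exact: integral_ge0.
  have inner s : (\int[mu]_t `|(a s * b t)%:E| = `|a s|%:E * \int[mu]_t `|(b t)%:E|)%E.
    rewrite -ge0_integralZl_EFin//.
      by apply: eq_integral => t _ /=; rewrite normrM EFinM.
    by apply: measurableT_comp => //; exact/measurable_EFinP.
  under eq_integral do rewrite inner.
  rewrite -(fineK fbf) ge0_integralZr//; last 2 first.
  - by apply/measurable_EFinP; exact: measurableT_comp.
  - by rewrite lee_fin fine_ge0//; exact: integral_ge0.
  have faf : (\int[mu]_t `|(a t)%:E|)%E \is a fin_num.
    by rewrite ge0_fin_numE//; exact: integral_ge0.
  by rewrite -(fineK faf) -EFinM ltry.
have intf : (mu \x mu)%E.-integrable setT f.
  apply: le_integrable intg => // -[s t] _ /=; rewrite lee_fin.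
  by apply: le_trans (kab s t) _; exact: ler_norm.
have FE : fubini_F mu f = EFin \o (fun s => \int[mu]_t k s t).
  by apply/funext => s; rewrite /fubini_F /= fineK//; exact: integrable_fin_num (iks s).
have GE : fubini_G mu f = EFin \o (fun t => \int[mu]_s k s t).
  by apply/funext => t; rewrite /fubini_G /= fineK//; exact: integrable_fin_num (ikt t).
split.
  by rewrite -FE; exact: integrable_fubini_F.
rewrite /Rintegral; congr fine.
have h1 : (\int[mu]_s fubini_F mu f s)%E = (\int[mu]_t fubini_G mu f t)%E by exact: Fubini.
by rewrite FE GE in h1.
Qed.

Lemma real_Fubini (k : R -> R -> R) (a b : R -> R) :
  measurable_fun setT (fun z : TR * TR => k z.1 z.2) ->
  mu.-integrable setT (EFin \o a) -> mu.-integrable setT (EFin \o b) ->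
  (forall s t, `|k s t| <= a s * b t) ->
  [/\ mu.-integrable setT (EFin \o (fun s => \int[mu]_t k s t)),
      mu.-integrable setT (EFin \o (fun t => \int[mu]_s k s t)) &
      \int[mu]_s (\int[mu]_t k s t) = \int[mu]_t (\int[mu]_s k s t)].
Proof.
move=> mk ia ib kab; have [i1 e1] := real_Fubini_half mk ia ib kab.
have mk' : measurable_fun setT (fun z : TR * TR => k z.2 z.1).
  exact: (measurableT_comp mk (@measurable_swap _ _ TR TR)).
have [|i2 _] := @real_Fubini_half (fun t s => k s t) b a mk' ib ia.
  by move=> t s; rewrite mulrC.
by split.
Qed.

Definition jmeasurable (k : R -> R -> R[i]) :=
  measurable_fun setT (fun z : TR * TR => Re (k z.1 z.2)) /\
  measurable_fun setT (fun z : TR * TR => Im (k z.1 z.2)).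

Lemma cint_Fubini (k : R -> R -> R[i]) (a b : R -> R) : jmeasurable k ->
  mu.-integrable setT (EFin \o a) -> mu.-integrable setT (EFin \o b) ->
  (forall s t, normc (k s t) <= a s * b t) ->
  [/\ cintegrable setT (fun s => cint setT (k s)),
      cintegrable setT (fun t => cint setT (k ^~ t)) &
      cint setT (fun s => cint setT (k s)) = cint setT (fun t => cint setT (k ^~ t))].
Proof.
move=> [m1 m2] ia ib kab.
have [] := @real_Fubini (fun s t => Re (k s t)) a b m1 ia ib _.
  by move=> s t; exact: le_trans (le_Re_normc _) (kab s t).
move=> i1 i2 e1; have [] := @real_Fubini (fun s t => Im (k s t)) a b m2 ia ib _.
  by move=> s t; exact: le_trans (le_Im_normc _) (kab s t).
move=> i3 i4 e2; split; [by split|by split|].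
by apply: complexP => /=.
Qed.

Lemma jmeasurableM k l : jmeasurable k -> jmeasurable l ->
  jmeasurable (fun s t => k s t * l s t).
Proof.
move=> [f1 f2] [g1 g2]; split; under eq_fun do rewrite ReImE.
  by apply: measurable_funB; exact: measurable_funM.
by apply: measurable_funD; exact: measurable_funM.
Qed.

Lemma jmeasurable_fst f : cmeasurable setT f -> jmeasurable (fun s _ => f s).
Proof.
move=> [m1 m2]; split.
  exact: (measurableT_comp m1 (@measurable_fst _ _ TR TR)).
exact: (measurableT_comp m2 (@measurable_fst _ _ TR TR)).
Qed.

Lemma jmeasurable_snd f : cmeasurable setT f -> jmeasurable (fun _ t => f t).
Proof.
move=> [m1 m2]; split.
  exact: (measurableT_comp m1 (@measurable_snd _ _ TR TR)).
exact: (measurableT_comp m2 (@measurable_snd _ _ TR TR)).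
Qed.

Lemma jmeasurable_comp f (p : R -> R -> R) : ccontinuous f ->
  measurable_fun setT (fun z : TR * TR => p z.1 z.2) ->
  jmeasurable (fun s t => f (p s t)).
Proof.
move=> [c1 c2] mp; split.
  exact: (measurableT_comp (continuous_measurable_fun c1) mp).
exact: (measurableT_comp (continuous_measurable_fun c2) mp).
Qed.

Lemma measurable_fst_real : measurable_fun setT (fun z : TR * TR => z.1 : R).
Proof. exact: measurable_fst. Qed.

Lemma measurable_snd_real : measurable_fun setT (fun z : TR * TR => z.2 : R).
Proof. exact: measurable_snd. Qed.

(** The argument is complex: for compactly supported continuous [W] the transform is entire, while
    for [W] merely integrable it is used at real points. *)
Definition ft (W : R -> R[i]) (z : R[i]) : R[i] :=
  cint setT (fun t => W t * cexp ('i * z * t%:C)).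

Lemma normc_cexp_real (s t : R) : normc (cexp ('i * s%:C * t%:C)) = 1.
Proof.
by rewrite normc_cexp (_ : Re _ = 0) ?expR0// !ReImE /=; ring.
Qed.

Lemma ccontinuous_cexp_real (s : R) : ccontinuous (fun t => cexp ('i * s%:C * t%:C)).
Proof. exact: ccontinuous_cexpZ. Qed.

Lemma cintegrable_ft (W : R -> R[i]) (s : R) : cintegrable setT W ->
  cintegrable setT (fun t => W t * cexp ('i * s%:C * t%:C)).
Proof.
move=> iW; apply: cintegrable_dom (cintegrable_normc measurableT iW) _ => //.
  apply: cmeasurableM; first exact: cintegrable_measurable.
  by apply: ccontinuous_measurable; exact: ccontinuous_cexp_real.
by move=> t _; rewrite normcM normc_cexp_real mulr1.
Qed.

Lemma normc_ft_le (W : R -> R[i]) (s : R) : cintegrable setT W ->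
  normc (ft W s%:C) <= 2 * \int[mu]_t normc (W t).
Proof.
move=> iW; apply: le_normc_cint => //.
- exact: cintegrable_ft.
- exact: cintegrable_normc.
- by move=> t _; rewrite normcM normc_cexp_real mulr1.
Qed.

(** The multiplication formula, by Fubini. With [e = -1] it moves the transform from [EE] onto the
    function paired with it. *)
Lemma ft_swap (f W : R -> R[i]) (e : R) : cintegrable setT f -> cintegrable setT W ->
  [/\ cintegrable setT (fun s => f s * ft W (e * s)%:C),
      cintegrable setT (fun t => W t * ft f (e * t)%:C) &
      cint setT (fun s => f s * ft W (e * s)%:C) = cint setT (fun t => W t * ft f (e * t)%:C)].
Proof.
move=> fi Wi.
pose k s t := f s * (W t * cexp ('i * (e * s * t)%:C)).
have mk : jmeasurable k.
  apply: jmeasurableM.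
    by apply: jmeasurable_fst; exact: cintegrable_measurable.
  apply: jmeasurableM.
    by apply: jmeasurable_snd; exact: cintegrable_measurable.
  apply: (@jmeasurable_comp (fun x => cexp ('i * x%:C)) (fun s t => e * s * t)).
    exact: ccontinuous_cexpZ.
  apply: measurable_funM; last exact: measurable_snd_real.
  apply: measurable_funM => //; exact: measurable_fst_real.
have [] := cint_Fubini mk (cintegrable_normc measurableT fi) (cintegrable_normc measurableT Wi) _.
  move=> s t; rewrite /k !normcM (_ : normc (cexp _) = 1) ?mulr1//.
  by rewrite normc_cexp (_ : Re _ = 0) ?expR0// !ReImE /=; ring.
have E1 s : cint setT (k s) = f s * ft W (e * s)%:C.
  rewrite /k cintZ//.
    by congr (_ * _); apply: cint_ext => t _; congr (_ * cexp _); rewrite -[RHS]mulrA -rmorphM.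
  apply: cintegrable_ext (cintegrable_ft (e * s) Wi) => // t _.
  by congr (_ * cexp _); rewrite -[LHS]mulrA -rmorphM.
have E2 t : cint setT (k ^~ t) = W t * ft f (e * t)%:C.
  rewrite /k -cintZ//; last exact: cintegrable_ft.
  apply: cint_ext => s _; rewrite mulrCA; do 2 congr (_ * _).
  by congr cexp; rewrite -[RHS]mulrA -rmorphM [e * s * t]mulrAC.
move=> h1 h2 h3; rewrite (funext E1) in h1 h3; rewrite (funext E2) in h2 h3.
by split; [exact: h1|exact: h2|exact: h3].
Qed.

Lemma ft_deriv (W W' : R -> R[i]) (z : R[i]) : is_cderiv W W' -> ccontinuous W' ->
  cintegrable setT (fun t => W t * cexp ('i * z * t%:C)) ->
  cintegrable setT (fun t => W' t * cexp ('i * z * t%:C)) ->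
  (normc (W n%:R * cexp ('i * z * n%:R%:C)) @[n --> \oo] --> (0 : R)) ->
  (normc (W (- n%:R) * cexp ('i * z * (- n%:R)%:C)) @[n --> \oo] --> (0 : R)) ->
  ft W' z = - ('i * z) * ft W z.
Proof.
move=> dW cW' i0 i1 h1 h2.
have d := is_cderivM dW (is_cderiv_cexpZ ('i * z)).
have cW := is_cderiv_continuous dW.
have c : ccontinuous (fun t => W' t * cexp ('i * z * t%:C) + W t * ('i * z * cexp ('i * z * t%:C))).
  apply: ccontinuousD; first by apply: ccontinuousM => //; exact: ccontinuous_cexpZ.
  by apply: ccontinuousM => //; apply: ccontinuousZ; exact: ccontinuous_cexpZ.
have e t : W t * ('i * z * cexp ('i * z * t%:C)) = 'i * z * (W t * cexp ('i * z * t%:C)).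
  by rewrite mulrCA.
have i2 : cintegrable setT (fun t => W t * ('i * z * cexp ('i * z * t%:C))).
  by rewrite (funext e); exact: cintegrableZ.
have := cint_deriv0 d c (cintegrableD measurableT i1 i2) h1 h2.
rewrite cintD// (funext e) cintZ// => /eqP; rewrite addr_eq0 => /eqP; rewrite -/(ft W' z) => ->.
by rewrite mulNr.
Qed.

End Fubini.

(** * The defect vectors *)

Section KernelFunction.
Context {R : realType}.
Local Notation mu := (@lebesgue_measure R).
Variables (tau phi kappa : R).
Hypothesis phi_gt0 : 0 < phi.
Hypothesis phi_ltpi : phi < pi.
Implicit Types (t s x : R).

Lemma sin_phi_gt0 : 0 < sin phi.
Proof. by apply: sin_gt0_pi; rewrite phi_gt0. Qed.

Lemma norm_cos_phi_lt1 : `|cos phi| < 1.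
Proof.
rewrite -(ltr_pXn2r (_ : 0 < 2)%N)// ?nnegrE// real_normK ?num_real// expr1n.
by have := cos2Dsin2 phi; have := exprn_gt0 2 sin_phi_gt0; lra.
Qed.

(** The coefficient of the derivative after the transform: the two shifts contribute the
    exponentials and the middle term of the operator contributes [2 * cos phi]. Its positivity is
    where 0 < phi < pi enters. *)
Definition pcoef t : R := expR t + expR (- t) + 2 * cos phi.
Definition qcoef t : R := 2 * tau * (cos phi + expR t).
Definition cos_gap : R := 1 - `|cos phi|.

Lemma cos_gap_gt0 : 0 < cos_gap. Proof. by rewrite subr_gt0 norm_cos_phi_lt1. Qed.

Lemma expR_addN_ge2 t : 2 <= expR t + expR (- t).
Proof.
have h := expRxMexpNx_1 t; have h1 := expR_gt0 t; have h2 := expR_gt0 (- t).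
set a := expR t in h h1 *; set b := expR (- t) in h h2 *.
have := sqr_ge0 (a - b); nra.
Qed.

(** The sum of the two exponentials is at least 2, so a multiple of it by |cos phi| < 1 already
    compensates a negative [2 * cos phi]. *)
Lemma pcoef_ge t : cos_gap * (expR t + expR (- t)) <= pcoef t.
Proof.
rewrite /pcoef /cos_gap mulrBl mul1r lerD2l.
have h := expR_addN_ge2 t; have := ler_norm (- cos phi); rewrite normrN.
have := normr_ge0 (cos phi); nra.
Qed.

Lemma pcoef_gt0 t : 0 < pcoef t.
Proof.
apply: lt_le_trans (pcoef_ge t); rewrite mulr_gt0 ?cos_gap_gt0// addr_gt0 ?expR_gt0//.
Qed.

Lemma expR_norm_le t : expR `|t| <= expR t + expR (- t).
Proof.
have [t0|t0] := leP 0 t; first by rewrite ger0_norm// lerDl expR_ge0.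
by rewrite ltr0_norm// lerDr expR_ge0.
Qed.

Lemma is_deriv_pcoef t : is_derive t (1 : R) pcoef (expR t - expR (- t)).
Proof.
apply: is_deriv_eq (is_deriv_add (is_deriv_add (is_derive_expR t)
   (is_deriv_expR (is_deriv_opp (is_deriv_id t)))) (is_deriv_cst (2 * cos phi) t)) _.
ring.
Qed.

(* [y = cexp eta] solves [p y' = ((expR (- t) - expR t) / 2 + kappa + 'i q) y], which is what the
   eigenvalue equation for ['i * kappa] becomes under the Fourier transform. *)
Definition eta t : R[i] :=
  (- (1 / 2) * ln (pcoef t) + kappa / sin phi * atan ((expR t + cos phi) / sin phi)) +i*
  (tau * (t + ln (pcoef t))).

Definition eta' t : R[i] :=
  ((- ((expR t - expR (- t)) / 2) + kappa) / pcoef t) +i* (qcoef t / pcoef t).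

(** Completing the square with [cos^2 + sin^2 = 1] turns the denominator in the derivative of the
    arctangent into [expR t * p / sin^2], which leaves [kappa / p]. For the imaginary part,
    [p + p' = 2 (expR t + cos phi)]. *)
Lemma is_cderiv_eta : is_cderiv eta eta'.
Proof.
have sg := sin_phi_gt0; have sn0 : sin phi != 0 by rewrite gt_eqF.
move=> t; have pn0 : pcoef t != 0 by rewrite gt_eqF ?pcoef_gt0.
have dln := is_deriv_ln (pcoef_gt0 t) (is_deriv_pcoef t).
have en0 : expR t != 0 by rewrite gt_eqF ?expR_gt0.
have dat : is_derive t (1 : R) (fun t => atan ((expR t + cos phi) / sin phi)) (sin phi / pcoef t).
  have d1 : is_derive t (1 : R) (fun t => (expR t + cos phi) / sin phi) (expR t / sin phi).
    apply: is_deriv_eq (is_deriv_mul (is_deriv_add (is_derive_expR t) (is_deriv_cst (cos phi) t))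
       (is_deriv_cst (sin phi)^-1 t)) _; ring.
  apply: is_deriv_eq (is_deriv_atan d1) _.
  have cs := cos2Dsin2 phi.
  have -> : 1 + ((expR t + cos phi) / sin phi) ^+ 2 = expR t * pcoef t / sin phi ^+ 2.
    have -> : expR t * pcoef t = expR t ^+ 2 + (cos phi ^+ 2 + sin phi ^+ 2) + 2 * expR t * cos phi.
      by rewrite cs /pcoef expRN; field.
    by field.
  field; by rewrite en0 pn0 sn0.
split => /=.
  apply: is_deriv_eq (is_deriv_add (is_deriv_mul (is_deriv_cst _ t) dln)
     (is_deriv_mul (is_deriv_cst _ t) dat)) _.
  by field; rewrite pn0 sn0.
apply: is_deriv_eq (is_deriv_mul (is_deriv_cst tau t) (is_deriv_add (is_deriv_id t) dln)) _.
rewrite /qcoef /pcoef in pn0 *; move: pn0; rewrite expRN => pn0; field.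
rewrite en0 (_ : _ + _ + _ = expR t * (expR t + (expR t)^-1 + 2 * cos phi)) ?mulf_neq0//.
by field.
Qed.

Lemma continuous_pcoef : continuous pcoef.
Proof. exact: is_deriv_continuous is_deriv_pcoef. Qed.

Lemma continuous_expRN : continuous (fun t : R => expR (- t)).
Proof.
apply: continuous_expR_comp => x; apply: cvgN; exact: cvg_id.
Qed.

Lemma continuous_pcoefV : continuous (fun t => (pcoef t)^-1).
Proof.
by move=> t; apply: cvgV; [rewrite gt_eqF ?pcoef_gt0|exact: continuous_pcoef].
Qed.

Lemma ccontinuous_eta' : ccontinuous eta'.
Proof.
split => /= t; apply: cvgM; try exact: continuous_pcoefV.
  apply: cvgD; last exact: cvg_cst.
  apply: cvgN; apply: cvgM; last exact: cvg_cst.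
  by apply: cvgB; [exact: continuous_expR|exact: continuous_expRN].
apply: cvgM; first exact: cvg_cst.
by apply: cvgD; [exact: cvg_cst|exact: continuous_expR].
Qed.

Definition EE t : R[i] := cexp (eta t).
Definition EE' t : R[i] := eta' t * EE t.

Lemma is_cderiv_EE : is_cderiv EE EE'.
Proof. exact: is_cderiv_cexp is_cderiv_eta. Qed.

Lemma ccontinuous_EE : ccontinuous EE.
Proof. exact: is_cderiv_continuous is_cderiv_EE. Qed.

Lemma ccontinuous_EE' : ccontinuous EE'.
Proof. exact: ccontinuousM ccontinuous_eta' ccontinuous_EE. Qed.

Lemma EE_neq0 t : EE t != 0. Proof. exact: cexp_neq0. Qed.

(** The numerators grow no faster than [pcoef]. As [EE' = eta' * EE], the derivative inherits the
    integrability of [EE]. *)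
Lemma normc_eta'_le : exists2 K : R, 0 <= K & forall t, normc (eta' t) <= K.
Proof.
have d0 := cos_gap_gt0.
exists ((1 / 2 + `|kappa| + 4 * `|tau|) / cos_gap).
  by rewrite divr_ge0 ?(ltW d0)// !addr_ge0// mulr_ge0.
move=> t; apply: (le_trans (normc_le_ReIm _)) => /=.
have p0 := pcoef_gt0 t; have pg := pcoef_ge t.
rewrite (normrM _ (pcoef t)^-1) (normrM (qcoef t)) normfV (gtr0_norm p0) -mulrDl ler_pdivrMr// [X in _ <= X]mulrAC ler_pdivlMr//.
have e2 := expR_addN_ge2 t; have e1 := expR_gt0 t; have e1' := expR_gt0 (- t).
set a := expR t in pg e2 e1 *; set b := expR (- t) in pg e2 e1' *.
apply: (@le_trans _ _ ((1 / 2 + `|kappa| + 4 * `|tau|) * (cos_gap * (a + b)))); last first.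
  by rewrite ler_wpM2l// !addr_ge0// mulr_ge0.
rewrite mulrCA [X in _ <= X]mulrC ler_pM2r//.
have h1 : `|- ((a - b) / 2) + kappa| <= (a + b) / 2 + `|kappa|.
  apply: le_trans (ler_normD _ _) _; rewrite lerD2r normrN ler_norml; apply/andP; split; lra.
have h2 : `|cos phi + a| <= 1 + a.
  apply: le_trans (ler_normD _ _) _; rewrite (gtr0_norm e1) lerD2r; exact: cos_max.
have k0 := normr_ge0 kappa; have t0 := normr_ge0 tau.
have h3 : `|qcoef t| <= 2 * `|tau| * (1 + a).
  by rewrite /qcoef -/a normrM normrM (ger0_norm (_ : 0 <= 2))// ler_wpM2l// mulr_ge0.
have h4 : `|kappa| * 2 <= `|kappa| * (a + b) by rewrite ler_wpM2l.
have h5 : `|tau| * 2 <= `|tau| * (a + b) by rewrite ler_wpM2l.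
have h6 : 0 <= `|tau| * b by rewrite mulr_ge0// ltW.
have h7 : 0 <= `|tau| * a by rewrite mulr_ge0// ltW.
clear - h1 h3 h4 h5 h6 h7 k0 t0; lra.
Qed.

(** The bound [p >= cos_gap e^|t|] turns the factor [p^(-1/2)] of the modulus into e^(-|t|/2); the
    arctangent factor is bounded, whatever the sign of [kappa]. *)
Lemma normc_EE_le : exists2 C : R, 0 <= C & forall t, normc (EE t) <= C * expR (- (1 / 2 * `|t|)).
Proof.
have d0 := cos_gap_gt0.
exists (expR (- (1 / 2) * ln cos_gap + `|kappa / sin phi| * pi)); first exact: expR_ge0.
move=> t; rewrite /EE normc_cexp -expRD ler_expR /=.
have h1 : ln cos_gap + `|t| <= ln (pcoef t).
  rewrite -{1}(expRK `|t|) -lnM ?posrE ?expR_gt0// ler_ln ?posrE ?mulr_gt0 ?expR_gt0 ?pcoef_gt0//.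
  apply: le_trans (pcoef_ge t); rewrite ler_pM2l//; exact: expR_norm_le.
have h2 : kappa / sin phi * atan ((expR t + cos phi) / sin phi) <= `|kappa / sin phi| * pi.
  apply: le_trans (ler_norm _) _; rewrite normrM ler_wpM2l//.
  set x := (_ / _); have := atan_gtNpi2 x; have := atan_ltpi2 x.
  by have := pi_gt0 R; rewrite ler_norml => ? ? ?; apply/andP; split; lra.
clear - h1 h2; lra.
Qed.

Lemma cintegrable_EE : cintegrable setT EE.
Proof.
have [C C0 HC] := normc_EE_le.
have i := integrable_realZ C measurableT (integrable_expRNabs (_ : 0 < 1 / 2 :> R)).
apply: cintegrable_dom (i _) _ => //.
by apply: ccontinuous_measurable; exact: ccontinuous_EE.
Qed.

Lemma cintegrable_EE' : cintegrable setT EE'.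
Proof.
have [K K0 HK] := normc_eta'_le.
apply: cintegrable_dom (integrable_realZ K measurableT (cintegrable_normc measurableT cintegrable_EE)) _ => //.
  by apply: ccontinuous_measurable; exact: ccontinuous_EE'.
by move=> t _; rewrite normcM ler_wpM2r ?normc_ge0.
Qed.

Lemma normc_EE_cvg0 (x : nat -> R) : (forall n, `|x n| = n%:R) -> normc (EE (x n)) @[n --> \oo] --> (0 : R).
Proof.
move=> xn; have [C C0 HC] := normc_EE_le.
apply: (@squeeze_cvgr _ _ _ _ (fun=> 0) (fun n => C * 2 * n.+1%:R^-1)).
- apply: nearW => n; rewrite normc_ge0 /=; apply: (le_trans (HC _)).
  rewrite -[X in _ <= X]mulrA ler_wpM2l// xn expRN invf_ple ?posrE ?expR_gt0//.
    rewrite invfM invrK; apply: le_trans (expR_ge1Dx _); rewrite (_ : n.+1%:R = n%:R + 1 :> R); [lra|by rewrite natr1].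
- exact: cvg_cst.
- rewrite -(mulr0 (C * 2)); apply: cvgM; [exact: cvg_cst|exact: cvg_harmonic].
Qed.

(* Grouped as the three terms of [difference_op] produce it. *)
Lemma EE_ode t :
  (expR (- t))%:C * (- 'i * EE' t + 'i / 2 * EE t) +
  (2 * cos phi)%:C * (- 'i * EE' t - tau%:C * EE t) +
  (expR t)%:C * (- 'i * EE' t - (2 * tau)%:C * EE t - 'i / 2 * EE t) =
  - ('i * kappa%:C) * EE t.
Proof.
have pn0 : pcoef t != 0 by rewrite gt_eqF ?pcoef_gt0.
have key : (pcoef t)%:C * eta' t = (- ((expR t - expR (- t)) / 2) + kappa) +i* (qcoef t).
  by apply: complexP; rewrite !ReImE /=; field; rewrite pn0.
have -> : - ('i * kappa%:C) * EE t = (- 'i * ((pcoef t)%:C * eta' t) +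
    ('i / 2) * (expR (- t) - expR t)%:C - (qcoef t)%:C) * EE t.
  have h2 : 'i / 2 = 'i * (2^-1 : R)%:C :> R[i] by rewrite fmorphV rmorph_nat.
  rewrite key h2; congr (_ * _); apply: complexP; rewrite !ReImE /=; by field.
rewrite /EE' /pcoef /qcoef !(rmorphD, rmorphB, rmorphM)/=; ring.
Qed.

End KernelFunction.

(** * Square-integrable complex functions *)

Section L2Facts.
Context {R : realType}.
Local Notation mu := (@lebesgue_measure R).
Implicit Types (u v w : R -> R[i]).

Lemma L2_cmeasurable u : L2 u -> cmeasurable setT u.
Proof.
by move=> [/sub_Lfun_mfun/set_mem ? /sub_Lfun_mfun/set_mem ?].
Qed.

Lemma Lfun2_dom (f b : R -> R) : measurable_fun setT f ->
  mu.-integrable setT (EFin \o b) -> (forall x, f x ^+ 2 <= b x) -> f \in Lfun mu 2%:E.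
Proof.
move=> mf ib fb.
have i2 : mu.-integrable setT (EFin \o (fun x => f x ^+ 2)).
  apply: integrable_real_dom ib _ => //; first exact: measurable_funX.
  by move=> x _; rewrite ger0_norm ?sqr_ge0.
rewrite inE; apply/andP; split; rewrite inE//=.
rewrite /finite_norm unlock /Lnorm; apply: poweR_lty.
have /integrableP[_] := i2; apply: le_lt_trans.
rewrite le_eqVlt; apply/orP; left; apply/eqP; apply: eq_integral => x _ /=.
by rewrite powR_mulrn// real_normK ?num_real// (ger0_norm (sqr_ge0 _)).
Qed.

Lemma L2_dom u (b : R -> R) : cmeasurable setT u ->
  mu.-integrable setT (EFin \o b) -> (forall x, normc (u x) ^+ 2 <= b x) -> L2 u.
Proof.
move=> [m1 m2] ib ub; split; apply: Lfun2_dom ib _ => // x;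
  apply: le_trans (ub x); rewrite normc_sqr ?lerDl ?lerDr sqr_ge0//.
Qed.

Lemma L2_sqr_bound u (K : R) : cmeasurable setT u ->
  (forall x, normc (u x) ^+ 2 * (1 + x ^+ 2) <= K) -> L2 u.
Proof.
move=> mu_ uK; apply: L2_dom mu_ (integrable_realZ K measurableT (@integrable_sqrD1V R)) _ => x.
by rewrite ler_pdivlMr ?sqrD1_gt0.
Qed.

(** Bounds on [u] and on [s u] together give decay like 1 / (1 + |s|). For a transform they come
    from the integrals of a function and of its derivative. *)
Lemma L2_mul_bound u (A B : R) : cmeasurable setT u -> (forall s, normc (u s) <= A) ->
  (forall s, normc (s%:C * u s) <= B) -> L2 u.
Proof.
move=> mu_ uA uB; apply: (@L2_sqr_bound _ (A ^+ 2 + B ^+ 2)) => // s.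
have A0 : 0 <= A by exact: le_trans (normc_ge0 _) (uA s).
have B0 : 0 <= B by exact: le_trans (normc_ge0 _) (uB s).
rewrite mulrDr mulr1 (_ : _ * s ^+ 2 = normc (s%:C * u s) ^+ 2); last first.
  by rewrite normcM normc_real exprMn real_normK ?num_real// mulrC.
by apply: lerD; rewrite ler_pXn2r// ?nnegrE ?normc_ge0.
Qed.

Lemma L2_mul_integrable (f g : R -> R) : f \in Lfun mu 2%:E -> g \in Lfun mu 2%:E ->
  mu.-integrable setT (EFin \o (fun x => f x * g x)).
Proof. by move=> hf hg; apply/Lfun1_integrable; exact: Lfun2_mul_Lfun1. Qed.

Lemma L2_cintegrable u v : L2 u -> L2 v -> cintegrable setT (fun x => u x * v x).
Proof.
move=> [u1 u2] [v1 v2]; split.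
  have -> : (fun x => Re (u x * v x)) =
      (fun x => Re (u x) * Re (v x) + (-1) * (Im (u x) * Im (v x))).
    by apply/funext => x; rewrite !ReImE; ring.
  by apply: integrable_realD => //; [|apply: integrable_realZ => //]; exact: L2_mul_integrable.
under eq_fun do rewrite ReImE.
by apply: integrable_realD => //; exact: L2_mul_integrable.
Qed.

Lemma Lfun2_opp (f : R -> R) : f \in Lfun mu 2%:E -> (fun x => - f x) \in Lfun mu 2%:E.
Proof.
move=> hf; have i2 := Lfun2_integrable_sqr hf.
have /sub_Lfun_mfun/set_mem mf := hf.
apply: Lfun2_dom i2 _ => //; first exact: measurableT_comp.
by move=> x; rewrite sqrrN.
Qed.

Lemma L2_conj u : L2 u -> L2 (fun x => (u x)^*).
Proof.
move=> [u1 u2]; split.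
  by under eq_fun do rewrite cReC.
by under eq_fun do rewrite cImC; exact: Lfun2_opp.
Qed.

Lemma L2_normc_sqr u : L2 u -> mu.-integrable setT (EFin \o (fun x => normc (u x) ^+ 2)).
Proof.
move=> [u1 u2]; under eq_fun do rewrite normc_sqr.
by apply: integrable_realD => //; exact: Lfun2_integrable_sqr.
Qed.

Lemma L2Z (c : R[i]) u : L2 u -> L2 (fun x => c * u x).
Proof.
move=> hu; apply: L2_dom (integrable_realZ (normc c ^+ 2) measurableT (L2_normc_sqr hu)) _.
  apply: cmeasurableM; last exact: L2_cmeasurable.
  by apply: ccontinuous_measurable; exact: ccontinuous_cst.
by move=> x; rewrite normcM exprMn.
Qed.

Lemma cint_ae u v : cmeasurable setT u -> cmeasurable setT v -> ae_equal u v ->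
  cint setT u = cint setT v.
Proof.
move=> [u1 u2] [v1 v2] [N [mN N0 sub]].
by apply: complexP => /=; congr fine; apply: ae_eq_integral => //;
  try exact/measurable_EFinP; exists N; split => // x /= h; apply: sub => /= uv; apply: h => _; rewrite uv.
Qed.

End L2Facts.

(** * Continuity of transforms, and their behaviour under a shift of the line *)

Section FourierLinear.
Context {R : realType}.
Implicit Types (W V : R -> R[i]).

Lemma ftD W V (s : R) : cintegrable setT W -> cintegrable setT V ->
  ft (fun t => W t + V t) s%:C = ft W s%:C + ft V s%:C.
Proof.
move=> hW hV; rewrite /ft -cintD//; try exact: cintegrable_ft.
by apply: cint_ext => t _; rewrite mulrDl.
Qed.

Lemma ftZ c W (s : R) : cintegrable setT W ->
  ft (fun t => c * W t) s%:C = c * ft W s%:C.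
Proof.
move=> hW; rewrite /ft -cintZ//; try exact: cintegrable_ft.
by apply: cint_ext => t _; rewrite mulrA.
Qed.

Lemma ft_ext W V z : W =1 V -> ft W z = ft V z.
Proof. by move=> /funext ->. Qed.

Lemma ft_ccontinuous W (e : R) : cintegrable setT W -> ccontinuous (fun s => ft W (e * s)%:C).
Proof.
move=> hW; have [m1 m2] := cintegrable_measurable hW.
have iN := cintegrable_normc measurableT hW.
have key (P : R[i] -> R) : (forall z, `|P z| <= normc z) ->
   (forall s : R, (@lebesgue_measure R).-integrable setT (EFin \o (fun t => P (W t * cexp ('i * (e * s)%:C * t%:C))))) ->
   (forall t : R, continuous (fun s : R => P (W t * cexp ('i * (e * s)%:C * t%:C)))) ->
   continuous (fun s : R => (\int[@lebesgue_measure R]_t P (W t * cexp ('i * (e * s)%:C * t%:C)))%R).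
  move=> Pz iP cP s.
  have := (@continuity_under_integral R _ _ (@lebesgue_measure R) (fun s t => P (W t * cexp ('i * (e * s)%:C * t%:C))) setT measurableT
     (s - 1) (s + 1) _ _ (fun t => normc (W t)) iN).
  apply.
  - by move=> x _; exact: iP.
  - by apply: aeW => t _ x _; exact: cP.
  - move=> x _; apply: aeW => t _; apply: le_trans (Pz _) _.
    by rewrite normcM normc_cexp_real mulr1.
  - by rewrite inE /= in_itv/=; apply/andP; split; rewrite ?ltrBlDr ltrDl.
have cc t : ccontinuous (fun s : R => W t * cexp ('i * (e * s)%:C * t%:C)).
  apply: ccontinuousZ; apply: ccontinuous_ext (ccontinuous_cexpZ ('i * (e * t)%:C)) => s.
  by congr cexp; rewrite -!mulrA -!rmorphM; congr (_ * _%:C); ring.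
split.
  apply: (key (@Re R) (@le_Re_normc R)).
    by move=> s; have [] := cintegrable_ft (e * s) hW.
  by move=> t; have [] := cc t.
apply: (key (@Im R) (@le_Im_normc R)).
  by move=> s; have [] := cintegrable_ft (e * s) hW.
by move=> t; have [] := cc t.
Qed.

(** [contour_shift] for [h z = f z e^(- i t z)]: at height [y] the exponential contributes the real
    factor [e^(y t)], at most e^|t| in the strip. *)
Lemma ft_contour_shift (f : R[i] -> R[i]) (c d t : R) : spaceV f -> -1 <= c -> c <= d -> d <= 1 ->
  ft (fun x => f (x +i* c)) (-1 * t)%:C * (expR (c * t))%:C =
  ft (fun x => f (x +i* d)) (-1 * t)%:C * (expR (d * t))%:C.
Proof.
move=> Vf c1 cd d1; have [df [C [M [C0 M0 bd]]]] := spaceV_bounds Vf.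
pose h z := f z * cexp ('i * (-1 * t)%:C * z).
have hE (y x : R) : h (x +i* y) = f (x +i* y) * cexp ('i * (-1 * t)%:C * x%:C) * (expR (y * t))%:C.
  rewrite /h -[RHS]mulrA; congr (_ * _).
  have -> : (expR (y * t))%:C = cexp (y * t)%:C.
    by apply: complexP; rewrite ?Re_cexp ?Im_cexp /= ?cos0 ?sin0 ?mulr1 ?mulr0.
  by rewrite -cexpD; congr cexp; apply: complexP; rewrite !ReImE /=; ring.
have hi y : `|y| <= 1 -> cintegrable setT (fun x => f (x +i* y) * cexp ('i * (-1 * t)%:C * x%:C)).
  by move=> y1; apply: cintegrable_ft; exact: spaceV_cintegrable.
have yc : `|c| <= 1 by rewrite ler_norml; apply/andP; split; lra.
have yd : `|d| <= 1 by rewrite ler_norml; apply/andP; split; lra.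
have cE y : `|y| <= 1 -> ft (fun x => f (x +i* y)) (-1 * t)%:C * (expR (y * t))%:C =
    cint setT (fun x => h (x +i* y)).
  by move=> y1; rewrite (funext (hE y)) cintZr//; exact: hi.
rewrite !cE//; apply: (@contour_shift _ h (C * expR `|t|) M) => //.
- by rewrite mulr_ge0// expR_ge0.
- move=> z /andP[z1 z2]; apply: cderivableM; last exact: cderivable_cexpZ.
  by apply: df; rewrite ler_norml; apply/andP; split; lra.
- move=> [x y] /= /andP[z1 z2] Mx.
  have y1 : `|y| <= 1 by rewrite ler_norml; apply/andP; split; lra.
  rewrite hE !normcM normc_cexp_real mulr1 normc_real ger0_norm ?expR_ge0//.
  rewrite mulrAC; apply: ler_pM; rewrite ?normc_ge0 ?expR_ge0//; first exact: (bd (x +i* y)).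
  rewrite ler_expR; apply: le_trans (ler_norm _) _; rewrite normrM ler_piMl//.
- rewrite (funext (hE c)); under eq_fun do rewrite mulrC; exact: cintegrableZ (hi c yc).
- rewrite (funext (hE d)); under eq_fun do rewrite mulrC; exact: cintegrableZ (hi d yd).
Qed.

End FourierLinear.

(** * The explicit vector solves the defect equation *)

Section Existence.
Context {R : realType}.
Local Notation mu := (@lebesgue_measure R).
Variables (tau phi kappa : R).
Hypothesis phi_gt0 : 0 < phi.
Hypothesis phi_ltpi : phi < pi.
Implicit Types (t s x : R).

Local Notation EE := (EE tau phi kappa).
Local Notation EE' := (EE' tau phi kappa).
Local Notation EEi := (cintegrable_EE tau kappa phi_gt0 phi_ltpi).
Local Notation EE'i := (cintegrable_EE' tau kappa phi_gt0 phi_ltpi).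

(* The conjugate of the defect vector for the eigenvalue ['i * kappa]. *)
Definition ghat s : R[i] := ft EE (-1 * s)%:C.

Definition gdef s : R[i] := (ghat s)^*.

Lemma ghat_ccontinuous : ccontinuous ghat.
Proof. exact: ft_ccontinuous EEi. Qed.

Lemma ghat_mul s : s%:C * ghat s = - 'i * ft EE' (-1 * s)%:C.
Proof.
have := @ft_deriv _ EE EE' (-1 * s)%:C (is_cderiv_EE tau kappa phi_gt0 phi_ltpi)
  (ccontinuous_EE' tau kappa phi_gt0 phi_ltpi) (cintegrable_ft _ EEi) (cintegrable_ft _ EE'i).
under eq_fun do rewrite normcM normc_cexp_real mulr1.
under [X in _ -> X @ _ --> _ -> _]eq_fun do rewrite normcM normc_cexp_real mulr1.
move=> ->.
- rewrite /ghat; apply: complexP; rewrite !ReImE /=; ring.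
- by apply: normc_EE_cvg0 => // n; rewrite ger0_norm.
- by apply: normc_EE_cvg0 => // n; rewrite normrN ger0_norm.
Qed.

Lemma L2_ghat : L2 ghat.
Proof.
apply: (@L2_mul_bound _ _ (2 * \int[mu]_t normc (EE t)) (2 * \int[mu]_t normc (EE' t))).
- by apply: ccontinuous_measurable; exact: ghat_ccontinuous.
- by move=> s; exact: normc_ft_le EEi.
- by move=> s; rewrite ghat_mul normcM normcN normc_i mul1r; exact: normc_ft_le EE'i.
Qed.

Lemma L2_gdef : L2 gdef. Proof. exact: L2_conj L2_ghat. Qed.

(** Multiplying [ghat] by [s] amounts to differentiating [EE]. These are the functions whose
    transforms are [ghat] times the three coefficients of [difference_op]. *)
Let W1 t := - 'i * EE' t + 'i / 2 * EE t.
Let W2 t := (2 * cos phi)%:C * (- 'i * EE' t + - tau%:C * EE t).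
Let W3 t := - 'i * EE' t + (- (2 * tau)%:C - 'i / 2) * EE t.

Lemma ft_lin (a b : R[i]) s : ft (fun t => a * EE' t + b * EE t) (-1 * s)%:C =
  a * ft EE' (-1 * s)%:C + b * ghat s.
Proof.
rewrite ftD; [|exact: cintegrableZ EE'i|exact: cintegrableZ EEi].
by rewrite !ftZ//; [exact: EEi|exact: EE'i].
Qed.

Lemma cintegrable_lin (a b : R[i]) : cintegrable setT (fun t => a * EE' t + b * EE t).
Proof. apply: cintegrableD => //; [exact: cintegrableZ EE'i|exact: cintegrableZ EEi]. Qed.

Lemma ft_W1 s : 'i * (1 / 2 - 'i * s%:C) * ghat s = ft W1 (-1 * s)%:C.
Proof.
rewrite ft_lin -ghat_mul -mulrDl; congr (_ * _).
have h2 : 2^-1 = (2^-1 : R)%:C :> R[i] by rewrite fmorphV rmorph_nat.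
by rewrite h2; apply: complexP; rewrite !ReImE /=; ring.
Qed.

Lemma ft_W2 s : 2 * (s%:C - tau%:C) * (cos phi)%:C * ghat s = ft W2 (-1 * s)%:C.
Proof.
rewrite ftZ; last exact: cintegrable_lin.
rewrite ft_lin -ghat_mul -mulrDl mulrA; congr (_ * _).
rewrite rmorphM /= rmorph_nat; ring.
Qed.

Lemma ft_W3 s : - ('i * (1 / 2 + 'i * s%:C - 2 * 'i * tau%:C)) * ghat s = ft W3 (-1 * s)%:C.
Proof.
rewrite ft_lin -ghat_mul -mulrDl; congr (_ * _).
have h2 : 2^-1 = (2^-1 : R)%:C :> R[i] by rewrite fmorphV rmorph_nat.
by rewrite h2; apply: complexP; rewrite !ReImE /=; ring.
Qed.

Lemma expR_shift_solve1 (X Y : R[i]) t :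
  Y * (expR (0 * t))%:C = X * (expR (1 * t))%:C -> X = (expR (- t))%:C * Y.
Proof.
rewrite mul0r mul1r expR0 mulr1 => ->.
by rewrite mulrCA -rmorphM /= (mulrC (expR (- t))) expRxMexpNx_1 mulr1.
Qed.

Lemma expR_shift_solveN1 (X Y : R[i]) t :
  X * (expR (-1 * t))%:C = Y * (expR (0 * t))%:C -> X = (expR t)%:C * Y.
Proof.
rewrite mul0r mulN1r expR0 mulr1 => <-.
by rewrite mulrCA -rmorphM /= expRxMexpNx_1 mulr1.
Qed.

(** Fubini puts the transform on [f], where moving the line replaces [f (s + i)] and [f (s - i)] by
    factors [e^-t] and [e^t]. What remains is the left-hand side of [EE_ode] against the transform
    of [f], and a second use of Fubini goes back. *)
Lemma difference_op_ghat (f : R[i] -> R[i]) : spaceV f ->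
  cint setT (fun s => difference_op tau phi f s%:C * ghat s) =
  cint setT (fun s => f s%:C * (- ('i * kappa%:C) * ghat s)).
Proof.
move=> Vf.
pose fc c (s : R) := f (s +i* c).
have fi c : `|c| <= 1 -> cintegrable setT (fc c) by exact: spaceV_cintegrable.
have f1i : cintegrable setT (fc 1) by apply: fi; rewrite normr1.
have f0i : cintegrable setT (fc 0) by apply: fi; rewrite normr0 ler01.
have fmi : cintegrable setT (fc (-1)) by apply: fi; rewrite normrN normr1.
have W1i : cintegrable setT W1 by exact: cintegrable_lin.
have W2i : cintegrable setT W2 by apply: cintegrableZ => //; exact: cintegrable_lin.
have W3i : cintegrable setT W3 by exact: cintegrable_lin.
have N10 : -1 <= 0 :> R by rewrite oppr_le0.
have [a1 b1 e1] := ft_swap (-1) f1i W1i.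
have [a2 b2 e2] := ft_swap (-1) f0i W2i.
have [a3 b3 e3] := ft_swap (-1) fmi W3i.
have [a4 b4 e4] := ft_swap (-1) f0i EEi.
have E s : difference_op tau phi f s%:C * ghat s =
    fc 1 s * ft W1 (-1 * s)%:C + fc 0 s * ft W2 (-1 * s)%:C + fc (-1) s * ft W3 (-1 * s)%:C.
  rewrite -ft_W1 -ft_W2 -ft_W3 /difference_op /fc.
  have -> : s%:C + 'i = s +i* 1 by apply: complexP => /=; rewrite ?addr0 ?add0r.
  have -> : s%:C - 'i = s +i* (-1) by apply: complexP => /=; rewrite ?subr0 ?sub0r.
  ring.
rewrite (funext E) (cintD measurableT (cintegrableD measurableT a1 a2) a3) (cintD measurableT a1 a2).
rewrite e1 e2 e3.
have c1 t : ft (fc 1) (-1 * t)%:C = (expR (- t))%:C * ft (fc 0) (-1 * t)%:C.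
  exact: (expR_shift_solve1 (@ft_contour_shift R f 0 1 t Vf N10 ler01 (lexx 1))).
have cm t : ft (fc (-1)) (-1 * t)%:C = (expR t)%:C * ft (fc 0) (-1 * t)%:C.
  exact: (expR_shift_solveN1 (@ft_contour_shift R f (-1) 0 t Vf (lexx (-1)) N10 ler01)).
rewrite -(cintD measurableT b1 b2) -(cintD measurableT (cintegrableD measurableT b1 b2) b3).
have -> : (fun s => f s%:C * (- ('i * kappa%:C) * ghat s)) =
   (fun s => - ('i * kappa%:C) * (fc 0 s * ghat s)).
  by apply/funext => s; rewrite mulrCA.
rewrite (cintZ _ measurableT a4) e4 -(cintZ _ measurableT b4); apply: cint_ext => t _.
rewrite c1 cm [RHS]mulrA -(EE_ode tau kappa phi_gt0 phi_ltpi t) /W1 /W2 /W3; ring.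
Qed.

Lemma gdef_defect : ker_sub (adjoint (opL tau phi)) ('i * kappa%:C) gdef.
Proof.
split => /=; [exact: L2_gdef|exact: L2Z L2_gdef|].
move=> u w [/= hu hw [f Vf [uf wf]]].
have gE s : (gdef s)^* = ghat s by rewrite /gdef conjcK.
have cE : (fun s => (gdef s)^*) = ghat by apply/funext.
have mg : cmeasurable setT ghat by exact: L2_cmeasurable L2_ghat.
have mu_ := L2_cmeasurable hu; have mw := L2_cmeasurable hw.
have [df _] := spaceV_bounds Vf.
have cf c : `|c| <= 1 -> ccontinuous (fun x : R => f (x +i* c)).
  by move=> c1; apply: cderivable_hline => x; exact: df.
have mLf : cmeasurable setT (fun x => difference_op tau phi f x%:C).
  apply: ccontinuous_measurable; rewrite /difference_op.
  have c1 : ccontinuous (fun x => f (x%:C + 'i)).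
    have -> : (fun x => f (x%:C + 'i)) = (fun x => f (x +i* 1)).
      by apply/funext => x; congr f; apply: complexP => /=; rewrite ?addr0 ?add0r.
    by apply: cf; rewrite normr1.
  have cm : ccontinuous (fun x => f (x%:C - 'i)).
    have -> : (fun x => f (x%:C - 'i)) = (fun x => f (x +i* (-1))).
      by apply/funext => x; congr f; apply: complexP => /=; rewrite ?subr0 ?sub0r.
    by apply: cf; rewrite normrN normr1.
  have ca : ccontinuous (fun x => f x%:C) by apply: cf; rewrite normr0 ler01.
  apply: ccontinuousB; last first.
    apply: ccontinuousM => //; apply: ccontinuousZ; apply: ccontinuousB; last exact: ccontinuous_cst.
    apply: ccontinuousD; first exact: ccontinuous_cst.
    by apply: ccontinuousZ; exact: ccontinuous_id.
  apply: ccontinuousD; last first.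
    apply: ccontinuousM => //; apply: ccontinuousM; last exact: ccontinuous_cst.
    by apply: ccontinuousZ; apply: ccontinuousB; [exact: ccontinuous_id|exact: ccontinuous_cst].
  apply: ccontinuousM => //; apply: ccontinuousZ; apply: ccontinuousB; first exact: ccontinuous_cst.
  by apply: ccontinuousZ; exact: ccontinuous_id.
rewrite /L2_dot !cintegralE.
(* [u] and [w] agree with [f] and its image only almost everywhere; measurability of all factors
   lets [cint_ae] replace them. *)
transitivity (cint setT (fun s => difference_op tau phi f s%:C * ghat s)).
  apply: cint_ae.
  - by apply: cmeasurableM => //; rewrite cE.
  - exact: cmeasurableM.
  - case: wf => N [mN N0 sub]; exists N; split => // x /= h; apply: sub => /= e; apply: h.
    by rewrite e; congr (_ * _); exact: gE.
rewrite difference_op_ghat//; apply: cint_ae.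
- apply: cmeasurableM.
    by apply: ccontinuous_measurable; apply: cf; rewrite normr0 ler01.
  by apply: cmeasurableM => //; apply: ccontinuous_measurable; exact: ccontinuous_cst.
- apply: cmeasurableM => //; apply: cmeasurable_conj; apply: cmeasurableM.
    by apply: ccontinuous_measurable; exact: ccontinuous_cst.
  exact: cmeasurable_conj.
- case: uf => N [mN N0 sub]; exists N; split => // x /= h; apply: sub => /= e; apply: h.
  rewrite e; congr (_ * _); rewrite -[RHS]/(conjc _) conjcM.
  rewrite -[conjc (gdef x)]/((gdef x)^* ) gE; congr (_ * _).
  by apply: complexP; rewrite !ReImE /=; ring.
Qed.

End Existence.

(** * Totality of the transforms of test functions *)

Section Bump.
Context {R : realType}.
Local Notation mu := (@lebesgue_measure R).
Implicit Types (t s x : R).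

Definition pos x : R := Num.max 0 x.

Lemma pos_ge0 x : 0 <= pos x. Proof. by rewrite /pos le_max lexx. Qed.

Lemma pos_id x : 0 <= x -> pos x = x. Proof. by move=> x0; rewrite /pos max_r. Qed.

Lemma pos_eq0 x : x <= 0 -> pos x = 0. Proof. by move=> x0; rewrite /pos max_l. Qed.

Lemma continuous_pos : continuous pos.
Proof.
have -> : pos = (fun x => (x + `|x|) / 2).
  apply/funext => x; have [x0|x0] := leP 0 x.
    by rewrite pos_id// ger0_norm//; lra.
  by rewrite pos_eq0 ?ltW// ltr0_norm//; lra.
move=> x; apply: cvgM; last exact: cvg_cst.
by apply: cvgD; [exact: cvg_id|exact: norm_continuous].
Qed.

Lemma is_deriv_pos2 x : is_derive x (1 : R) (fun t => pos t ^+ 2) (2 * pos x).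
Proof.
apply: (@is_deriv_quadratic _ _ _ _ 1) => h _; rewrite mul1r.
have [a|a] := leP 0 (x + h); have [b|b] := leP 0 x; rewrite ?(pos_id a) ?(pos_id b) ?(pos_eq0 (ltW a)) ?(pos_eq0 (ltW b)); rewrite ler_norml; apply/andP; split; nra.
Qed.

Lemma is_deriv_pos3 x : is_derive x (1 : R) (fun t => pos t ^+ 3) (3 * pos x ^+ 2).
Proof.
apply: (@is_deriv_quadratic _ _ _ _ (3 * `|x| + 3)) => h; rewrite ler_norml => /andP[h1 h2].
have n0 := normr_ge0 x; have n1 := ler_norm x; have n2 := ler_norm (- x); rewrite normrN in n2.
set y := `|x| in n0 n1 n2 *.
have hh : 0 <= h ^+ 2 by exact: sqr_ge0.
have hy : 0 <= y * h ^+ 2 by rewrite mulr_ge0.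
(* If [x] and [x + h] lie on opposite sides of 0, then |x| <= |h|, so every term is already of
   second order in [h]. *)
have [a|a] := leP 0 (x + h); have [b|b] := leP 0 x; rewrite ?(pos_id a) ?(pos_id b) ?(pos_eq0 (ltW a)) ?(pos_eq0 (ltW b)).
- have -> : (x + h) ^+ 3 - x ^+ 3 - 3 * x ^+ 2 * h = (3 * x + h) * h ^+ 2 by ring.
  rewrite normrM (ger0_norm hh) ler_wpM2r// ler_norml; apply/andP; split; lra.
- rewrite !expr0n /= mulr0 mul0r !subr0.
  have xh : 0 <= x + h <= h by apply/andP; split; lra.
  rewrite ger0_norm ?exprn_ge0// exprS; apply: ler_pM; rewrite ?exprn_ge0//; first by lra.
  by rewrite ler_pXn2r ?nnegrE//; case/andP: xh => ? ?; lra.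
- rewrite expr0n/= sub0r -opprD normrN.
  have -> : x ^+ 3 + 3 * x ^+ 2 * h = x ^+ 2 * (x + 3 * h) by ring.
  have x2 : x ^+ 2 <= h ^+ 2 by clear -a b; nra.
  rewrite normrM (ger0_norm (sqr_ge0 x)) mulrC; apply: ler_pM => //; first exact: sqr_ge0.
  by rewrite ler_norml; apply/andP; split; lra.
- by rewrite !expr0n/= mulr0 mul0r !subr0 normr0; nra.
Qed.

(** The cube makes the truncated parabola of class C^2, which gives its transform the integrable
    decay [1 / (1 + s^2)]. *)
Definition bump t : R := pos (1 - t ^+ 2) ^+ 3.
Definition bump1 t : R := - (6 * t * pos (1 - t ^+ 2) ^+ 2).
Definition bump2 t : R := - (6 * pos (1 - t ^+ 2) ^+ 2) + 24 * t ^+ 2 * pos (1 - t ^+ 2).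

Lemma is_deriv_1Bsqr t : is_derive t (1 : R) (fun t => 1 - t ^+ 2) (- (2 * t)).
Proof.
apply: is_deriv_eq (is_deriv_sub (is_deriv_cst 1 t) (is_deriv_mul (is_deriv_id t) (is_deriv_id t))) _.
ring.
Qed.

Lemma is_deriv_bump t : is_derive t (1 : R) bump (bump1 t).
Proof.
apply: is_deriv_eq (is_deriv_comp (is_deriv_pos3 _) (is_deriv_1Bsqr t)) _.
rewrite /bump1; ring.
Qed.

Lemma is_deriv_bump1 t : is_derive t (1 : R) bump1 (bump2 t).
Proof.
have d2 := is_deriv_comp (is_deriv_pos2 _) (is_deriv_1Bsqr t).
apply: is_deriv_eq (is_deriv_opp (is_deriv_mul (is_deriv_scale 6 t) d2)) _.
rewrite /bump2; ring.
Qed.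

Lemma continuous_bump2 : continuous bump2.
Proof.
have c1 : continuous (fun t => pos (1 - t ^+ 2)).
  move=> t; apply: (@continuous_comp _ _ _ (fun t => 1 - t ^+ 2) pos); last exact: continuous_pos.
  by apply: cvgB; [exact: cvg_cst|exact: exprn_continuous].
move=> t; apply: cvgD.
  by apply: cvgN; apply: cvgM; [exact: cvg_cst|apply: cvgM; exact: c1].
apply: cvgM; last exact: c1.
by apply: cvgM; [exact: cvg_cst|exact: exprn_continuous].
Qed.

Lemma bump_ge0 t : 0 <= bump t. Proof. by rewrite exprn_ge0// pos_ge0. Qed.

Lemma pos_1Bsqr_eq0 t : 1 <= `|t| -> pos (1 - t ^+ 2) = 0.
Proof.
move=> t1; rewrite pos_eq0// subr_le0 -(real_normK (num_real t)); exact: exprn_ege1.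
Qed.

Lemma bump_ge t : `|t| <= 1 / 2 -> 27 / 64 <= bump t.
Proof.
rewrite ler_norml => /andP[t1 t2]; have h : 3 / 4 <= 1 - t ^+ 2 by nra.
rewrite /bump pos_id; last by lra.
rewrite (_ : 27 / 64 = (3 / 4) ^+ 3); last by field.
rewrite ler_pXn2r ?nnegrE//; lra.
Qed.

End Bump.

(** * Compact support, primitives and dilation *)

Section CompactSupport.
Context {R : realType}.
Local Notation mu := (@lebesgue_measure R).
Implicit Types (f W : R -> R[i]) (N : R).

Definition csupp N f := forall t : R, N <= `|t| -> f t = 0.

Lemma csupp_bound f N : ccontinuous f -> csupp N f ->
  exists2 K, 0 <= K & forall t, normc (f t) <= K * expR (- (1 * `|t|)).
Proof.
move=> cf sf; pose M : R := `|N|; have M0 : 0 <= M by exact: normr_ge0.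
have [||m mM Hm] := @EVT_max _ (fun x => normc (f x)) (- M) M.
- by rewrite ge0_cp.
- by apply: continuous_within; exact: ccontinuous_normc.
exists (normc (f m) * expR M); first by rewrite mulr_ge0 ?normc_ge0 ?expR_ge0.
move=> t; rewrite mul1r -mulrA -expRD; have [tM|Mt] := leP `|t| M; last first.
  rewrite sf; first by rewrite normc0 mulr_ge0 ?normc_ge0 ?expR_ge0.
  by apply: le_trans (ler_norm _) _; exact: ltW.
rewrite -[leLHS]mulr1; apply: ler_pM; rewrite ?normc_ge0//.
  by apply: Hm; rewrite in_itv/= -ler_norml.
by rewrite -expR0 ler_expR subr_ge0.
Qed.

Lemma csupp_cintegrable f N : ccontinuous f -> csupp N f -> cintegrable setT f.
Proof.
move=> cf sf; have [K K0 HK] := csupp_bound cf sf.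
apply: cintegrable_dom (integrable_realZ K measurableT (integrable_expRNabs (@ltr01 R))) _ => //.
exact: ccontinuous_measurable.
Qed.

Lemma csuppMr f g N : csupp N f -> csupp N (fun t => f t * g t).
Proof. by move=> sf t /sf ->; rewrite mul0r. Qed.

Lemma csupp_cvg0 f N (x : nat -> R) : csupp N f -> (forall n, `|x n| = n%:R) ->
  normc (f (x n)) @[n --> \oo] --> (0 : R).
Proof.
move=> sf xn; apply: cvg_near_cst; exists (Num.truncn `|N|).+1 => // n /= Nn.
rewrite sf ?normc0// xn; apply: le_trans (ler_norm _) _; apply: ltW; apply: (lt_le_trans (truncnS_gt _)).
by rewrite ler_nat.
Qed.

Lemma ft_deriv_csupp W W' N z : is_cderiv W W' -> ccontinuous W' -> csupp N W -> csupp N W' ->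
  ft W' z = - ('i * z) * ft W z.
Proof.
move=> dW cW' sW sW'; have cW := is_cderiv_continuous dW.
apply: ft_deriv => //.
- apply: (@csupp_cintegrable _ N); last exact: csuppMr.
  by apply: ccontinuousM => //; exact: ccontinuous_cexpZ.
- apply: (@csupp_cintegrable _ N); last exact: csuppMr.
  by apply: ccontinuousM => //; exact: ccontinuous_cexpZ.
- apply: (@csupp_cvg0 (fun t => W t * cexp ('i * z * t%:C)) N (fun n => n%:R)).
    exact: csuppMr.
  by move=> n; rewrite ger0_norm.
- apply: (@csupp_cvg0 (fun t => W t * cexp ('i * z * t%:C)) N (fun n => - n%:R)).
    exact: csuppMr.
  by move=> n; rewrite normrN ger0_norm.
Qed.

Lemma is_deriv_primitive (g : R -> R) x : continuous g -> mu.-integrable setT (EFin \o g) ->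
  is_derive x (1 : R) (fun x => \int[mu]_(t in `]-oo, x]) g t) (g x).
Proof.
move=> cg ig.
have iu : mu.-integrable `]-oo, (x + 1)%R] (EFin \o g) by apply: integrableS ig.
have [|d e] := @continuous_FTC1 _ g -oo%O x (x + 1) _ iu (ltNyr _) (cg x).
  by rewrite ltrDl.
by apply: DeriveDef; [exact: d|rewrite -derive1E; exact: e].
Qed.

(** By the fundamental theorem the integral over [[- n j, n j]] of the dilated function is exactly
    [n] times that of [g] over [[- j, j]]; then [j] tends to infinity. *)
Lemma Rintegral_scale (g : R -> R) (n : nat) : (0 < n)%N -> continuous g ->
  mu.-integrable setT (EFin \o g) -> mu.-integrable setT (EFin \o (fun t => g (t / n%:R))) ->
  \int[mu]_t g (t / n%:R) = n%:R * \int[mu]_t g t.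
Proof.
move=> n0 cg ig ign; have nn0 : n%:R != 0 :> R by rewrite pnatr_eq0 -lt0n.
pose G x := \int[mu]_(t in `]-oo, x]) g t.
have dG x : is_derive x (1 : R) G (g x) by exact: is_deriv_primitive.
have dGn x : is_derive x (1 : R) (fun t => n%:R * G (t / n%:R)) (g (x / n%:R)).
  have d1 : is_derive x (1 : R) (fun t => t / n%:R) (n%:R^-1).
    by apply: is_deriv_eq (is_deriv_mul (is_deriv_id x) (is_deriv_cst (n%:R^-1) x)) _; ring.
  apply: is_deriv_eq (is_deriv_mul (is_deriv_cst n%:R x) (is_deriv_comp (dG _) d1)) _.
  by field.
have cgn : continuous (fun t : R => g (t / n%:R)).
  move=> t; apply: (@continuous_comp _ _ _ (fun t : R => t / n%:R) g); last exact: cg.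
  by apply: cvgM; [exact: cvg_id|exact: cvg_cst].
have l1 : (\int[mu]_(t in `[- (n * j)%:R, (n * j)%:R]) g (t / n%:R)) @[j --> \oo] --> \int[mu]_t g (t / n%:R).
  have h := Rintegral_sym_cvg ign.
  apply: (cvg_comp (fun j => (n * j)%N) _ _ h).
  apply/cvgnyPge => A; exists A => // j /= Aj; apply: leq_trans Aj _; exact: leq_pmull.
have l2 : (n%:R * \int[mu]_(t in `[- j%:R, j%:R]) g t) @[j --> \oo] --> n%:R * \int[mu]_t g t.
  by apply: cvgM; [exact: cvg_cst|exact: Rintegral_sym_cvg].
have e : (fun j : nat => \int[mu]_(t in `[- (n * j)%:R, (n * j)%:R]) g (t / n%:R)) =
    (fun j : nat => n%:R * \int[mu]_(t in `[- j%:R, j%:R]) g t).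
  apply/funext => j.
  rewrite (Rintegral_deriv _ dGn cgn) ?ge0_cp// (Rintegral_deriv _ dG cg) ?ge0_cp//.
  have -> : (n * j)%:R / n%:R = j%:R :> R by rewrite natrM; field.
  have -> : - (n * j)%:R / n%:R = - j%:R :> R by rewrite natrM; field.
  by rewrite mulrBr.
rewrite e in l1; exact: cvg_unique l1 l2.
Qed.

End CompactSupport.

(** * Functions with vanishing integrals, and limits of dilated primitives *)

Section Primitive.
Context {R : realType}.
Local Notation mu := (@lebesgue_measure R).
Implicit Types (f g h : R -> R) (s t x a c d : R).

Lemma integrable_sub (A B : set R) f : measurable A -> measurable B -> A `<=` B ->
  mu.-integrable B (EFin \o f) -> mu.-integrable A (EFin \o f).
Proof. by move=> mA mB AB; apply: integrableS. Qed.

Lemma integrable_restrict (A : set R) f : measurable A -> mu.-integrable A (EFin \o f) ->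
  mu.-integrable setT (EFin \o (f \_ A)).
Proof.
move=> mA iA; rewrite -restrict_EFin.
have [h _] := @integrable_mkcond _ _ _ mu A (EFin \o f) mA; exact: h.
Qed.

Lemma itv_oo_cc f c d : mu.-integrable `[c, d] (EFin \o f) ->
  \int[mu]_(t in `[c, d]) f t = \int[mu]_(t in `]c, d[) f t.
Proof.
move=> icc; rewrite -Rintegral_itv_bndo_bndc.
  rewrite -Rintegral_itv_obnd_cbnd//.
  by apply: integrable_sub icc => //; exact: subset_itv_oo_cc.
by apply: integrable_sub icc => //; exact: subset_itv_co_cc.
Qed.

(* Almost every point is a Lebesgue point, where the vanishing primitive has derivative [h x]. *)
Lemma ae_eq0_of_itv h : measurable_fun setT h ->
  (forall c d, mu.-integrable `[c, d] (EFin \o h)) ->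
  (forall c d, c < d -> \int[mu]_(t in `[c, d]) h t = 0) ->
  {ae mu, forall x, h x = 0}.
Proof.
move=> mh ih h0.
have lh : locally_integrable setT h.
  split; [by []|exact: openT|] => K _ cK.
  have [M [Mr HM]] := compact_bounded cK.
  have KM : K `<=` `[- (M + 1), M + 1].
    by move=> x Kx /=; rewrite in_itv /= -ler_norml; apply: HM => //; rewrite ltrDl.
  have /integrableP[] // : mu.-integrable K (EFin \o h).
  by apply: (integrable_sub _ _ KM (ih (- (M + 1)) (M + 1))) => //; exact: compact_measurable.
have := lebesgue_differentiation lh.
apply: filterS; first exact: (ae_filter_ringOfSetsType mu).
move=> x lx.
have [] := @FTC1_lebesgue_pt R h (BLeft (x - 1)) x (x + 1) _ (ih (x - 1) (x + 1)) _ lx.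
- by rewrite ltrDl.
- by rewrite lte_fin gtrBl.
set F := (fun y => _) => dF; rewrite derive1E => <-.
have F0 : \forall y \near x, F y = (fun=> 0) y.
  near=> y; rewrite /F /= h0//.
  near: y; apply: (cvgr_gt x); [exact: cvg_id|by rewrite gtrBl].
by rewrite (@near_eq_derive R R R F (fun=> 0) x 1 F0) derive_cst.
Unshelve. all: by end_near. Qed.

(** The half-line exhausts the real line, empties, or stays fixed according to the sign of [y], and
    dominated convergence applies. Differences of these step functions produce the indicator of an
    interval in [kernel_density]. *)
Lemma primitive_scale_cvg g y : mu.-integrable setT (EFin \o g) ->
  \int[mu]_(t in `]-oo, n.+1%:R * y]) g t @[n --> \oo] -->
  (if 0 < y then \int[mu]_t g t else if y < 0 then 0 else \int[mu]_(t in `]-oo, 0]) g t : R).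
Proof.
move=> ig; have mg : measurable_fun setT g by case/integrableP: ig => /measurable_EFinP.
have lim (l : R -> R) : measurable_fun setT l ->
    (forall x, \forall n \near \oo, (g \_ `]-oo, n.+1%:R * y]) x = l x) ->
    \int[mu]_(t in `]-oo, n.+1%:R * y]) g t @[n --> \oo] --> \int[mu]_t l t.
  move=> ml gl; under eq_fun do rewrite Rintegral_mkcond.
  apply: (@Rintegral_dominated_cvg _ _ _ _ (fun x => `|g x|)) => //.
  - by move=> n; apply/(measurable_restrictT _ _).1 => //; exact: measurable_funTS.
  - by move=> x _; apply: cvg_near_cst; exact: gl.
  - exact: integrable_norm.
  - by move=> n x _; rewrite patchE /=; case: ifP => // _; rewrite normr0.
have large (z x : R) : 0 < z -> \forall n \near \oo, `|x| < n.+1%:R * z.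
  move=> z0; exists (Num.truncn (`|x| / z)).+1 => // n /= xn.
  rewrite -ltr_pdivrMr//; apply: lt_le_trans (truncnS_gt _) _.
  by rewrite ler_nat; exact: leq_trans xn _.
have [y0|y0|y0] := ltgtP 0 y; last first.
- rewrite -y0; under eq_fun do rewrite mulr0; exact: cvg_cst.
- have -> : 0 = \int[mu]_t (fun=> 0) t :> R by rewrite /Rintegral integral0.
  apply: lim => // x; have z0 : 0 < - y by rewrite oppr_gt0.
  apply: filterS (large _ x z0) => n xn.
  rewrite patchE memNset//= in_itv/=; apply/negP; rewrite -ltNge.
  by have := ler_norm (- x); rewrite normrN; lra.
- apply: lim => // x; apply: filterS (large _ x y0) => n xn.
  rewrite patchE ifT// inE/= in_itv/=.
  by have := ler_norm x; lra.
Qed.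

End Primitive.

(** * Approximate identities from a kernel with nonzero integral *)

Section KernelApproximation.
Context {R : realType}.
Local Notation mu := (@lebesgue_measure R).
Implicit Types (f h : R -> R) (s t x a c d : R).

Variables (k : R -> R) (K : R).
Hypothesis ck : continuous k.
Hypothesis bk : forall x, `|k x| <= K / (1 + x ^+ 2).

Lemma kernel_integrable : mu.-integrable setT (EFin \o k).
Proof.
apply: integrable_real_dom (integrable_realZ K measurableT (@integrable_sqrD1V R)) _ => //.
exact: continuous_measurable_fun.
Qed.

Lemma kernel_bound_ge0 : 0 <= K.
Proof.
have := le_trans (normr_ge0 _) (bk 0).
by rewrite expr0n /= addr0 divr1.
Qed.

(** Peetre's inequality: it makes the decay of translates uniform when [a] stays in a bounded
    interval. *)
Lemma sqrD1_shift s a : 1 + s ^+ 2 <= 2 * (1 + a ^+ 2) * (1 + (s - a) ^+ 2).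
Proof.
have := sqr_ge0 (s - 2 * a); have := sqr_ge0 (a * (s - a)); nra.
Qed.

Let KK x := \int[mu]_(t in `]-oo, x]) k t.

Lemma is_deriv_KK x : is_derive x (1 : R) KK (k x).
Proof. exact: is_deriv_primitive ck kernel_integrable. Qed.

Lemma continuous_kernel_shift (n : nat) s : continuous (fun a => k (n%:R * (s - a))).
Proof.
move=> a; apply: (@continuous_comp _ _ _ (fun a : R => n%:R * (s - a)) k); last exact: ck.
by apply: cvgM; [exact: cvg_cst|apply: cvgB; [exact: cvg_cst|exact: cvg_id]].
Qed.

Lemma Rintegral_kernel_shift (n : nat) s c d : (0 < n)%N -> c <= d ->
  n%:R * \int[mu]_(a in `[c, d]) k (n%:R * (s - a)) = KK (n%:R * (s - c)) - KK (n%:R * (s - d)).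
Proof.
move=> n0 cd; have nn0 : n%:R != 0 :> R by rewrite pnatr_eq0 -lt0n.
have dl a : is_derive a (1 : R) (fun a => n%:R * (s - a)) (- n%:R).
  apply: is_deriv_eq (is_deriv_mul (is_deriv_cst n%:R a) (is_deriv_sub (is_deriv_cst s a) (is_deriv_id a))) _.
  ring.
have dG a : is_derive a (1 : R) (fun a => - n%:R^-1 * KK (n%:R * (s - a))) (k (n%:R * (s - a))).
  apply: is_deriv_eq (is_deriv_mul (is_deriv_cst (- n%:R^-1) a) (is_deriv_comp (is_deriv_KK _) (dl a))) _.
  by field.
rewrite (Rintegral_deriv cd dG); first by field.
exact: continuous_kernel_shift.
Qed.

(** Away from the origin the bound is uniform in [n], because
    [n (1 + u^2) <= 2 n u^2 <= 2 n^2 u^2]. *)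
Lemma kernel_scale_le (n : nat) u : (0 < n)%N -> 1 <= `|u| ->
  n%:R * `|k (n%:R * u)| <= 2 * K / (1 + u ^+ 2).
Proof.
move=> n0 u1; have K0 := kernel_bound_ge0.
have n1 : 1 <= n%:R :> R by rewrite ler1n.
have u2 : 1 <= u ^+ 2 by rewrite -(real_normK (num_real u)) exprn_ege1.
apply: (@le_trans _ _ (n%:R * (K / (1 + (n%:R * u) ^+ 2)))).
  by rewrite ler_wpM2l.
rewrite mulrA ler_pdivrMr ?sqrD1_gt0// mulrAC ler_pdivlMr ?sqrD1_gt0//.
have -> : n%:R * K * (1 + u ^+ 2) = K * (n%:R * (1 + u ^+ 2)) by ring.
have -> : 2 * K * (1 + (n%:R * u) ^+ 2) = K * (2 * (1 + (n%:R * u) ^+ 2)) by ring.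
rewrite ler_wpM2l// exprMn; clear -n1 u2.
set m : R := n%:R in n1 *; set v := u ^+ 2 in u2 *.
have h : m * v <= m ^+ 2 * v by rewrite ler_wpM2r ?expr2 ?ler_peMr//; lra.
have h2 : m <= m * v by rewrite ler_peMr//; lra.
lra.
Qed.

Lemma kernel_primitive_le x y : `|KK x - KK y| <= 2 * \int[mu]_t `|k t|.
Proof.
have ik := kernel_integrable.
have h z : `|KK z| <= \int[mu]_t `|k t|.
  apply: (le_trans (le_normr_Rintegral _ _)) => //; first exact: integrableS ik.
  have ikn : mu.-integrable setT (EFin \o (fun t => `|k t|)) by exact: integrable_norm.
  rewrite Rintegral_mkcond; apply: le_Rintegral => //.
  - by apply: (integrable_restrict (f := fun t => `|k t|)) => //; apply: integrable_sub ikn.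
  - by move=> t _; rewrite patchE; case: ifP => _; [exact: lexx|exact: normr_ge0].
by apply: le_trans (ler_normB _ _) _; rewrite mulr_natl mulr2n lerD.
Qed.

(** Supplies the dominating function for [kernel_density]. Close to [[c, d]] the primitives are
    bounded by the integral of |k|; far away the difference is rewritten as an integral over
    [[c, d]] and estimated by [kernel_scale_le]. *)
Lemma kernel_shift_dominated c d : c <= d -> exists2 B, 0 <= B & forall (n : nat) s, (0 < n)%N ->
  `|KK (n%:R * (s - c)) - KK (n%:R * (s - d))| <= B / (1 + s ^+ 2).
Proof.
move=> cd; have K0 := kernel_bound_ge0.
(* For |s| > M and [a] in [[c, d]] one has |s - a| >= 1, as [kernel_scale_le] requires. *)
pose M : R := `|c| + `|d| + 1.
have [c0 d0] : 0 <= `|c| /\ 0 <= `|d| by [].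
pose B1 : R := 2 * (\int[mu]_t `|k t|) * (1 + M ^+ 2).
pose B2 : R := (d - c) * (2 * K * (2 * (1 + M ^+ 2))).
have I0 : 0 <= \int[mu]_t `|k t| by apply: Rintegral_ge0.
have B10 : 0 <= B1 by rewrite !mulr_ge0// ltW// sqrD1_gt0.
have B20 : 0 <= B2 by rewrite !mulr_ge0// ?subr_ge0// ltW// sqrD1_gt0.
exists (B1 + B2); first by rewrite addr_ge0.
move=> n s n0; rewrite ler_pdivlMr ?sqrD1_gt0//.
have [sM|Ms] := leP `|s| M.
  apply: (@le_trans _ _ B1); last by rewrite lerDl.
  apply: ler_pM => //; first by rewrite ltW// sqrD1_gt0.
    exact: kernel_primitive_le.
  by rewrite lerD2l -(real_normK (num_real s)) ler_pXn2r// nnegrE !addr_ge0.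
apply: (@le_trans _ _ B2); last by rewrite lerDr.
rewrite -(Rintegral_kernel_shift s n0 cd).
have ckn := @continuous_kernel_shift n s.
rewrite normrM ger0_norm//.
have pw a : a \in `[c, d] -> n%:R * `|k (n%:R * (s - a))| <= 2 * K * (2 * (1 + M ^+ 2)) / (1 + s ^+ 2).
  rewrite in_itv /= => /andP[ca ad].
  have aM : `|a| <= M - 1.
    rewrite /M addrK ler_norml; have := ler_norm (- c); have := ler_norm d; rewrite normrN => h1 h2.
    by apply/andP; split; lra.
  have u1 : 1 <= `|s - a|.
    by have := lerB_dist s a; lra.
  apply: (le_trans (kernel_scale_le n0 u1)).
  rewrite ler_pdivrMr ?sqrD1_gt0// mulrAC ler_pdivlMr ?sqrD1_gt0// -!mulrA ler_wpM2l// ler_wpM2l//.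
  apply: (le_trans (sqrD1_shift s a)).
  rewrite mulrA ler_wpM2r//; first by rewrite ltW// sqrD1_gt0.
  have M0 : 0 <= M by rewrite !addr_ge0.
  have aM2 : a ^+ 2 <= M ^+ 2.
    rewrite -(real_normK (num_real a)) ler_pXn2r ?nnegrE//; clear -aM; lra.
  clear -aM2; lra.
have ikn : mu.-integrable `[c, d] (EFin \o (fun a => k (n%:R * (s - a)))) by exact: continuous_integrable_itv.
apply: (@le_trans _ _ (n%:R * \int[mu]_(a in `[c, d]) `|k (n%:R * (s - a))| * (1 + s ^+ 2))).
  rewrite ler_wpM2r//; first by rewrite ltW// sqrD1_gt0.
  by rewrite ler_wpM2l//; exact: le_normr_Rintegral.
rewrite -ler_pdivlMr ?sqrD1_gt0// -RintegralZl//; last exact: integrable_norm.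
apply: (@le_trans _ _ (\int[mu]_(a in `[c, d]) (2 * K * (2 * (1 + M ^+ 2)) / (1 + s ^+ 2)))).
  apply: le_Rintegral => //.
  - by apply: integrable_realZ => //; exact: integrable_norm.
  - by apply: continuous_integrable_itv; exact: cst_continuous.
by rewrite Rintegral_cst_itv// /B2 le_eqVlt; apply/orP; left; apply/eqP; ring.
Qed.

Hypothesis k0 : \int[mu]_t k t != 0.

(** Integrating the hypothesis over the centre [a] in [[c, d]] and exchanging integrals replaces the
    kernel by a difference of dilated primitives. As [n] grows this tends to the integral of [k]
    times the indicator of [[c, d]], so [h] has integral 0 over every interval. Domination works
    because [h] in L^2 makes |h| / (1 + s^2) integrable. *)
Lemma kernel_density h : h \in Lfun mu 2%:E ->
  (forall (n : nat) a, (0 < n)%N -> \int[mu]_s (k (n%:R * (s - a)) * h s) = 0) ->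
  {ae mu, forall x, h x = 0}.
Proof.
move=> h2 H; have K0 := kernel_bound_ge0.
have /sub_Lfun_mfun/set_mem mh : h \in Lfun mu 2%:E by [].
have ih c d : mu.-integrable `[c, d] (EFin \o h).
  have i1 : mu.-integrable `[c, d] (EFin \o (fun x => 1 + h x ^+ 2)).
    apply: integrable_realD => //; first by apply: continuous_integrable_itv; exact: cst_continuous.
    exact: (integrable_sub _ measurableT (@subsetT _ _) (Lfun2_integrable_sqr h2)).
  apply: integrable_real_dom i1 _ => //; first exact: measurable_funTS.
  move=> x _; rewrite -(real_normK (num_real (h x))); set y := `|h x|.
  have := sqr_ge0 (y - 1); nra.
have ihw : mu.-integrable setT (EFin \o (fun s => `|h s| / (1 + s ^+ 2))).
  apply: integrable_real_dom (integrable_realD measurableT (Lfun2_integrable_sqr h2) (@integrable_sqrD1V R)) _ => //.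
    apply: measurable_funM; first exact: measurableT_comp.
    by apply: continuous_measurable_fun; exact: continuous_sqrD1V.
  move=> s _; rewrite ger0_norm ?divr_ge0// ?(ltW (sqrD1_gt0 _))//.
  have v0 : 0 < (1 + s ^+ 2)^-1 by rewrite invr_gt0 sqrD1_gt0.
  have v1 : (1 + s ^+ 2)^-1 <= 1 by rewrite invf_le1 ?sqrD1_gt0// lerDl sqr_ge0.
  rewrite -(real_normK (num_real (h s))); move: v0 v1; set v := _^-1; set y := `|h s| => v0 v1.
  have := sqr_ge0 (y - v); nra.
apply: ae_eq0_of_itv => // c d cd.
have key (n : nat) : (0 < n)%N -> \int[mu]_s ((KK (n%:R * (s - c)) - KK (n%:R * (s - d))) * h s) = 0.
  move=> n0.
  pose kk (a s : R) := \1_(`[c, d] : set R) a * (k (n%:R * (s - a)) * h s).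
  have mkk : measurable_fun setT (fun z : (measurableTypeR R) * (measurableTypeR R) => kk z.1 z.2).
    apply: measurable_funM.
      by apply: measurableT_comp (measurable_indic _) measurable_fst_real.
    apply: measurable_funM; last by apply: measurableT_comp mh measurable_snd_real.
    apply: measurableT_comp (continuous_measurable_fun ck) _.
    apply: measurable_funM => //; apply: measurable_funB; [exact: measurable_snd_real|exact: measurable_fst_real].
  have ia : mu.-integrable setT (EFin \o ((fun a : R => 2 * K * (1 + a ^+ 2)) \_ `[c, d])).
    apply: integrable_restrict => //; apply: continuous_integrable_itv.
    by move=> x; apply: cvgM; [exact: cvg_cst|exact: continuous_sqrD1].
  have [|_ i2 e] := real_Fubini mkk ia ihw.
    move=> a s; rewrite /kk indicE patchE; case: ifP => _; last by rewrite !mul0r normr0.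
    rewrite mul1r normrM mulrA -[X in _ <= X]mulrAC; apply: ler_wpM2r => //.
    apply: (le_trans (bk _)); rewrite ler_pdivrMr ?sqrD1_gt0// mulrAC ler_pdivlMr ?sqrD1_gt0//.
    rewrite -!mulrA [leRHS]mulrCA ler_wpM2l//.
    apply: (le_trans (sqrD1_shift s a)); rewrite -mulrA ler_wpM2l// ler_wpM2l//.
      by rewrite ltW// sqrD1_gt0.
    rewrite lerD2l exprMn ler_peMl ?sqr_ge0//; apply: exprn_ege1; by rewrite ler1n.
  have nn0 : n%:R != 0 :> R by rewrite pnatr_eq0 -lt0n.
  have e1 : \int[mu]_a (\int[mu]_s kk a s) = 0.
    have -> : (fun a => \int[mu]_s kk a s) = (fun=> 0).
      apply/funext => a; rewrite /kk indicE; case: (a \in _).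
        by under eq_Rintegral do rewrite mul1r; exact: H.
      by under eq_Rintegral do rewrite mul0r; rewrite /Rintegral integral0.
    by rewrite /Rintegral integral0.
  rewrite e1 in e.
  have E s : (KK (n%:R * (s - c)) - KK (n%:R * (s - d))) * h s = n%:R * \int[mu]_a kk a s.
    rewrite -(Rintegral_kernel_shift s n0 (ltW cd)) -mulrA; congr (_ * _).
    have ckn := @continuous_kernel_shift n s.
    rewrite -RintegralZr//; last exact: continuous_integrable_itv.
    rewrite Rintegral_mkcond; apply: eq_Rintegral => a _.
    by rewrite /kk indicE patchE; case: ifP => _; rewrite ?mul1r ?mul0r.
  under eq_Rintegral do rewrite E.
  by rewrite RintegralZl// -e mulr0.
(* [L] is the integral of [k] on []c, d[] and 0 off [[c, d]]; its values at the two endpoints are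
   discarded later by [itv_oo_cc]. *)
pose sg (y : R) : R := if 0 < y then \int[mu]_t k t else if y < 0 then 0 else \int[mu]_(t in `]-oo, 0]) k t.
pose L (s : R) : R := sg (s - c) - sg (s - d).
have [B B0 HB] := kernel_shift_dominated (ltW cd).
have cKK : continuous KK := is_deriv_continuous is_deriv_KK.
have cKs (n : nat) b : continuous (fun s => KK (n%:R * (s - b))).
  move=> s; apply: (@continuous_comp _ _ _ (fun s : R => n%:R * (s - b)) KK); last exact: cKK.
  by apply: cvgM; [exact: cvg_cst|apply: cvgB; [exact: cvg_id|exact: cvg_cst]].
have mD (n : nat) : measurable_fun setT (fun s => (KK (n.+1%:R * (s - c)) - KK (n.+1%:R * (s - d))) * h s).
  apply: measurable_funM => //; apply: continuous_measurable_fun => s.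
  by apply: cvgB; exact: cKs.
have cv s : (KK (n.+1%:R * (s - c)) - KK (n.+1%:R * (s - d))) * h s @[n --> \oo] --> L s * h s.
  by apply: cvgM; [apply: cvgB|exact: cvg_cst]; [exact: (@primitive_scale_cvg _ k (s - c) kernel_integrable)|exact: (@primitive_scale_cvg _ k (s - d) kernel_integrable)].
have mL : measurable_fun setT (fun s => L s * h s).
  by apply: measurable_fun_cvg => //; [exact: mD|move=> s _; exact: cv].
have lim : \int[mu]_s (L s * h s) = 0.
  have h0 : (\int[mu]_s ((KK (n.+1%:R * (s - c)) - KK (n.+1%:R * (s - d))) * h s)) @[n --> \oo]
     --> \int[mu]_s (L s * h s).
    apply: (@Rintegral_dominated_cvg _ _ _ _ (fun s => B * (`|h s| / (1 + s ^+ 2)))) => //.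
    - exact: integrable_realZ.
    - move=> n s _; rewrite normrM mulrCA [leRHS]mulrC ler_wpM2r//; exact: HB.
  have : (fun n : nat => \int[mu]_s ((KK (n.+1%:R * (s - c)) - KK (n.+1%:R * (s - d))) * h s)) = (fun=> 0).
    by apply/funext => n; exact: key.
  by move=> e; rewrite e in h0; exact: (cvg_unique _ h0 (cvg_cst _)).
have ioo : mu.-integrable `]c, d[ (EFin \o h).
  by apply: integrable_sub (ih c d) => //; exact: subset_itv_oo_cc.
have Lin s : s \in `]c, d[%classic -> L s * h s = (\int[mu]_t k t) * h s.
  rewrite inE /= in_itv/= => /andP[cs sd].
  by rewrite /L /sg !subr_gt0 !subr_lt0 cs sd (ltNge d) (ltW sd) /= subr0.
have Lout s : s \notin `[c, d]%classic -> L s * h s = 0.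
  move/negP => sN; rewrite /L /sg !subr_gt0 !subr_lt0.
  have [sc|cs] := ltP s c.
    by rewrite (lt_trans sc cd) !ltNge (ltW sc) (ltW (lt_trans sc cd))/= subrr mul0r.
  have [ds|sd] := ltP d s; first by rewrite (lt_trans cd ds) subrr mul0r.
  by exfalso; apply: sN; rewrite inE/= in_itv/= cs.
have eL : \int[mu]_s (L s * h s) = (\int[mu]_t k t) * \int[mu]_(t in `[c, d]) h t.
  transitivity (\int[mu]_(s in `[c, d]) (L s * h s)).
    rewrite [RHS]Rintegral_mkcond; apply: eq_Rintegral => s _; rewrite patchE; case: ifPn => // /Lout.
    by [].
  pose I : R := \int[mu]_t k t; pose J : R := \int[mu]_(t in `]-oo, 0]) k t.
  have sgB y : `|sg y| <= `|I| + `|J|.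
    by rewrite /sg; case: ifP => _; [|case: ifP => _]; rewrite ?normr0 ?addr_ge0 ?lerDl ?lerDr.
  have iL : mu.-integrable `[c, d] (EFin \o (fun s => L s * h s)).
    have ihn : mu.-integrable `[c, d] (EFin \o (fun s => `|h s|)) by exact: integrable_norm.
    have ih2 : mu.-integrable `[c, d] (EFin \o (fun s => 2 * (`|I| + `|J|) * `|h s|)) by exact: integrable_realZ.
    apply: integrable_real_dom ih2 _ => //.
      by apply: measurable_funTS; exact: mL.
    move=> s _; rewrite normrM ler_wpM2r// mulr_natl mulr2n.
    by apply: le_trans (ler_normB _ _) _; rewrite lerD.
  rewrite (itv_oo_cc iL) (itv_oo_cc (ih c d)).
  by rewrite -RintegralZl//; apply: eq_Rintegral => s; exact: Lin.
have : (\int[mu]_t k t) * \int[mu]_(t in `[c, d]) h t = 0 by rewrite -eL.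
by move/eqP; rewrite mulf_eq0 (negPf k0) /= => /eqP.
Qed.

End KernelApproximation.

(** * The transform of the bump and its nonzero integral *)

Section BumpTransform.
Context {R : realType}.
Local Notation mu := (@lebesgue_measure R).
Implicit Types (s t x a c : R).

Lemma expRN_cvg0 c : 0 < c -> expR (- (c * n%:R)) @[n --> \oo] --> (0 : R).
Proof.
move=> c0; have -> : (fun n : nat => expR (- (c * n%:R))) = (fun n => expR (- c) ^+ n).
  by apply/funext => n; rewrite -expRM_natl; congr expR; ring.
apply: cvg_expr; rewrite ger0_norm ?expR_ge0// expR_lt1; lra.
Qed.

Lemma continuous_expRNabs c : continuous (fun s => expR (- (c * `|s|))).
Proof.
apply: continuous_expR_comp => s; apply: cvgN.
by apply: cvgM; [exact: cvg_cst|exact: norm_continuous].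
Qed.

Lemma Rintegral_itv_primitive (f : R -> R) a c : a <= c -> continuous f ->
  mu.-integrable setT (EFin \o f) ->
  \int[mu]_(t in `[a, c]) f t = \int[mu]_(t in `]-oo, c]) f t - \int[mu]_(t in `]-oo, a]) f t.
Proof.
move=> ac cf jf.
exact: (Rintegral_deriv ac (fun x => is_deriv_primitive x cf jf) cf).
Qed.

Lemma continuous_cosM t : continuous (fun s => cos (s * t)).
Proof.
move=> s; apply: (@continuous_comp _ _ _ (fun s : R => s * t) cos); last exact: continuous_cos.
by apply: cvgM; [exact: cvg_id|exact: cvg_cst].
Qed.

Lemma integrable_expRNabs_cos c t : 0 < c ->
  mu.-integrable setT (EFin \o (fun s => expR (- (c * `|s|)) * cos (s * t))).
Proof.
move=> c0; apply: integrable_real_dom (integrable_expRNabs c0) _ => //.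
  apply: measurable_funM; apply: continuous_measurable_fun.
    exact: continuous_expRNabs.
  exact: continuous_cosM.
move=> s _; rewrite normrM ger0_norm ?expR_ge0// -[leRHS]mulr1 ler_wpM2l ?expR_ge0//.
by rewrite ler_norml cos_geN1 cos_le1.
Qed.

(** The Poisson kernel, as Abel damping of a cosine transform produces it. *)
Lemma Rintegral_expRNabs_cos c t : 0 < c ->
  \int[mu]_s (expR (- (c * `|s|)) * cos (s * t)) = 2 * c / (c ^+ 2 + t ^+ 2).
Proof.
move=> c0; have D0 : c ^+ 2 + t ^+ 2 != 0 by rewrite gt_eqF// ltr_wpDr ?sqr_ge0// exprn_gt0.
pose D : R := c ^+ 2 + t ^+ 2.
pose f s := expR (- (c * `|s|)) * cos (s * t).
have jf : mu.-integrable setT (EFin \o f) by exact: integrable_expRNabs_cos.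
have cf : continuous f.
  by move=> s; apply: cvgM; [exact: continuous_expRNabs|exact: continuous_cosM].
(* A primitive of [e^(k s) cos (s t)], for [k = c] on the negative and [k = - c] on the positive
   half-line; both share the denominator [D = k^2 + t^2]. *)
pose G (k s : R) : R := (t * (expR (k * s) * sin (s * t)) + k * (expR (k * s) * cos (s * t))) / D.
have dG k s : k ^+ 2 = c ^+ 2 -> is_derive s (1 : R) (G k) (expR (k * s) * cos (s * t)).
  move=> kc.
  have dst : is_derive s (1 : R) (fun s => s * t) t.
    by apply: is_deriv_eq (is_deriv_mul (is_deriv_id s) (is_deriv_cst t s)) _; ring.
  have de := is_deriv_expR (is_deriv_scale k s).
  have d1 := is_deriv_mul (is_deriv_cst t s) (is_deriv_mul de (is_deriv_sin dst)).
  have d2 := is_deriv_mul (is_deriv_cst k s) (is_deriv_mul de (is_deriv_cos dst)).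
  apply: is_deriv_eq (is_deriv_mul (is_deriv_add d1 d2) (is_deriv_cst D^-1 s)) _.
  apply: (mulIf D0); rewrite -/D mulr0 addr0 mulfVK//.
  by rewrite /D -kc; ring.
have ce k : continuous (fun s => expR (k * s) * cos (s * t)).
  have ck : continuous (fun s : R => expR (k * s)).
    by apply: continuous_expR_comp => s; apply: cvgM; [exact: cvg_cst|exact: cvg_id].
  by move=> s; apply: cvgM; [exact: ck|exact: continuous_cosM].
have E (n : nat) : \int[mu]_(s in `[- n%:R, n%:R]) f s = 2 * c / D + 2 * G (- c) n%:R.
  have n0 : 0 <= n%:R :> R by [].
  rewrite Rintegral_itv_primitive ?ge0_cp//.
  have e1 := Rintegral_itv_primitive n0 cf jf.
  have e2 := @Rintegral_itv_primitive f (- n%:R) 0 _ cf jf.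
  have -> : \int[mu]_(t0 in `]-oo, n%:R]) f t0 - \int[mu]_(t0 in `]-oo, (- n%:R)]) f t0 =
    \int[mu]_(s in `[- n%:R, 0]) f s + \int[mu]_(s in `[0, n%:R]) f s.
    by rewrite e1 e2 ?oppr_le0//; ring.
  have -> : \int[mu]_(s in `[0, n%:R]) f s = \int[mu]_(s in `[0, n%:R]) (expR (- c * s) * cos (s * t)).
    apply: eq_Rintegral => s; rewrite inE/= in_itv/= => /andP[s0 _].
    by rewrite /f ger0_norm// mulNr.
  have -> : \int[mu]_(s in `[- n%:R, 0]) f s = \int[mu]_(s in `[- n%:R, 0]) (expR (c * s) * cos (s * t)).
    apply: eq_Rintegral => s; rewrite inE/= in_itv/= => /andP[_ s0].
    by rewrite /f ler0_norm// mulrN opprK.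
  rewrite (Rintegral_deriv n0 (fun s => dG (- c) s (sqrrN c)) (ce _)).
  rewrite (Rintegral_deriv _ (fun s => dG c s erefl) (ce _)) ?oppr_le0//.
  rewrite /G !mulr0 !mul0r expR0 sin0 cos0 !mulNr !mulrN sinN cosN.
  by rewrite -/D; field.
have := Rintegral_sym_cvg jf; rewrite (funext E) => h1.
have h2 : (2 * c / D + 2 * G (- c) n%:R) @[n --> \oo] --> 2 * c / D + 2 * 0.
  apply: cvgD; first exact: cvg_cst.
  apply: cvgM; first exact: cvg_cst.
  pose B : R := (`|t| + c) / D.
  have e0 : B * expR (- (c * n%:R)) @[n --> \oo] --> (0 : R).
    by rewrite -[X in _ --> X](mulr0 B); apply: cvgM; [exact: cvg_cst|exact: expRN_cvg0].
  apply: (@squeeze_cvgr _ _ _ _ (fun n => - (B * expR (- (c * n%:R)))) (fun n => B * expR (- (c * n%:R)))).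
  - apply: nearW => n; rewrite -ler_norml /G /B mulrAC normrM (@ger0_norm _ D^-1); last first.
      by rewrite invr_ge0 addr_ge0// sqr_ge0.
    rewrite ler_wpM2r//; first by rewrite invr_ge0 addr_ge0// sqr_ge0.
    rewrite mulrDl; apply: le_trans (ler_normD _ _) _.
    apply: lerD; rewrite !normrM ?normrN (@ger0_norm _ (expR _)) ?expR_ge0// mulNr.
      by rewrite ler_wpM2l// ler_piMr ?expR_ge0// ler_norml sin_geN1 sin_le1.
    rewrite (@ger0_norm _ c) ?(ltW c0)// ler_wpM2l ?(ltW c0)// ler_piMr ?expR_ge0// ler_norml.
    by rewrite cos_geN1 cos_le1.
  - by rewrite -oppr0; apply: cvgN.
  - exact: e0.
by apply: etrans (cvg_unique _ h1 h2) _; rewrite // mulr0 addr0.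
Qed.

Definition bumpc t : R[i] := (bump t)%:C.

Lemma csupp_bump : csupp 1 bumpc.
Proof. by move=> t t1; rewrite /bumpc /bump pos_1Bsqr_eq0// expr0n. Qed.

Lemma ccontinuous_bump : ccontinuous bumpc.
Proof. apply: ccontinuous_real; exact: (is_deriv_continuous is_deriv_bump). Qed.

Lemma cintegrable_bump : cintegrable setT bumpc.
Proof. exact: csupp_cintegrable ccontinuous_bump csupp_bump. Qed.

Lemma ccontinuous_bump2 : ccontinuous (fun t => (bump2 t)%:C).
Proof. by apply: ccontinuous_real; exact: continuous_bump2. Qed.

Lemma csupp_bump2 : csupp 1 (fun t => (bump2 t)%:C).
Proof. by move=> t t1; rewrite /bump2 pos_1Bsqr_eq0// expr0n !mulr0 oppr0 addr0. Qed.

Lemma ft_bump2 s : ft (fun t => (bump2 t)%:C) s%:C = - s%:C ^+ 2 * ft bumpc s%:C.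
Proof.
have d1 : is_cderiv bumpc (fun t => (bump1 t)%:C) := is_cderiv_real is_deriv_bump.
have d2 : is_cderiv (fun t => (bump1 t)%:C) (fun t => (bump2 t)%:C) := is_cderiv_real is_deriv_bump1.
have s1 : csupp 1 (fun t => (bump1 t)%:C).
  by move=> t t1; rewrite /bump1 pos_1Bsqr_eq0// expr0n mulr0 oppr0.
rewrite (ft_deriv_csupp _ d2 ccontinuous_bump2 s1 csupp_bump2) (ft_deriv_csupp _ d1 (is_cderiv_continuous d2) csupp_bump s1).
rewrite mulrA; congr (_ * _).
by apply: complexP; rewrite !ReImE /=; ring.
Qed.

(* The transform of the even function [bump] is real. *)
Definition bumphat s : R := Re (ft bumpc s%:C).

Lemma Re_bump_cexp s t : Re (bumpc t * cexp ('i * s%:C * t%:C)) = bump t * cos (s * t).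
Proof.
rewrite ReImE Re_cexp !ReImE /=.
have -> : (0 * s - 1 * 0) * t - (0 * 0 + 1 * s) * 0 = 0 by ring.
have -> : (0 * s - 1 * 0) * 0 + (0 * 0 + 1 * s) * t = s * t by ring.
by rewrite expR0 mul1r mul0r subr0.
Qed.

Lemma Im_bump_cexp s t : Im (bumpc t * cexp ('i * s%:C * t%:C)) = bump t * sin (s * t).
Proof.
rewrite ReImE Im_cexp !ReImE /=.
have -> : (0 * s - 1 * 0) * t - (0 * 0 + 1 * s) * 0 = 0 by ring.
have -> : (0 * s - 1 * 0) * 0 + (0 * 0 + 1 * s) * t = s * t by ring.
by rewrite expR0 mul1r mul0r addr0.
Qed.

Lemma bumphatE s : bumphat s = \int[mu]_t (bump t * cos (s * t)).
Proof. by rewrite /bumphat /ft /=; apply: eq_Rintegral => t _; rewrite Re_bump_cexp. Qed.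

Lemma bumpN t : bump (- t) = bump t. Proof. by rewrite /bump sqrrN. Qed.

(** The sine part is odd, so its primitive [P] is even and the integrals over symmetric intervals
    vanish. *)
Lemma ft_bump s : ft bumpc s%:C = (bumphat s)%:C.
Proof.
have [_ jS] := cintegrable_ft s cintegrable_bump.
have [_ cS] := ccontinuousM ccontinuous_bump (ccontinuous_cexpZ ('i * s%:C)).
pose P x := \int[mu]_(t in `]-oo, x]) Im (bumpc t * cexp ('i * s%:C * t%:C)).
have dP x : is_derive x (1 : R) P (Im (bumpc x * cexp ('i * s%:C * x%:C))).
  exact: is_deriv_primitive.
apply: complexP => //=.
have dQ x : is_derive x (1 : R) (fun x => P x - P (- x)) ((fun=> 0) x).
  have dN : is_derive x (1 : R) (fun x => - x) (-1) by apply: is_deriv_opp; exact: is_deriv_id.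
  apply: is_deriv_eq (is_deriv_sub (dP x) (is_deriv_comp (dP _) dN)) _.
  by rewrite !Im_bump_cexp bumpN (mulrN s x) sinN /=; ring.
have E (n : nat) : \int[mu]_(t in `[- n%:R, n%:R]) Im (bumpc t * cexp ('i * s%:C * t%:C)) = 0.
  rewrite Rintegral_itv_primitive ?ge0_cp// -/(P _) -/(P _).
  have := @Rintegral_deriv R _ _ 0 n%:R _ dQ (@cst_continuous _ _ _); rewrite oppr0 subrr subr0 => <-//.
  by rewrite /Rintegral integral0.
have h := Rintegral_sym_cvg jS; rewrite (funext E) in h.
by apply/esym; exact: (cvg_unique _ (cvg_cst 0) h).
Qed.

Lemma continuous_bumphat : continuous bumphat.
Proof.
have [h _] := @ft_ccontinuous R _ 1 cintegrable_bump.
have -> // : bumphat = (fun s => Re (ft bumpc (1 * s)%:C)).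
by apply/funext => s; rewrite mul1r.
Qed.

Lemma bumphat_bound : exists K, forall s, `|bumphat s| <= K / (1 + s ^+ 2).
Proof.
have i2 := csupp_cintegrable ccontinuous_bump2 csupp_bump2.
exists (2 * \int[mu]_t normc (bumpc t) + 2 * \int[mu]_t normc ((bump2 t)%:C : R[i])) => s.
have h1 := normc_ft_le s cintegrable_bump; have h2 := normc_ft_le s i2.
rewrite ft_bump2 ft_bump normcM normcN normcX !normc_real real_normK ?num_real// in h2.
rewrite ft_bump normc_real in h1.
by rewrite ler_pdivlMr ?sqrD1_gt0// mulrDr mulr1 lerD// mulrC.
Qed.

(** Only |t| <= c is kept: there the Poisson kernel is at least [1 / c] and [bump] at least 27/64,
    on an interval of length [2 c]. *)
Lemma Rintegral_bump_poisson_ge c : 0 < c -> c <= 1 / 2 ->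
  mu.-integrable setT (EFin \o (fun t => bump t * (2 * c / (c ^+ 2 + t ^+ 2)))) ->
  27 / 32 <= \int[mu]_t (bump t * (2 * c / (c ^+ 2 + t ^+ 2))).
Proof.
move=> c0 c2 i2; have c0' := ltW c0.
have p0 t : 0 < c ^+ 2 + t ^+ 2 by rewrite ltr_wpDr ?sqr_ge0// exprn_gt0.
have f0 t : 0 <= bump t * (2 * c / (c ^+ 2 + t ^+ 2)).
  by apply: mulr_ge0; [exact: bump_ge0|apply: divr_ge0; [rewrite mulr_ge0|exact: ltW]].
apply: (@le_trans _ _ (\int[mu]_(t in `[- c, c]) (27 / 64 / c))).
  have cc : - c <= c by rewrite ge0_cp.
  rewrite (Rintegral_cst_itv _ cc) le_eqVlt; apply/orP; left; apply/eqP.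
  by field; rewrite gt_eqF.
rewrite [leLHS]Rintegral_mkcond; apply: le_Rintegral => //.
  by apply: integrable_restrict => //; apply: continuous_integrable_itv; exact: cst_continuous.
move=> t _; rewrite patchE; case: ifPn => [|_]; last exact: f0.
rewrite inE /= in_itv /= -ler_norml => tc; rewrite ler_pM ?divr_ge0//.
  by rewrite invr_ge0.
  by apply: bump_ge; exact: le_trans tc c2.
rewrite ler_pdivlMr// mulrC ler_pdivrMr//.
have : t ^+ 2 <= c ^+ 2 by rewrite -(real_normK (num_real t)) ler_pXn2r// nnegrE// ltW.
clear; nra.
Qed.

Lemma Rintegral_bumphat_damped c : 0 < c -> c <= 1 / 2 ->
  27 / 32 <= \int[mu]_s (expR (- (c * `|s|)) * bumphat s).
Proof.
move=> c0 c2.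
pose k (s t : R) : R := expR (- (c * `|s|)) * (bump t * cos (s * t)).
have cb : continuous (@bump R) := is_deriv_continuous is_deriv_bump.
have jb : mu.-integrable setT (EFin \o (@bump R)).
  by have [] := cintegrable_bump.
have ce : continuous (fun s : R => expR (- (c * `|s|))).
  exact: continuous_expRNabs.
have mk : measurable_fun setT (fun z : (measurableTypeR R) * (measurableTypeR R) => k z.1 z.2).
  apply: measurable_funM.
    exact: (measurableT_comp (continuous_measurable_fun ce) measurable_fst_real).
  apply: measurable_funM.
    exact: (measurableT_comp (continuous_measurable_fun cb) measurable_snd_real).
  apply: (measurableT_comp (continuous_measurable_fun (@continuous_cos R))).
  by apply: measurable_funM; [exact: measurable_fst_real|exact: measurable_snd_real].
have [|_ i2 e] := real_Fubini mk (integrable_expRNabs c0) jb.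
  move=> s t; rewrite /k normrM (@ger0_norm _ (expR _)) ?expR_ge0// normrM (ger0_norm (bump_ge0 t)) ler_wpM2l ?expR_ge0//.
  by rewrite -[leRHS]mulr1 ler_wpM2l ?bump_ge0// ler_norml cos_geN1 cos_le1.
have e1 s : \int[mu]_t k s t = expR (- (c * `|s|)) * bumphat s.
  rewrite bumphatE -RintegralZl//.
  by have [h _] := cintegrable_ft s cintegrable_bump; apply: eq_integrable h => // t _; rewrite /= Re_bump_cexp.
have e2 t : \int[mu]_s k s t = bump t * (2 * c / (c ^+ 2 + t ^+ 2)).
  rewrite -(Rintegral_expRNabs_cos t c0) -(RintegralZl _ measurableT (integrable_expRNabs_cos t c0)).
  by apply: eq_Rintegral => s _; rewrite /k mulrCA.
under eq_Rintegral do rewrite -e1.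
rewrite e (funext e2); rewrite (funext e2) in i2.
exact: Rintegral_bump_poisson_ge.
Qed.

(** By inversion the value is [2 pi bump(0)]. Nonvanishing follows from Abel damping: each damped
    integral equals a Poisson integral of [bump], hence is at least 27/32, and the damping factor
    tends to 1. *)
Lemma bumphat_integral_neq0 : \int[mu]_s bumphat s != 0.
Proof.
have [K HK] := bumphat_bound.
have jb := kernel_integrable continuous_bumphat HK.
(* The damping rate [1 / (n + 2)] never exceeds 1/2, as the lower bound for the damped integral
   demands. *)
have h : (\int[mu]_s (expR (- (n.+2%:R^-1 * `|s|)) * bumphat s)) @[n --> \oo] --> \int[mu]_s bumphat s.
  apply: (@Rintegral_dominated_cvg _ _ _ _ (fun s => `|bumphat s|)) => //.
  - move=> n; apply: continuous_measurable_fun => s; apply: cvgM; last exact: continuous_bumphat.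
    exact: continuous_expRNabs.
  - exact: continuous_measurable_fun continuous_bumphat.
  - move=> s _; rewrite -[X in _ --> X]mul1r; apply: cvgM; last exact: cvg_cst.
    suff h0 : - (n.+2%:R^-1 * `|s|) @[n --> \oo] --> (0 : R).
      by have := cvg_comp _ _ h0 (@continuous_expR R 0); rewrite expR0.
    rewrite -oppr0; apply: cvgN; rewrite -[X in _ --> X](mul0r `|s|); apply: cvgM; last exact: cvg_cst.
    by have := @cvg_harmonic R; rewrite -cvg_shiftS.
  - exact: integrable_norm.
  - move=> n s _; rewrite normrM ger0_norm ?expR_ge0// ler_piMl// expR_le1 oppr_le0 mulr_ge0//.
have : 27 / 32 <= \int[mu]_s bumphat s.
  rewrite -(cvg_lim (@Rhausdorff R) h); apply: limr_ge; first by apply/cvg_ex; eexists; exact: h.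
  apply: nearW => n; apply: Rintegral_bumphat_damped; first by rewrite invr_gt0.
  by rewrite div1r lef_pV2 ?posrE// ler_nat.
by move=> hh; rewrite gt_eqF//; apply: lt_le_trans hh; rewrite divr_gt0.
Qed.

Lemma ft_bump_scale (n : nat) a s : (0 < n)%N ->
  ft (fun t => bumpc (t / n%:R) * cexp (- 'i * a%:C * t%:C)) s%:C = (n%:R * bumphat (n%:R * (s - a)))%:C.
Proof.
move=> n0; have nn0 : n%:R != 0 :> R by rewrite pnatr_eq0 -lt0n.
pose g u := bumpc u * cexp ('i * (n%:R * (s - a))%:C * u%:C).
have E t : bumpc (t / n%:R) * cexp (- 'i * a%:C * t%:C) * cexp ('i * s%:C * t%:C) = g (t / n%:R).
  rewrite /g -mulrA -cexpD; congr (_ * cexp _).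
  by apply: complexP; rewrite !ReImE /=; field.
have gi : cintegrable setT g by exact: cintegrable_ft cintegrable_bump.
have gc : ccontinuous g by apply: ccontinuousM ccontinuous_bump (ccontinuous_cexpZ _).
have gnc : ccontinuous (fun t => g (t / n%:R)).
  have ct : continuous (fun t : R => t / n%:R) by move=> t; apply: cvgM; [exact: cvg_id|exact: cvg_cst].
  split => t.
    exact: (@continuous_comp _ _ _ (fun t : R => t / n%:R) (fun u => Re (g u)) _ (ct t) (gc.1 _)).
  exact: (@continuous_comp _ _ _ (fun t : R => t / n%:R) (fun u => Im (g u)) _ (ct t) (gc.2 _)).
have gni : cintegrable setT (fun t => g (t / n%:R)).
  apply: (@csupp_cintegrable _ _ n%:R) => // t tn; rewrite /g csupp_bump ?mul0r//.
  by rewrite normrM normfV (@ger0_norm _ n%:R)// ler_pdivlMr ?mul1r// ltr0n.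
have -> : (n%:R * bumphat (n%:R * (s - a)))%:C = n%:R%:C * ft bumpc (n%:R * (s - a))%:C.
  by rewrite ft_bump -rmorphM.
rewrite /ft (cint_ext (g := fun t => g (t / n%:R))) => [|t _]; last exact: E.
apply: complexP; rewrite !ReImE /= mul0r ?subr0 ?addr0.
  exact: (Rintegral_scale n0 gc.1 gi.1 gni.1).
exact: (Rintegral_scale n0 gc.2 gi.2 gni.2).
Qed.

Lemma bumphatN s : bumphat (- s) = bumphat s.
Proof. by rewrite !bumphatE; apply: eq_Rintegral => t _; rewrite mulNr cosN. Qed.

(** As [bumphat] is real, the hypothesis splits into one on the real part and one on the imaginary
    part of [g], and [kernel_density] applies to each. *)
Lemma bump_density (g : R -> R[i]) : L2 g ->
  (forall (n : nat) a, (0 < n)%N -> cint setT (fun s => (bumphat (n%:R * (s - a)))%:C * g s) = 0) ->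
  ae_equal g (fun=> 0).
Proof.
move=> [g1 g2] H; have [K HK] := bumphat_bound.
have kd := kernel_density continuous_bumphat HK bumphat_integral_neq0.
have a1 : {ae mu, forall x, Re (g x) = 0}.
  apply: kd => // n a n0; have := congr1 (@Re R) (H n a n0) => /= e; rewrite -[RHS]e.
  by apply: eq_Rintegral => s _; rewrite cReM /= mul0r subr0.
have a2 : {ae mu, forall x, Im (g x) = 0}.
  apply: kd => // n a n0; have := congr1 (@Im R) (H n a n0) => /= e; rewrite -[RHS]e.
  by apply: eq_Rintegral => s _; rewrite cImM /= mul0r addr0.
apply: filterS2 a1 a2; first exact: (ae_filter_ringOfSetsType mu).
by move=> x r1 r2; exact: complexP.
Qed.

End BumpTransform.

(** * Test functions in the domain of the operator *)

Section SmoothCompactSupport.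
Context {R : realType}.
Local Notation mu := (@lebesgue_measure R).
Implicit Types (s t x a c N B : R) (z : R[i]) (W V H : R -> R[i]).

Definition C1 W := exists W', is_cderiv W W' /\ ccontinuous W'.

Lemma C1_ccontinuous W : C1 W -> ccontinuous W.
Proof. by move=> [W' [d _]]; exact: is_cderiv_continuous d. Qed.

Lemma C1D W V : C1 W -> C1 V -> C1 (fun t => W t + V t).
Proof.
move=> [W' [d1 c1]] [V' [d2 c2]]; exists (fun t => W' t + V' t).
by split; [exact: is_cderivD|exact: ccontinuousD].
Qed.

Lemma C1M W V : C1 W -> C1 V -> C1 (fun t => W t * V t).
Proof.
move=> [W' [d1 c1]] [V' [d2 c2]]; exists (fun t => W' t * V t + W t * V' t).
split; first exact: is_cderivM.
have cW := is_cderiv_continuous d1; have cV := is_cderiv_continuous d2.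
by apply: ccontinuousD; apply: ccontinuousM.
Qed.

Lemma C1_cst z : C1 (fun=> z).
Proof. by exists (fun=> 0); split; [exact: is_cderiv_cst|exact: ccontinuous_cst]. Qed.

Lemma C1Z z W : C1 W -> C1 (fun t => z * W t).
Proof. by move=> h; apply: C1M h; exact: C1_cst. Qed.

Lemma C1_real (f f' : R -> R) : (forall x, is_derive x (1 : R) f (f' x)) -> continuous f' ->
  C1 (fun t => (f t)%:C).
Proof.
move=> d c; exists (fun t => (f' t)%:C); split; first exact: is_cderiv_real.
exact: ccontinuous_real.
Qed.

Lemma csuppW N B W : N <= B -> csupp N W -> csupp B W.
Proof. by move=> NB h t Bt; apply: h; exact: le_trans Bt. Qed.

Lemma csuppMl W V N : csupp N V -> csupp N (fun t => W t * V t).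
Proof. by move=> sV t /sV ->; rewrite mulr0. Qed.

Lemma csuppD W V N : csupp N W -> csupp N V -> csupp N (fun t => W t + V t).
Proof. by move=> sW sV t Nt; rewrite sW// sV// addr0. Qed.

(** Enlarging the radius by 1 makes [W] vanish on a whole neighbourhood of every point
    considered. *)
Lemma csupp_deriv W W' N : is_cderiv W W' -> csupp N W -> csupp (N + 1) W'.
Proof.
move=> dW sW t Nt.
have key (P : R[i] -> R) d : P 0 = 0 -> is_derive t (1 : R) (fun t => P (W t)) d -> d = 0.
  move=> P0 [_ <-].
  have F0 : \forall y \near t, P (W y) = (fun=> 0) y.
    have Ny : \forall y \near t, N < `|y|.
      have cn : (`|y| : R) @[y --> t] --> (`|t| : R) by exact: norm_continuous.
      by apply: (cvgr_gt _ cn); apply: lt_le_trans Nt; rewrite ltrDl.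
    by apply: filterS Ny => y Ny; rewrite sW ?P0// ltW.
  by rewrite (@near_eq_derive R R R (fun t => P (W t)) (fun=> 0) t 1 F0) derive_cst.
have [d1 d2] := dW t.
by apply: complexP; [exact: (key (@Re R) _ erefl d1)|exact: (key (@Im R) _ erefl d2)].
Qed.

Lemma normc_cexp_strip z t B : `|Im z| <= B -> normc (cexp ('i * z * t%:C)) <= expR (B * `|t|).
Proof.
move=> zB; rewrite normc_cexp ler_expR.
have -> : Re ('i * z * t%:C) = - (Im z * t) by rewrite !ReImE /=; ring.
apply: le_trans (ler_norm _) _; rewrite normrN normrM ler_wpM2r//.
Qed.

Lemma csupp_strip_integrable W N B : ccontinuous W -> csupp N W ->
  mu.-integrable setT (EFin \o (fun t => normc (W t) * expR (B * `|t|))).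
Proof.
move=> cW sW.
have ce : continuous (fun t : R => expR (B * `|t|)).
  by apply: continuous_expR_comp => t; apply: cvgM; [exact: cvg_cst|exact: norm_continuous].
have h : cintegrable setT (fun t => (expR (B * `|t|))%:C * W t).
  apply: csupp_cintegrable (csuppMl _ sW).
  by apply: ccontinuousM cW; exact: ccontinuous_real.
have := cintegrable_normc measurableT h.
apply: eq_integrable => // t _ /=; congr EFin.
by rewrite normcM normc_real ger0_norm ?expR_ge0// mulrC.
Qed.

Lemma csupp_ft_integrable W N z : ccontinuous W -> csupp N W ->
  cintegrable setT (fun t => W t * cexp ('i * z * t%:C)).
Proof.
move=> cW sW; apply: csupp_cintegrable (csuppMr _ sW).
by apply: ccontinuousM cW _; exact: ccontinuous_cexpZ.
Qed.

Lemma normc_ft_strip W N B : ccontinuous W -> csupp N W ->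
  exists2 K, 0 <= K & forall z, `|Im z| <= B -> normc (ft W z) <= K.
Proof.
move=> cW sW; exists (2 * \int[mu]_t (normc (W t) * expR (B * `|t|))).
  rewrite mulr_ge0//; apply: Rintegral_ge0 => t _; by rewrite mulr_ge0 ?normc_ge0 ?expR_ge0.
move=> z zB; apply: le_normc_cint => //; first exact: csupp_ft_integrable cW sW.
  exact: csupp_strip_integrable sW.
move=> t _; rewrite normcM ler_wpM2l ?normc_ge0//; exact: normc_cexp_strip.
Qed.

(** Differentiation under the integral: the derivative is the transform of ['i * t * W t], and
    [cexp_sub1D_le] bounds the remainder of the integrand by [8 N^2 normc h ^ 2] times an integrable
    function. *)
Lemma cderivable_ft W N z : 0 < N -> ccontinuous W -> csupp N W -> cderivable (ft W) z.
Proof.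
move=> N0 cW sW; pose V t := 'i * t%:C * W t.
have cV : ccontinuous V.
  by apply: ccontinuousM cW; apply: ccontinuousZ; exact: ccontinuous_id.
have sV : csupp N V by exact: csuppMl.
exists (ft V z) => e e0.
pose B := `|Im z|; pose I0 := \int[mu]_t (normc (W t) * expR (B * `|t|)).
have I0_ge0 : 0 <= I0 by apply: Rintegral_ge0 => t _; rewrite mulr_ge0 ?normc_ge0 ?expR_ge0.
pose K := 2 * (8 * N ^+ 2 * I0).
have K0 : 0 <= K by rewrite /K; do 3! (apply: mulr_ge0 => //); exact: sqr_ge0.
have K1 : 0 < K + 1 by rewrite ltr_wpDl.
(* The first bound keeps |h t| <= 1/2 on the support, the range of [cexp_sub1D_le]; the second makes
   the quadratic remainder at most [e * normc h]. *)
exists (Num.min (2 * N)^-1 (e / (K + 1))).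
  by rewrite lt_min invr_gt0 mulr_gt0//= divr_gt0.
move=> h; rewrite lt_min => /andP[h1 h2].
have h0 := normc_ge0 h.
have iz w := csupp_ft_integrable w cW sW.
have iV := csupp_ft_integrable z cV sV.
have -> : ft W (z + h) - ft W z - ft V z * h =
    cint setT (fun t => W t * cexp ('i * z * t%:C) * (cexp ('i * h * t%:C) - 1 - 'i * h * t%:C)).
  rewrite /ft -(cintB measurableT (iz (z + h)) (iz z)) -(cintZr h measurableT iV).
  rewrite -(cintB measurableT (cintegrableB measurableT (iz (z + h)) (iz z))); last first.
    by have := cintegrableZ h measurableT iV; apply: cintegrable_ext => // t _; rewrite mulrC.
  apply: cint_ext => t _; rewrite /V.
  have -> : 'i * (z + h) * t%:C = 'i * z * t%:C + 'i * h * t%:C by ring.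
  by rewrite cexpD; ring.
have iI := @csupp_strip_integrable W N B cW sW.
apply: (@le_trans _ _ (2 * \int[mu]_t (8 * N ^+ 2 * normc h ^+ 2 * (normc (W t) * expR (B * `|t|))))).
  apply: le_normc_cint => //.
  - apply: (@csupp_cintegrable _ _ N); last by do 2! apply: csuppMr.
    apply: ccontinuousM.
      by apply: ccontinuousM cW _; exact: ccontinuous_cexpZ.
    apply: ccontinuousB; last by apply: ccontinuousZ; exact: ccontinuous_id.
    by apply: ccontinuousB; [exact: ccontinuous_cexpZ|exact: ccontinuous_cst].
  - exact: integrable_realZ.
  - move=> t _; have [tN|Nt] := leP `|t| N; last first.
      by rewrite sW ?(ltW Nt)// !mul0r normc0 mul0r mulr0.
    have nh : normc ('i * h * t%:C) = normc h * `|t| by rewrite !normcM normc_i mul1r normc_real.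
    have small : normc ('i * h * t%:C) <= 1 / 2.
      rewrite nh; apply: le_trans (ler_pM _ _ (ltW h1) tN) _ => //.
      by rewrite le_eqVlt; apply/orP; left; apply/eqP; field; rewrite gt_eqF.
    have q := cexp_sub1D_le small; rewrite nh in q.
    rewrite !normcM [leRHS]mulrC; apply: ler_pM; rewrite ?mulr_ge0 ?normc_ge0//.
      by rewrite ler_wpM2l ?normc_ge0//; exact: normc_cexp_strip.
    apply: (le_trans q); rewrite exprMn -mulrA ler_wpM2l// mulrC ler_wpM2r ?exprn_ge0//.
    by rewrite ler_pXn2r ?nnegrE// ltW.
rewrite RintegralZl//.
have -> : 2 * (8 * N ^+ 2 * normc h ^+ 2 * I0) = K * normc h * normc h by rewrite /K; ring.
rewrite ler_wpM2r//; apply: (@le_trans _ _ ((K + 1) * normc h)); first by rewrite ler_wpM2r// lerDl.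
by rewrite mulrC -ler_pdivlMr// ltW.
Qed.

Lemma ft_mul W W' N z : is_cderiv W W' -> ccontinuous W' -> csupp N W -> csupp N W' ->
  z * ft W z = 'i * ft W' z.
Proof.
move=> d c s1 s2; rewrite (ft_deriv_csupp z d c s1 s2).
have ii : 'i * 'i = -1 :> R[i] by rewrite -expr2 sqr_i.
transitivity (- ('i * 'i) * z * ft W z); last by ring.
by rewrite ii opprK mul1r.
Qed.

Lemma L2D u v : @L2 R u -> L2 v -> L2 (fun x => u x + v x).
Proof.
move=> hu hv; have [m1 m2] := L2_cmeasurable hu; have [n1 n2] := L2_cmeasurable hv.
have jb := integrable_realD measurableT (integrable_realZ 2 measurableT (L2_normc_sqr hu))
   (integrable_realZ 2 measurableT (L2_normc_sqr hv)).
apply: L2_dom jb _.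
  by split; under eq_fun do rewrite ReImE; exact: measurable_funD.
move=> x; have h := normcD (u x) (v x).
have h0 := normc_ge0 (u x + v x).
apply: (@le_trans _ _ ((normc (u x) + normc (v x)) ^+ 2)).
  by rewrite ler_pXn2r ?nnegrE// addr_ge0 ?normc_ge0.
by have := sqr_ge0 (normc (u x) - normc (v x)); nra.
Qed.

Lemma ft_L2 W N : C1 W -> csupp N W -> L2 (fun s => ft W s%:C).
Proof.
move=> [W' [d c]] sW; have cW := is_cderiv_continuous d.
have sW' := csupp_deriv d sW.
have sW1 : csupp (N + 1) W by apply: csuppW sW; rewrite lerDl.
have iW := csupp_cintegrable cW sW; have iW' := csupp_cintegrable c sW'.
apply: (@L2_mul_bound _ _ (2 * \int[mu]_t normc (W t)) (2 * \int[mu]_t normc (W' t))).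
- have -> : (fun s => ft W s%:C) = (fun s => ft W (1 * s)%:C).
    by apply/funext => s; rewrite mul1r.
  by apply: ccontinuous_measurable; exact: ft_ccontinuous.
- by move=> s; exact: normc_ft_le.
- by move=> s; rewrite (ft_mul s%:C d c sW1 sW') normcM normc_i mul1r; exact: normc_ft_le.
Qed.

(* Two derivatives of [W] make [z ^+ 2 * ft W z] bounded on the strip. *)
Lemma ft_spaceV W W' N : is_cderiv W W' -> C1 W' -> csupp N W -> spaceV (ft W).
Proof.
move=> d1 [W'' [d2 c2]] sW; pose M := `|N| + 2.
have N0 : 0 <= `|N| by []. have Nn := ler_norm N.
have c1 := is_cderiv_continuous d2; have c0 := is_cderiv_continuous d1.
have s1 := csupp_deriv d1 sW; have s2 := csupp_deriv d2 s1.
have {}s2 : csupp M W'' by apply: csuppW s2; rewrite /M; lra.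
have {}s1 : csupp M W' by apply: csuppW s1; rewrite /M; lra.
have s0 : csupp M W by apply: csuppW sW; rewrite /M; lra.
have M0 : 0 < M by rewrite /M; lra.
split.
  exists 1 => // s _; apply: cderivable_derivable; exact: cderivable_ft M0 c0 s0.
exists (1 / 2); first by rewrite divr_gt0.
have [K K0 HK] := @normc_ft_strip W'' M 1 c2 s2.
exists K, 1 => z z1 x1; rewrite normcE lecR.
have x0 : 0 < `|Re z| by exact: lt_le_trans x1.
have -> : - (3 / 2) - 1 / 2 = - (2%:R) :> R by field.
rewrite powRN powR_mulrn; last exact: ltW.
rewrite -[K * _]/(K / _) ler_pdivlMr ?exprn_gt0//.
have h := HK z z1.
have e : z ^+ 2 * ft W z = - ft W'' z.
  by rewrite expr2 -mulrA (ft_mul z d1 c1 s0 s1) mulrCA (ft_mul z d2 c2 s1 s2) mulrA -expr2 sqr_i mulN1r.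
have e2 : normc (ft W'' z) = normc (z ^+ 2 * ft W z) by rewrite e normcN.
rewrite e2 in h; apply: le_trans h; rewrite normcM normcX mulrC ler_wpM2r ?normc_ge0//.
by rewrite ler_pXn2r ?nnegrE ?normc_ge0// le_Re_normc.
Qed.

End SmoothCompactSupport.

(** * Compactly supported solutions of the inhomogeneous equation *)

Section TestFunctions.
Context {R : realType}.
Local Notation mu := (@lebesgue_measure R).
Variables (tau phi kappa : R).
Hypothesis phi_gt0 : 0 < phi.
Hypothesis phi_ltpi : phi < pi.
Implicit Types (t s x : R) (H F W : R -> R[i]).

Local Notation EE := (EE tau phi kappa).
Local Notation EE' := (EE' tau phi kappa).
Local Notation eta := (eta tau phi kappa).
Local Notation eta' := (eta' tau phi kappa).
Local Notation p := (pcoef phi).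
Local Notation q := (qcoef tau phi).

Definition EEV t : R[i] := cexp (-1 * eta t).

Lemma EEV_mul t : EEV t * EE t = 1.
Proof. by rewrite /EEV mulN1r cexpN mulVf// cexp_neq0. Qed.

Lemma C1_EEV : C1 EEV.
Proof.
have d := is_cderivZ (-1) (is_cderiv_eta tau kappa phi_gt0 phi_ltpi).
exists (fun t => -1 * eta' t * EEV t); split; first exact: (is_cderiv_cexp d).
have c := ccontinuous_eta' tau kappa phi_gt0 phi_ltpi.
apply: ccontinuousM; first exact: ccontinuousZ.
by apply: ccontinuous_cexp; exact: is_cderiv_continuous d.
Qed.

Lemma C1_expR : C1 (fun t : R => (expR t)%:C).
Proof. by apply: (@C1_real _ (@expR R) (@expR R)); exact: continuous_expR. Qed.

Lemma C1_expRN : C1 (fun t : R => (expR (- t))%:C).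
Proof.
apply: (@C1_real _ _ (fun t => - expR (- t))).
  move=> x; apply: is_deriv_eq (is_deriv_expR (is_deriv_opp (is_deriv_id x))) _; ring.
by move=> x; apply: cvgN; exact: continuous_expRN.
Qed.

Lemma C1_ext W H : W =1 H -> C1 W -> C1 H.
Proof. by move=> /funext ->. Qed.

Definition pcoefV t : R := (p t)^-1.
Definition pcoefV' t : R := - ((expR t - expR (- t)) * (pcoefV t * pcoefV t)).

Lemma pcoefV_mul t : (p t)%:C * (pcoefV t)%:C = 1.
Proof. by rewrite -rmorphM /= /pcoefV mulfV// gt_eqF// pcoef_gt0. Qed.

Lemma is_deriv_pcoefV t : is_derive t (1 : R) pcoefV (pcoefV' t).
Proof.
have p0 x : 0 < p x by exact: pcoef_gt0.
have -> : pcoefV = (fun t => expR (- ln (p t))).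
  by apply/funext => x; rewrite expRN lnK// posrE.
apply: is_deriv_eq (is_deriv_expR (is_deriv_opp (is_deriv_ln (p0 t) (is_deriv_pcoef phi t)))) _.
by rewrite (expRN (ln (p t))) lnK ?posrE// /pcoefV' /pcoefV; ring.
Qed.

Lemma continuous_pcoefV' : continuous pcoefV'.
Proof.
have cp := @continuous_pcoefV R phi phi_gt0 phi_ltpi.
move=> t; apply: cvgN; apply: cvgM; last by apply: cvgM; exact: cp.
by apply: cvgB; [exact: continuous_expR|exact: continuous_expRN].
Qed.

Lemma C1_pcoefV : C1 (fun t => (pcoefV t)%:C).
Proof. exact: C1_real is_deriv_pcoefV continuous_pcoefV'. Qed.

(* If [F' = H / p + ccoef * F], then [p * F * EE] is a primitive of [H * EE]. *)
Definition ccoef t : R[i] :=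
  - ((((expR t - expR (- t)) / 2 + kappa)%:C + 'i * (q t)%:C) * (pcoefV t)%:C).

Lemma C1_ccoef : C1 ccoef.
Proof.
have c1 : C1 (fun t : R => (((expR t - expR (- t)) / 2 + kappa)%:C + 'i * (q t)%:C) : R[i]).
  apply: C1_ext (C1D (C1D (C1M (C1D C1_expR (C1Z (-1) C1_expRN)) (C1_cst (2^-1)%:C)) (C1_cst kappa%:C))
     (C1Z 'i (C1Z (2 * tau)%:C (C1D (C1_cst (cos phi)%:C) C1_expR)))) => t.
  by apply: complexP; rewrite /qcoef !ReImE /=; ring.
apply: C1_ext (C1Z (-1) (C1M c1 C1_pcoefV)) => t.
by rewrite mulN1r.
Qed.

Section WithTest.
Variables (H : R -> R[i]) (N : R).
Hypothesis C1H : C1 H.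
Hypothesis sH : csupp N H.
Hypothesis H0 : cint setT (fun t => H t * EE t) = 0.

Let HE t := H t * EE t.

Lemma HE_ccontinuous : ccontinuous HE.
Proof. by apply: ccontinuousM; [exact: C1_ccontinuous|exact: ccontinuous_EE]. Qed.

Lemma HE_integrable : cintegrable setT HE.
Proof. exact: csupp_cintegrable HE_ccontinuous (csuppMr _ sH). Qed.

Definition Uprim t : R[i] := cint `]-oo, t] HE.

Lemma is_cderiv_Uprim : is_cderiv Uprim HE.
Proof.
have [c1 c2] := HE_ccontinuous; have [i1 i2] := HE_integrable.
by move=> x; split; exact: is_deriv_primitive.
Qed.

(** To the left of the support nothing has been integrated yet; to the right the primitive equals
    the full integral, which [H0] makes zero. This is where the hyperplane condition enters. *)
Lemma csupp_Uprim : csupp N Uprim.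
Proof.
move=> t Nt; have z x : N <= `|x| -> HE x = 0 by move=> Nx; rewrite /HE sH// mul0r.
have [t0|t0] := leP 0 t; last first.
  rewrite /Uprim -[RHS](@cint0 R `]-oo, t]); apply: cint_ext => x /=; rewrite in_itv /= => xt.
  by apply: z; apply: le_trans Nt _; rewrite !ltr0_norm//; lra.
rewrite ger0_norm// in Nt.
rewrite -H0 /Uprim /cint; congr (_ +i* _); rewrite Rintegral_mkcond; apply: eq_Rintegral => x _;
  rewrite patchE; case: ifPn => //; rewrite notin_setE /= in_itv/= => /negP; rewrite -ltNge => tx;
  rewrite -/(HE x) z// ger0_norm; lra.
Qed.

(** Variation of constants: the solution with [p * F * EE = Uprim], which takes over the compact
    support of [Uprim]. *)
Definition Ftest t : R[i] := Uprim t * (EEV t * (pcoefV t)%:C).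
Definition Ftest' t : R[i] := H t * (pcoefV t)%:C + ccoef t * Ftest t.

Lemma csupp_Ftest : csupp N Ftest.
Proof. exact: csuppMr csupp_Uprim. Qed.

Lemma csupp_Ftest' : csupp N Ftest'.
Proof. by apply: csuppD; [exact: csuppMr|apply: csuppMl; exact: csupp_Ftest]. Qed.

Lemma is_cderiv_Ftest : is_cderiv Ftest Ftest'.
Proof.
have dE := is_cderiv_cexp (is_cderivZ (-1) (is_cderiv_eta tau kappa phi_gt0 phi_ltpi)).
have dp := is_cderiv_real is_deriv_pcoefV.
apply: is_cderiv_eq (is_cderivM is_cderiv_Uprim (is_cderivM dE dp)) _ => t.
rewrite -/(EEV t) /HE /Ftest' /Ftest.
have -> : H t * EE t * (EEV t * (pcoefV t)%:C) = H t * (pcoefV t)%:C * (EEV t * EE t) by ring.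
rewrite EEV_mul mulr1; congr (_ + _).
(* This is the logarithmic derivative of [EEV / p], multiplied by [1 / p]: the term [p' / (2 p)]
   contained in [- eta'] cancels half of [- p' / p]. *)
have key : -1 * eta' t * (pcoefV t)%:C + (pcoefV' t)%:C = ccoef t * (pcoefV t)%:C.
  by rewrite /ccoef /pcoefV'; apply: complexP; rewrite !ReImE /= -/(pcoefV t) /pcoefV; field;
    rewrite gt_eqF// pcoef_gt0.
transitivity (Uprim t * EEV t * (-1 * eta' t * (pcoefV t)%:C + (pcoefV' t)%:C)); first by ring.
by rewrite key; ring.
Qed.

(** The equation expresses the derivative of [Ftest] through C^1 functions, so [Ftest] gains the
    second derivative that [ft_spaceV] asks for. *)
Lemma C1_Ftest' : C1 Ftest'.
Proof.
have cF' : ccontinuous Ftest'.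
  apply: ccontinuousD; apply: ccontinuousM.
  - exact: C1_ccontinuous C1H.
  - exact: C1_ccontinuous C1_pcoefV.
  - exact: C1_ccontinuous C1_ccoef.
  - exact: is_cderiv_continuous is_cderiv_Ftest.
have C1F : C1 Ftest by exists Ftest'; split; [exact: is_cderiv_Ftest|].
by apply: C1D; apply: C1M => //; [exact: C1_pcoefV|exact: C1_ccoef].
Qed.

Lemma C1_Ftest : C1 Ftest.
Proof.
by exists Ftest'; split; [exact: is_cderiv_Ftest|exact: C1_ccontinuous C1_Ftest'].
Qed.

(** The equation multiplied by ['i * p], with terms grouped by shift: first those with [e^-t], then
    the unshifted ones, then those with [e^t], and derivatives taken of the products, as
    transforming [difference_op] delivers them. *)
Lemma Ftest_ode t :
  'i * (- (expR (- t))%:C * Ftest t + (expR (- t))%:C * Ftest' t) + ('i / 2) * ((expR (- t))%:C * Ftest t) +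
  ((2 * (cos phi)%:C * 'i) * Ftest' t + (- (2 * tau%:C * (cos phi)%:C)) * Ftest t) +
  ('i * ((expR t)%:C * Ftest t + (expR t)%:C * Ftest' t) + (- 'i / 2 - 2 * tau%:C) * ((expR t)%:C * Ftest t)) =
  'i * H t + (- ('i * kappa%:C)) * Ftest t.
Proof.
have ii : 'i * 'i = -1 :> R[i] by rewrite -expr2 sqr_i.
set a : R[i] := (expR t)%:C; set b : R[i] := (expR (- t))%:C; set c : R[i] := (cos phi)%:C.
have hp : (p t)%:C = a + b + 2 * c by rewrite /pcoef !rmorphD rmorphM /= rmorph_nat.
have hq : (q t)%:C = 2 * tau%:C * (c + a) by rewrite /qcoef /c /a; apply: complexP; rewrite !ReImE /=; ring.
have PF : (p t)%:C * Ftest' t = H t - ((a - b) / 2 + kappa%:C + 'i * (q t)%:C) * Ftest t.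
  have hc : ccoef t = - (((a - b) / 2 + kappa%:C + 'i * (q t)%:C) * (pcoefV t)%:C).
    by rewrite /ccoef rmorphD rmorphM rmorphB /= fmorphV rmorph_nat.
  have pp := pcoefV_mul t; rewrite /Ftest' hc.
  transitivity (((p t)%:C * (pcoefV t)%:C) * (H t - ((a - b) / 2 + kappa%:C + 'i * (q t)%:C) * Ftest t)).
    by ring.
  by rewrite pp mul1r.
transitivity ('i * ((p t)%:C * Ftest' t) + 'i * ((a - b) / 2) * Ftest t - (q t)%:C * Ftest t).
  by rewrite hp hq; field.
rewrite PF; transitivity ('i * H t + (- ('i * kappa%:C)) * Ftest t - ('i * 'i + 1) * (q t)%:C * Ftest t).
  by ring.
by rewrite ii addNr !mul0r subr0.
Qed.

Definition ftest (z : R[i]) : R[i] := ft Ftest z.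

Lemma ftest_shift z (e : R) : ftest (z + e%:C * 'i) = ft (fun t => (expR (- (e * t)))%:C * Ftest t) z.
Proof.
apply: cint_ext => t _.
have -> : (expR (- (e * t)))%:C = cexp (- (e * t))%:C.
  by apply: complexP; rewrite ?Re_cexp ?Im_cexp /= ?cos0 ?sin0 ?mulr1 ?mulr0.
have -> : 'i * (z + e%:C * 'i) * t%:C = (- (e * t))%:C + 'i * z * t%:C.
  by apply: complexP; rewrite !ReImE /=; ring.
by rewrite cexpD; ring.
Qed.

Lemma difference_op_algebra (w t c X Y Z X' Y' Z' : R[i]) :
  w * X = 'i * X' -> w * Y = 'i * Y' -> w * Z = 'i * Z' ->
  'i * (1 / 2 - 'i * w) * X + 2 * (w - t) * c * Y - 'i * (1 / 2 + 'i * w - 2 * 'i * t) * Z =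
  'i * X' + 'i / 2 * X + (2 * c * 'i * Y' + - (2 * t * c) * Y) +
  ('i * Z' + (- 'i / 2 - 2 * t) * Z).
Proof.
have ii : 'i * 'i = -1 :> R[i] by rewrite -expr2 sqr_i.
move=> eX eY eZ; rewrite -eX -eZ.
have -> : 2 * c * 'i * Y' = 2 * c * ('i * Y') by ring.
rewrite -eY.
transitivity (('i / 2 - 'i * 'i * w) * X + 2 * (w - t) * c * Y -
   ('i / 2 + 'i * 'i * w - 2 * ('i * 'i) * t) * Z); first by field.
by rewrite ii; field.
Qed.

Lemma difference_op_ftest s : difference_op tau phi ftest s%:C =
  'i * ft H s%:C + (- ('i * kappa%:C)) * ftest s%:C.
Proof.
pose Fm t := (expR (- t))%:C * Ftest t; pose Fp t := (expR t)%:C * Ftest t.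
pose Fm' t := - (expR (- t))%:C * Ftest t + (expR (- t))%:C * Ftest' t.
pose Fp' t := (expR t)%:C * Ftest t + (expR t)%:C * Ftest' t.
have dF := is_cderiv_Ftest.
have cF := is_cderiv_continuous dF; have cF' := C1_ccontinuous C1_Ftest'.
have sF := csupp_Ftest; have sF' := csupp_Ftest'.
have cE : ccontinuous (fun t : R => (expR t)%:C) := C1_ccontinuous C1_expR.
have cEn : ccontinuous (fun t : R => (expR (- t))%:C) := C1_ccontinuous C1_expRN.
have dEn : is_cderiv (fun t : R => (expR (- t))%:C) (fun t => - (expR (- t))%:C).
  apply: is_cderiv_eq (is_cderiv_real (f' := fun t => - expR (- t)) _) _ => t; last by rewrite rmorphN.
  by apply: is_deriv_eq (is_deriv_expR (is_deriv_opp (is_deriv_id t))) _; ring.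
have dE : is_cderiv (fun t : R => (expR t)%:C) (fun t => (expR t)%:C) by exact: is_cderiv_real.
have dFm : is_cderiv Fm Fm' := is_cderivM dEn dF.
have dFp : is_cderiv Fp Fp' := is_cderivM dE dF.
have sFm : csupp N Fm by exact: csuppMl.
have sFp : csupp N Fp by exact: csuppMl.
have sFm' : csupp N Fm' by apply: csuppD; exact: csuppMl.
have sFp' : csupp N Fp' by apply: csuppD; exact: csuppMl.
have cFm' : ccontinuous Fm'.
  apply: ccontinuousD; apply: ccontinuousM => //.
  by apply: ccontinuous_ext (ccontinuousZ (-1) cEn) => t; rewrite mulN1r.
have cFp' : ccontinuous Fp' by apply: ccontinuousD; exact: ccontinuousM.
have iF := csupp_cintegrable cF sF; have iF' := csupp_cintegrable cF' sF'.
have iFm := csupp_cintegrable (is_cderiv_continuous dFm) sFm.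
have iFp := csupp_cintegrable (is_cderiv_continuous dFp) sFp.
have iFm' := csupp_cintegrable cFm' sFm'; have iFp' := csupp_cintegrable cFp' sFp'.
have iH := csupp_cintegrable (C1_ccontinuous C1H) sH.
have zi k W : cintegrable setT W -> cintegrable setT (fun t => k * W t) by exact: cintegrableZ.
have ei : ftest (s%:C + 'i) = ft Fm s%:C.
  have := ftest_shift s%:C 1; rewrite mul1r => ->; apply: ft_ext => t; by rewrite mul1r.
have em : ftest (s%:C - 'i) = ft Fp s%:C.
  have := ftest_shift s%:C (-1); rewrite rmorphN mulN1r => ->; apply: ft_ext => t.
  by rewrite mulN1r opprK.
rewrite /difference_op ei em.
rewrite /ftest -(ftZ 'i s iH) -(ftZ (- ('i * kappa%:C)) s iF) -(ftD s (zi _ _ iH) (zi _ _ iF)).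
rewrite -(ft_ext _ Ftest_ode).
have lin a b W V : cintegrable setT W -> cintegrable setT V ->
    cintegrable setT (fun t => a * W t + b * V t) /\
    ft (fun t => a * W t + b * V t) s%:C = a * ft W s%:C + b * ft V s%:C.
  move=> iW iV; have i1 := zi a W iW; have i2 := zi b V iV; split; first exact: cintegrableD.
  by rewrite (ftD s i1 i2) (ftZ a s iW) (ftZ b s iV).
have [j1 e1] := lin ('i)%R ('i / 2) _ _ iFm' iFm.
have [j2 e2] := lin (2 * (cos phi)%:C * 'i) (- (2 * tau%:C * (cos phi)%:C)) _ _ iF' iF.
have [j3 e3] := lin ('i)%R (- 'i / 2 - 2 * tau%:C) _ _ iFp' iFp.
rewrite (ftD s (cintegrableD measurableT j1 j2) j3) (ftD s j1 j2) e1 e2 e3.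
exact: (difference_op_algebra _ _ (ft_mul s%:C dFm cFm' sFm sFm') (ft_mul s%:C dF cF' sF sF')
  (ft_mul s%:C dFp cFp' sFp sFp')).
Qed.

Lemma opL_ftest : opL tau phi (fun s => ftest s%:C, fun s => difference_op tau phi ftest s%:C).
Proof.
have l1 : L2 (fun s => ftest s%:C) by exact: ft_L2 C1_Ftest csupp_Ftest.
split => //=.
  rewrite (funext difference_op_ftest); apply: L2D; apply: L2Z => //.
  exact: ft_L2 C1H sH.
exists ftest; first exact: ft_spaceV is_cderiv_Ftest C1_Ftest' csupp_Ftest.
by split; apply: aeW.
Qed.

End WithTest.

(** For [f = ftest H] one has [L f = i ft H - i kappa f]. Paired with [g], the adjoint relation
    gives [- i kappa] times the pairing of [f] with [g], the sign coming from conjugation; these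
    terms cancel and only [i ft H] against [g] is left. *)
Lemma defect_orthogonal H N g : C1 H -> csupp N H -> cint setT (fun t => H t * EE t) = 0 ->
  ker_sub (adjoint (opL tau phi)) ('i * kappa%:C) g ->
  cint setT (fun s => ft H s%:C * (g s)^*) = 0.
Proof.
move=> C1H sH H0 [/= hg hkg K].
have := K _ _ (opL_ftest C1H sH H0).
have l1 : L2 (fun s => ftest H s%:C) by have [] := opL_ftest C1H sH H0.
have l2 : L2 (fun s => ft H s%:C) by exact: ft_L2 C1H sH.
have lg := L2_conj hg.
have i1 := L2_cintegrable l1 lg; have i2 := L2_cintegrable l2 lg.
rewrite /L2_dot !cintegralE /=.
rewrite (cint_ext (g := fun s => 'i * (ft H s%:C * (g s)^* ) + (- ('i * kappa%:C)) * (ftest H s%:C * (g s)^* ))); last first.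
  by move=> s _; rewrite (difference_op_ftest C1H sH H0); ring.
rewrite [X in _ = X -> _](cint_ext (g := fun s => (- ('i * kappa%:C)) * (ftest H s%:C * (g s)^* ))); last first.
  move=> s _; rewrite [RHS]mulrCA; congr (_ * _); rewrite -[LHS]/(conjc _) conjcM; congr (_ * _).
  by apply: complexP; rewrite !ReImE /=; ring.
rewrite (cintD measurableT (cintegrableZ _ measurableT i2) (cintegrableZ _ measurableT i1)).
rewrite !cintZ// => /eqP; rewrite -subr_eq0 addrK mulf_eq0 => /orP[|/eqP//].
by rewrite eq_complex /= oner_eq0 andbF.
Qed.

End TestFunctions.

(** * Uniqueness of the defect vector *)

Section ScaledBumps.
Context {R : realType}.
Local Notation mu := (@lebesgue_measure R).
Implicit Types (s t a : R) (n : nat).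

(** Modulation translates the transform by [a], dilation by [n] contracts it, and the factor [1 / n]
    restores its height. *)
Definition btest n a t : R[i] := (n%:R^-1)%:C * (bumpc (t / n%:R) * cexp (- 'i * a%:C * t%:C)).

Lemma csupp_btest n a : (0 < n)%N -> csupp n%:R (btest n a).
Proof.
move=> n0; apply: csuppMl; apply: csuppMr => t tn; apply: csupp_bump.
by rewrite normrM normfV (@ger0_norm _ n%:R)// ler_pdivlMr ?mul1r// ltr0n.
Qed.

Lemma C1_btest n a : C1 (btest n a).
Proof.
apply: C1Z; apply: C1M; last first.
  by eexists; split; [exact: is_cderiv_cexpZ|apply: ccontinuousZ; exact: ccontinuous_cexpZ].
have dn t : is_derive t (1 : R) (fun t => t / n%:R) (n%:R^-1).
  by apply: is_deriv_eq (is_deriv_mul (is_deriv_id t) (is_deriv_cst n%:R^-1 t)) _; ring.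
apply: (C1_real (fun t => is_deriv_comp (is_deriv_bump _) (dn t))) => t.
apply: cvgM; last exact: cvg_cst.
apply: (@continuous_comp _ _ _ (fun t : R => t / n%:R) (@bump1 R)).
  exact: (is_deriv_continuous dn).
exact: (is_deriv_continuous is_deriv_bump1).
Qed.

Lemma cintegrable_btest n a : (0 < n)%N -> cintegrable setT (btest n a).
Proof.
move=> n0; apply: csupp_cintegrable (csupp_btest _ n0).
exact: C1_ccontinuous (C1_btest _ _).
Qed.

Lemma ft_btest n a s : (0 < n)%N -> ft (btest n a) s%:C = (bumphat (n%:R * (s - a)))%:C.
Proof.
move=> n0; have nn0 : n%:R != 0 :> R by rewrite pnatr_eq0 -lt0n.
have i1 := cintegrableZ n%:R%:C measurableT (cintegrable_btest a n0).
have E t : bumpc (t / n%:R) * cexp (- 'i * a%:C * t%:C) = n%:R%:C * btest n a t.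
  by rewrite /btest mulrA -rmorphM /= mulfV// mul1r.
have := ft_bump_scale a s n0; rewrite (ft_ext _ E) (ftZ _ s (cintegrable_btest a n0)) rmorphM.
by apply: mulfI; rewrite eq_complex /= (negPf nn0).
Qed.

Lemma test_density (h : R -> R[i]) : L2 h ->
  (forall (H : R -> R[i]) (N : R), C1 H -> csupp N H -> cint setT (fun s => ft H s%:C * h s) = 0) ->
  ae_equal h (fun=> 0).
Proof.
move=> hh K; apply: bump_density => // n a n0.
rewrite -[RHS](K _ _ (C1_btest n a) (csupp_btest a n0)).
by apply: cint_ext => s _; rewrite ft_btest.
Qed.

Lemma Rintegral_bump_gt0 : 0 < \int[mu]_t bump t.
Proof.
have [jb _] := @cintegrable_bump R.
apply: (@lt_le_trans _ _ (\int[mu]_(t in `[- (1 / 2), 1 / 2]) (27 / 64))).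
  rewrite Rintegral_cst_itv; last by lra.
  by rewrite mulr_gt0//; lra.
rewrite [leLHS]Rintegral_mkcond; apply: le_Rintegral => //.
  by apply: integrable_restrict => //; apply: continuous_integrable_itv; exact: cst_continuous.
move=> t _; rewrite patchE; case: ifPn => [|_]; last exact: bump_ge0.
by rewrite inE /= in_itv /= -ler_norml; exact: bump_ge.
Qed.

Lemma not_ae_False : ~ {ae mu, forall x : R, False}.
Proof.
move=> [A [mA A0 sA]].
have : (mu setT <= mu A)%E by apply: le_measure; rewrite ?inE//; move=> x _; apply: sA => /=; case.
by rewrite A0 -set_itvNyy lebesgue_measure_itv /= leye_eq.
Qed.

End ScaledBumps.

(** * The defect space is a line *)

Section Uniqueness.
Context {R : realType}.
Local Notation mu := (@lebesgue_measure R).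
Variables (tau phi kappa : R).
Hypothesis phi_gt0 : 0 < phi.
Hypothesis phi_ltpi : phi < pi.
Implicit Types (t s : R) (H : R -> R[i]) (N : R).

Local Notation EE := (EE tau phi kappa).
Local Notation EEV := (EEV tau phi kappa).
Local Notation gdef := (gdef tau phi kappa).
Local Notation ghat := (ghat tau phi kappa).
Local Notation defect := (ker_sub (adjoint (opL tau phi)) ('i * kappa%:C)).

Lemma L2_EE : L2 EE.
Proof.
have [C C0 HC] := @normc_EE_le R tau phi kappa phi_gt0 phi_ltpi.
have j := integrable_realZ (C ^+ 2) measurableT (integrable_expRNabs (@ltr01 R)).
apply: L2_dom j _ => [|t].
  by apply: ccontinuous_measurable; exact: ccontinuous_EE.
have -> : C ^+ 2 * expR (- (1 * `|t|)) = (C * expR (- (1 / 2 * `|t|))) ^+ 2.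
  by rewrite exprMn -expRM_natl; congr (_ * expR _); field.
by rewrite ler_pXn2r ?nnegrE ?normc_ge0 ?mulr_ge0 ?expR_ge0.
Qed.

(** Injectivity of the transform on [EE]: if its transform vanished, [ft_swap] would make [EE]
    orthogonal to every translated and dilated [bumphat], hence zero almost everywhere, whereas an
    exponential has no zero. *)
Lemma gdef_neq0 : ~ ae_equal gdef (fun=> 0).
Proof.
move=> g0; apply: (@not_ae_False R).
have iE := cintegrable_EE tau kappa phi_gt0 phi_ltpi.
suff : ae_equal EE (fun=> 0).
  apply: filterS; first exact: (ae_filter_ringOfSetsType mu).
  by move=> x e; have := EE_neq0 tau phi kappa x; rewrite e eqxx.
apply: bump_density; first exact: L2_EE.
move=> n a n0; have iV := cintegrable_btest a n0.
have [j1 j2 e] := ft_swap (-1) iV iE.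
have -> : (fun s => (bumphat (n%:R * (s - a)))%:C * EE s) = (fun t => EE t * ft (btest n (- a)) (-1 * t)%:C).
  apply/funext => t; rewrite (ft_btest (- a) (-1 * t) n0).
  (* The factor -1 in [ft_swap] evaluates the transform at [- t]; the centre [- a] and the evenness
     of [bumphat] compensate for it. *)
  have -> : bumphat (n%:R * (-1 * t - - a)) = bumphat (n%:R * (t - a)).
    by rewrite -bumphatN; congr bumphat; ring.
  exact: mulrC.
have [_ _ e'] := ft_swap (-1) (cintegrable_btest (- a) n0) iE.
rewrite -e' -[RHS](@cint0 R setT); apply: cint_ae.
- by apply: cintegrable_measurable; have [] := ft_swap (-1) (cintegrable_btest (- a) n0) iE.
- by apply: ccontinuous_measurable; exact: ccontinuous_cst.
- apply: filterS g0; first exact: (ae_filter_ringOfSetsType mu).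
  move=> x gx; have -> : ft EE (-1 * x)%:C = 0; last by rewrite mulr0.
  by apply: conjc_inj; rewrite [LHS]gx; apply: complexP; rewrite /= ?oppr0.
Qed.

(** The bump divided by [EE], so that its integral against [EE] is that of [bump], a positive
    number: it spans a complement of the hyperplane. *)
Definition btest0 t : R[i] := bumpc t * EEV t.

Lemma C1_btest0 : C1 btest0.
Proof.
apply: C1M; last exact: C1_EEV.
by apply: (C1_real is_deriv_bump); exact: (is_deriv_continuous is_deriv_bump1).
Qed.

Lemma csupp_btest0 : csupp 1 btest0.
Proof. exact: csuppMr csupp_bump. Qed.

Let b : R := \int[mu]_t bump t.

Lemma cint_btest0 : cint setT (fun t => btest0 t * EE t) = b%:C.
Proof.
rewrite -cint_real; apply: cint_ext => t _.
by rewrite /btest0 -mulrA EEV_mul mulr1.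
Qed.

(* Both sides vanish on the [H] with zero integral against [EE], by [defect_orthogonal]. *)
Lemma defect_functional H N (g : R -> R[i]) : C1 H -> csupp N H -> defect g ->
  cint setT (fun s => ft H s%:C * (g s)^*) =
  cint setT (fun t => H t * EE t) / b%:C * cint setT (fun s => ft btest0 s%:C * (g s)^*).
Proof.
move=> C1H sH kg; pose k : R[i] := - (cint setT (fun t => H t * EE t) / b%:C).
have bn0 : b%:C != 0 :> R[i].
  by rewrite eq_complex /= (gt_eqF Rintegral_bump_gt0).
have c0 := C1_btest0; pose M : R := Num.max N 1.
have sH' : csupp M H by apply: csuppW sH; rewrite le_max lexx.
have s0 : csupp M btest0 by apply: csuppW csupp_btest0; rewrite le_max lexx orbT.
have iH := csupp_cintegrable (C1_ccontinuous C1H) sH'.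
have i0 := csupp_cintegrable (C1_ccontinuous c0) s0.
pose H1 t := H t + k * btest0 t.
have C1H1 : C1 H1 by apply: C1D => //; exact: C1Z.
have sH1 : csupp M H1 by apply: csuppD => //; exact: csuppMl.
have cE := ccontinuous_EE tau kappa phi_gt0 phi_ltpi.
have iHE : cintegrable setT (fun t => H t * EE t).
  apply: csupp_cintegrable (csuppMr _ sH'); apply: ccontinuousM cE; exact: C1_ccontinuous.
have i0E : cintegrable setT (fun t => btest0 t * EE t).
  apply: csupp_cintegrable (csuppMr _ s0); apply: ccontinuousM cE; exact: C1_ccontinuous.
have z1 : cint setT (fun t => H1 t * EE t) = 0.
  rewrite (cint_ext (g := fun t => H t * EE t + k * (btest0 t * EE t))); last first.
    by move=> t _; rewrite /H1 mulrDl mulrA.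
  rewrite (cintD measurableT iHE (cintegrableZ k measurableT i0E)) (cintZ k measurableT i0E) cint_btest0.
  by rewrite /k mulNr mulfVK// subrr.
have [hg _ _] := kg; have lg := L2_conj hg.
have j1 := L2_cintegrable (ft_L2 C1H sH') lg; have j0 := L2_cintegrable (ft_L2 c0 s0) lg.
have := defect_orthogonal phi_gt0 phi_ltpi C1H1 sH1 z1 kg.
rewrite (cint_ext (g := fun s => ft H s%:C * (g s)^* + k * (ft btest0 s%:C * (g s)^* ))); last first.
  by move=> s _; rewrite (ftD s iH (cintegrableZ k measurableT i0)) (ftZ k s i0) mulrDl mulrA.
rewrite (cintD measurableT j1 (cintegrableZ k measurableT j0)) (cintZ k measurableT j0).
by move/eqP; rewrite addr_eq0 => /eqP ->; rewrite /k mulNr opprK.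
Qed.

(** By [defect_functional], the values of a defect vector on all [ft H] are fixed by its single
    value [T] on [btest0]. [T gdef] is nonzero, since otherwise [gdef] would annihilate a total
    family; matching [T] then determines the scalar. *)
Lemma defect_span g : defect g -> exists c, ae_equal g (fun x => c * gdef x).
Proof.
move=> kg; have k0 := gdef_defect tau kappa phi_gt0 phi_ltpi.
have [/= hg _ _] := kg; have [/= hg0 _ _] := k0.
have lg := L2_conj hg; have lg0 := L2_conj hg0.
pose T (u : R -> R[i]) := cint setT (fun s => ft btest0 s%:C * (u s)^*).
have T0 : T gdef != 0.
  apply/eqP => e; apply: gdef_neq0.
  have : ae_equal (fun s => (gdef s)^*) (fun=> 0).
    apply: (test_density lg0) => H N C1H sH.
    by rewrite (defect_functional C1H sH k0) -/(T gdef) e mulr0.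
  apply: filterS; first exact: (ae_filter_ringOfSetsType mu).
  by move=> x gx; apply: conjc_inj; rewrite gx; apply: complexP; rewrite /= ?oppr0.
pose d := T g / T gdef.
have : ae_equal (fun s => (g s)^* + (- d) * (gdef s)^* ) (fun=> 0).
  apply: test_density; first by apply: L2D => //; exact: L2Z.
  move=> H N C1H sH.
  have l := ft_L2 C1H sH.
  have j := L2_cintegrable l lg; have j0 := L2_cintegrable l lg0.
  rewrite (cint_ext (g := fun s => ft H s%:C * (g s)^* + (- d) * (ft H s%:C * (gdef s)^* ))); last first.
    by move=> s _; ring.
  rewrite (cintD measurableT j (cintegrableZ _ measurableT j0)) (cintZ _ measurableT j0).
  rewrite (defect_functional C1H sH kg) (defect_functional C1H sH k0) -/(T g) -/(T gdef).
  set X := cint _ _ / _; transitivity (X * (T g - d * T gdef)); first by ring.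
  by rewrite /d mulfVK// subrr mulr0.
(* The pairing is conjugate-linear in its second argument, so the ratio [d] of the functionals
   appears conjugated on the vectors. *)
move=> h; exists (conjc d); apply: filterS h; first exact: (ae_filter_ringOfSetsType mu).
move=> x e; apply: conjc_inj; rewrite -[RHS]/(conjc _) conjcM conjcK.
by apply/eqP; rewrite -subr_eq0 -mulNr; apply/eqP.
Qed.

Lemma defect_dim : has_dim defect 1.
Proof.
exists (fun _ => gdef); split.
- by move=> _; exact: gdef_defect.
- move=> c h k; apply/eqP; apply/negPn/negP => c0; apply: gdef_neq0.
  apply: filterS h; first exact: (ae_filter_ringOfSetsType mu).
  move=> x; rewrite big_ord1 (ord1 k) in c0 * => /eqP.
  by rewrite mulf_eq0 (negPf c0) => /eqP.
- move=> g /defect_span[c h]; exists (fun=> c).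
  apply: filterS h; first exact: (ae_filter_ringOfSetsType mu).
  by move=> x ->; rewrite big_ord1.
Qed.

End Uniqueness.

(** * Failure of self-adjointness *)

Lemma L2_normc_eq0 {R : realType} (g : R -> R[i]) : L2 g ->
  \int[@lebesgue_measure R]_x normc (g x) ^+ 2 = 0 -> ae_equal g (fun=> 0).
Proof.
move=> hg h0; have j := L2_normc_sqr hg.
pose f (x : R) : R := normc (g x) ^+ 2.
have mf : measurable_fun setT (EFin \o f) by case/integrableP: j.
have e : (\int[@lebesgue_measure R]_x `|(EFin \o f) x| = 0)%E.
  transitivity (\int[@lebesgue_measure R]_x f x)%:E; last by rewrite h0.
  rewrite /Rintegral fineK; last exact: integrable_fin_num.
  by apply: eq_integral => x _; rewrite /= ger0_norm ?sqr_ge0.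
have [N [mN N0 sub]] := (ae_eq_integral_abs (@lebesgue_measure R) measurableT mf).1 e.
exists N; split => // x /= gx; apply: sub => /= fx; apply: gx.
by move: (fx Logic.I) => [] /eqP; rewrite sqrf_eq0 => /eqP /eq0_normc.
Qed.

Lemma not_self_adjoint {R : realType} (tau phi : R) : 0 < phi -> phi < pi ->
  ~ self_adjoint (opL tau phi).
Proof.
move=> h0 h1 e; have k0 := @gdef_defect R tau phi 1 h0 h1.
have kA : opL tau phi (gdef tau phi 1, fun x => 'i * 1%:C * gdef tau phi 1 x).
  by rewrite e; exact: k0.
have [/= hg _ K] := k0.
apply: (gdef_neq0 h0 h1); apply: (L2_normc_eq0 hg).
(* The adjoint relation is tested on [g] itself and says that [i] and [- i] times the squared norm
   of [g] coincide. *)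
have := K _ _ kA; rewrite /L2_dot !cintegralE.
set g := gdef tau phi 1 in hg *.
have j := L2_cintegrable hg (L2_conj hg).
rewrite (cint_ext (g := fun x => 'i * (g x * (g x)^* ))); last by move=> x _; rewrite mulr1 mulrA.
rewrite [X in _ = X -> _](cint_ext (g := fun x => - 'i * (g x * (g x)^* ))); last first.
  move=> x _; rewrite [RHS]mulrCA; congr (_ * _); rewrite -[LHS]/(conjc _) conjcM; congr (_ * _).
  by apply: complexP; rewrite !ReImE /=; ring.
rewrite !cintZ//.
have -> : (fun x => g x * (g x)^* ) = (fun x => (normc (g x) ^+ 2)%:C).
  by apply/funext => x; apply: complexP; rewrite ?normc_sqr !ReImE /=; ring.
rewrite cint_real; set I0 := Rintegral _ _ _ => /eqP.
rewrite -subr_eq0 mulNr opprK -mulr2n mulrn_eq0 mulf_eq0 /= => /orP[|/eqP].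
  by rewrite eq_complex /= oner_eq0 andbF.
by move/(congr1 (@Re R)).
Qed.

Theorem proposition6p1 (R : realType) (tau phi : R)
    (phi_gt0 : 0 < phi) (phi_ltpi : phi < pi) :
  ~ self_adjoint (opL tau phi) /\ has_defect_indices (opL tau phi) 1 1.
Proof.
split; first exact: not_self_adjoint.
split.
  have := defect_dim tau 1 phi_gt0 phi_ltpi.
  have -> : 'i * 1%:C = 'i :> R[i] by rewrite mulr1.
  by [].
have := defect_dim tau (-1) phi_gt0 phi_ltpi.
have -> : 'i * (-1)%:C = - 'i :> R[i] by rewrite rmorphN mulrN mulr1.
by [].
Qed.
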